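(* Let $\varphi_0,\varphi_1\in\mathrm{Mon}_+$. Consider the functional $$\mathcal{L}(v)=\int_0^1\int_0^1 v(t,x)^2+\tfrac14(\partial_x v(t,x))^2\,dx\,dt$$ on the set of time-dependent vector fields $v\in L^2([0,1],H^1_0([0,1]))$ (so $v(t,0)=v(t,1)=0$) for which there exists a Lagrangian flow $\varphi$ associated with $v$ satisfying $\varphi(0,\cdot)=\varphi_0$ and $\varphi(1,\cdot)=\varphi_1$. Then this set is nonempty and $\mathcal{L}$ admits a minimizer on it. Moreover, denoting by $d(\varphi_0,\varphi_1)^2$ the minimum value, $d$ is a distance on $\mathrm{Mon}_+$ (in particular $d(\varphi_0,\varphi_1)=0$ iff $\varphi_0(x)=\varphi_1(x)$ for every $x\in[0,1]$), it is right-invariant in the sense that $d(\varphi_0\circ\psi,\varphi_1\circ\psi)=d(\varphi_0,\varphi_1)$ for every smooth increasing diffeomorphism $\psi$ of $[0,1]$, and $(\mathrm{Mon}_+,d)$ is a complete metric space.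
   Context: $\mathrm{Mon}_+$ denotes the set of nondecreasing functions $f:[0,1]\to[0,1]$ with $f(0)=0$ and $f(1)=1$. Definition (Lagrangian flow): let $v\in L^1([0,1],C([0,1]))$. A map $\varphi:[0,1]\times[0,1]\to[0,1]$, $(t,x)\mapsto\varphi(t,x)$ (first variable time, second variable space), is a Lagrangian flow associated with $v$ if (i) $x\mapsto\varphi(t,x)$ is nondecreasing for every $t$, and (ii) for every $x$ the map $t\mapsto\varphi(t,x)$ is absolutely continuous and $\varphi(t,x)-\varphi(s,x)=\int_s^t v(r,\varphi(r,x))\,dr$ for all $0\le s<t\le 1$. Lagrangian flows need not be unique for a given $v$. *)

(* Defs.v *)
From HB Require Import structures.
From mathcomp Require Import all_boot all_order all_algebra.
From mathcomp Require Import all_classical all_reals all_analysis.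
Set Implicit Arguments. Unset Strict Implicit. Unset Printing Implicit Defensive.
Import Order.TTheory GRing.Theory Num.Theory.
Import numFieldNormedType.Exports.
Local Open Scope classical_set_scope.
Local Open Scope ring_scope.

Section Defs.
Variable R : realType.
Local Notation mu := (@lebesgue_measure R).
Local Notation I01 := (`[0%R, 1%R]%classic : set R).

(* Mon_+ : nondecreasing maps [0,1] -> [0,1] with f 0 = 0, f 1 = 1
   (functions R -> R, only their values on [0,1] matter). *)
Definition Monp (f : R -> R) : Prop :=
  [/\ f 0 = 0, f 1 = 1,
      (forall x, x \in `[0, 1] -> f x \in `[0, 1]) &
      {in `[0, 1] &, forall x y, x <= y -> f x <= f y}].

Definition abs_continuous_on (a b : R) (f : R -> R) : Prop :=
  forall e : R, 0 < e -> exists2 d : R, 0 < d &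
    forall (n : nat) (s t : nat -> R),
      (forall i, (i < n)%N -> a <= s i /\ s i <= t i /\ t i <= b) ->
      (forall i j, (i < j < n)%N -> t i <= s j) ->
      \sum_(i < n) (t i - s i) < d ->
      \sum_(i < n) `|f (t i) - f (s i)| < e.

Definition LagFlow (v phi : R -> R -> R) : Prop :=
  [/\ (forall t x, t \in `[0, 1] -> x \in `[0, 1] -> phi t x \in `[0, 1]),
      (forall t, t \in `[0, 1] ->
         {in `[0, 1] &, forall x y, x <= y -> phi t x <= phi t y}) &
      (forall x, x \in `[0, 1] ->
         [/\ abs_continuous_on 0 1 (fun t => phi t x),
             mu.-integrable I01 (fun r => (v r (phi r x))%:E) &
             forall s t, 0 <= s -> s < t -> t <= 1 ->
               ((phi t x - phi s x)%:E =
                 \int[mu]_(r in `[s, t]%classic) (v r (phi r x))%:E)%E])].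

(* v in L^2([0,1], H^1_0([0,1])), given with its spatial derivative dv:
   dv is jointly (Borel) measurable and square integrable on [0,1]^2, and
   for every t in [0,1], v t x = int_0^x dv t y on [0,1] with v t 1 = 0. *)
Definition H10field (v dv : R -> R -> R) : Prop :=
  [/\ measurable_fun (I01 `*` I01) (fun p : R * R => dv p.1 p.2),
      (\int[mu]_(t in I01) \int[mu]_(x in I01) ((dv t x) ^+ 2)%:E < +oo)%E,
      (forall t, t \in `[0, 1] -> mu.-integrable I01 (fun y => (dv t y)%:E)),
      (forall t x, t \in `[0, 1] -> x \in `[0, 1] ->
         ((v t x)%:E = \int[mu]_(y in `[0%R, x]%classic) (dv t y)%:E)%E) &
      (forall t, t \in `[0, 1] -> v t 1 = 0)].

Definition Lenergy (v dv : R -> R -> R) : \bar R :=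
  (\int[mu]_(t in I01) \int[mu]_(x in I01)
      ((v t x) ^+ 2 + (dv t x) ^+ 2 / 4)%:E)%E.

Definition Admissible (phi0 phi1 : R -> R) (v dv : R -> R -> R) : Prop :=
  H10field v dv /\
  exists phi : R -> R -> R, [/\ LagFlow v phi,
    (forall x, x \in `[0, 1] -> phi 0 x = phi0 x) &
    (forall x, x \in `[0, 1] -> phi 1 x = phi1 x)].

Definition dMon (phi0 phi1 : R -> R) : R :=
  Num.sqrt (fine (ereal_inf
    ((fun vd : (R -> R -> R) * (R -> R -> R) => Lenergy vd.1 vd.2) @`
       [set vd | Admissible phi0 phi1 vd.1 vd.2]))).

Definition SmoothIncDiffeo (psi : R -> R) : Prop :=
  [/\ psi 0 = 0, psi 1 = 1,
      (forall (n : nat) x, x \in `[0, 1] -> derivable (derive1n n psi) x 1) &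
      (forall x, x \in `[0, 1] -> 0 < derive1 psi x)].

End Defs.

(* Main.v *)
Require Import Defs.
From HB Require Import structures.
From mathcomp Require Import all_boot all_order all_algebra.
From mathcomp Require Import all_classical all_reals all_analysis.
From mathcomp Require Import measurable_realfun ring lra zify.
Import Order.TTheory GRing.Theory Num.Theory.
Import numFieldNormedType.Exports.
Local Open Scope classical_set_scope.
Local Open Scope ring_scope.

Set Implicit Arguments.
Unset Strict Implicit.
Unset Printing Implicit Defensive.

(* Since v t x is the integral of dv t over [0, x], the increment of a flow line
   c over ]s, t] is the integral of dv over the region below the graph of c.
   Such regions have area at most t - s, so an energy bound makes flow lines
   equi-Hoelder in time, and bounds the uniform distance between the two ends
   of a flow by a multiple of the square root of its energy. Along an
   ultrafilter, fields of bounded energy converge weakly in L^2 and their flows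
   converge uniformly in time; the regions then converge in measure, so the
   limit flow is a flow of the limit field, whose energy is at most the limit
   energy. This one compactness statement yields minimizers and, by letting the
   end map converge, completeness.

   For nonemptiness, step maps are joined by moving their values along a smooth
   interpolation with a velocity that is affine between consecutive values; the
   energy is bounded independently of the steps, and general maps are limits of
   step maps. Reversing time gives symmetry, concatenating rescaled flows the
   triangle inequality, and a field has flow phi o psi whenever it has flow phi,
   which gives right invariance. *)

(** * Ultrafilter limits and square integrable functions *)

(** The obstacle is that velocities converge only weakly while they are evaluated along moving
    curves, so the limit cannot be taken in [v r (phi r x)]. Written as an area integral, an
    increment is a weakly convergent function tested against an indicator, up to a small change of
    region. Lagrangian flows need not be unique, but admissibility only asks for one: a flow is
    chosen for each field and the limit of the chosen flows serves.

    An ultrafilter is used rather than subsequences because limits are needed at once for the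
    integrals over all measurable sets and for all points of all flow lines: every bounded family
    converges along the same [U], with no diagonal extraction.

    Instead of Cauchy-Schwarz, the estimates use [K / 2 * a + (2 * K)^-1 * E] with [K] free. This is
    linear in the area [a] and in the energy [E], so it can be summed over disjoint intervals and no
    square root appears. *)

Lemma fmap_ultra (X Y : Type) (F : set_system X) (f : X -> Y) :
  UltraFilter F -> UltraFilter (f @ F).
Proof.
move=> FU; split => [|G GP FG]; first exact: fmap_proper_filter.
rewrite eqEsubset; split => // A GA.
have [//|FA] := in_ultra_setVsetC (f @^-1` A) FU.
have /(filterI GA) : G (~` A) by exact: FG.
by rewrite setICr => /filter_not_empty.
Qed.

Lemma ultra_bounded_cvg (R : realType) (I : Type) (U : set_system I) (x : I -> R)
    (M : R) : UltraFilter U -> (forall n, `|x n| <= M) ->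
  x @ U --> lim (x @ U) /\ `|lim (x @ U)| <= M.
Proof.
move=> UU xM.
have xU : UltraFilter (x @ U) by exact: fmap_ultra.
have := @segment_compact R (- M) M; rewrite compact_ultra => /(_ _ xU).
case.
  by apply: (@filterE _ U) => n /=; rewrite in_itv/= -ler_norml.
move=> l [/=]; rewrite in_itv/= -ler_norml => lM xl.
by rewrite (cvg_lim _ xl).
Qed.

Section L2.
Context d (T : measurableType d) (R : realType).
Variable m : {measure set T -> \bar R}.
Implicit Types (f g h : T -> R) (D A : set T).

Definition L2bound f (E : R) :=
  measurable_fun [set: T] f /\ (\int[m]_x (f x ^+ 2)%:E <= E%:E)%E.

Lemma norm_le_sqr (y K : R) : 0 < K -> `|y| <= K / 2 + (2 * K)^-1 * y ^+ 2.
Proof.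
move=> K0; rewrite -[y ^+ 2]real_normK ?num_real//; set z := `|y|.
have -> : K / 2 + (2 * K)^-1 * z ^+ 2 = z + (2 * K)^-1 * (z - K) ^+ 2.
  by field; rewrite gt_eqF.
by rewrite lerDl mulr_ge0 ?sqr_ge0// invr_ge0; lra.
Qed.

Lemma L2bound_ge0 f E : L2bound f E -> 0 <= E.
Proof.
by move=> [_ fE]; rewrite -lee_fin (le_trans _ fE)// integral_ge0// => x _;
  rewrite lee_fin sqr_ge0.
Qed.

(** Young's inequality [norm_le_sqr] integrated over [D]. The infimum over [K] of the right-hand
    side is the Cauchy-Schwarz bound, the square root of [a * E]. *)
Lemma L2bound_norm_integral f E D (a K : R) : L2bound f E -> measurable D ->
    (m D <= a%:E)%E -> 0 < K ->
  (\int[m]_(x in D) `|f x|%:E <= (K / 2 * a + (2 * K)^-1 * E)%:E)%E.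
Proof.
move=> [mf fE] mD Da K0.
have mf2 : measurable_fun setT (fun x => (f x ^+ 2)%:E).
  by apply/measurable_EFinP; exact: measurable_funX.
apply: (@le_trans _ _
  (\int[m]_(x in D) ((K / 2)%:E + ((2 * K)^-1)%:E * (f x ^+ 2)%:E)))%E.
  apply: ge0_le_integral => //.
  - apply/measurable_EFinP; apply: measurableT_comp => //.
    exact: measurable_funTS.
  - apply: emeasurable_funD => //.
    by apply: measurable_funeM; exact: measurable_funTS.
  - by move=> x _; rewrite -EFinM -EFinD lee_fin norm_le_sqr.
rewrite ge0_integralD//; last first.
  by apply: measurable_funeM; exact: measurable_funTS.
  by move=> x _; rewrite lee_fin mulr_ge0 ?sqr_ge0// invr_ge0; lra.
  by move=> x _; rewrite lee_fin; lra.
rewrite integral_cst// EFinD; apply: leeD.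
  by rewrite [leRHS]EFinM lee_wpmul2l// lee_fin; lra.
rewrite ge0_integralZl//; last 3 first.
- exact: measurable_funTS.
- by move=> x _; rewrite lee_fin sqr_ge0.
- by rewrite lee_fin invr_ge0; lra.
rewrite [leRHS]EFinM lee_wpmul2l//; first by rewrite lee_fin invr_ge0; lra.
apply: le_trans fE; apply: ge0_subset_integral => //.
by move=> x _; rewrite lee_fin sqr_ge0.
Qed.

Lemma L2bound_integrable f E D : L2bound f E -> measurable D ->
  (m D < +oo)%E -> m.-integrable D (EFin \o f).
Proof.
move=> fE mD Doo; apply/integrableP; split.
  by apply/measurable_EFinP/measurable_funTS; case: fE.
have Dfin : m D \is a fin_num by rewrite ge0_fin_numE.
have Df : (m D <= (fine (m D))%:E)%E by rewrite fineK.
by apply: le_lt_trans (L2bound_norm_integral fE mD Df ltr01) _; rewrite ltry.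
Qed.

Lemma L2bound_Rintegral f E D (a K : R) : L2bound f E -> measurable D ->
    (m D <= a%:E)%E -> 0 < K ->
  `|\int[m]_(x in D) f x| <= K / 2 * a + (2 * K)^-1 * E.
Proof.
move=> fE mD Da K0.
have Doo : (m D < +oo)%E by rewrite (le_lt_trans Da)// ltry.
have fint := L2bound_integrable fE mD Doo.
rewrite -lee_fin EFin_normr_Rintegral//.
apply: le_trans (L2bound_norm_integral fE mD Da K0).
by apply: le_abse_integral => //; case/integrableP : fint.
Qed.

Lemma integrable_EFinZ f D (c : R) : measurable D -> m.-integrable D (EFin \o f) ->
  m.-integrable D (EFin \o (fun x => c * f x)).
Proof. by move=> mD fi; exact: (integrableZl mD c fi). Qed.

Lemma integrable_EFinB f g D : measurable D -> m.-integrable D (EFin \o f) ->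
  m.-integrable D (EFin \o g) -> m.-integrable D (EFin \o (fun x => f x - g x)).
Proof. by move=> mD fi gi; exact: (integrableB mD fi gi). Qed.

End L2.

(** * Weak compactness of bounded sets of L^2 *)

Section weak_compactness.
Context d (T : measurableType d) (R : realType).
Variable m : {sigma_finite_measure set T -> \bar R}.
Variables (I : Type) (U : set_system I) (f : I -> T -> R) (E : R) (Q : set T).
Hypothesis UU : UltraFilter U.
Hypothesis fE : forall n, L2bound m (f n) E.
Hypothesis mQ : measurable Q.
Hypothesis Qoo : (m Q < +oo)%E.

Let muQ A := fine (m (A `&` Q)).

Let finQ A : measurable A -> m (A `&` Q) = (muQ A)%:E.
Proof.
move=> mA; rewrite fineK// ge0_fin_numE//; apply: le_lt_trans Qoo.
by apply: le_measure; rewrite ?inE//; exact: measurableI.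
Qed.

Let a n A := \int[m]_(x in A `&` Q) f n x.

Let a_bound n A (K : R) : measurable A -> 0 < K ->
  `|a n A| <= K / 2 * muQ A + (2 * K)^-1 * E.
Proof.
move=> mA K0; apply: (L2bound_Rintegral (fE n)) => //; first exact: measurableI.
by rewrite le_eqVlt; apply/orP; left; apply/eqP; exact: finQ.
Qed.

(** The cut by [Q] inside [a] gives every measurable set a finite measure [muQ], as the bound on [a]
    requires. *)
Definition ultra_charge A : \bar R := (lim ((fun n => a n A) @ U))%:E.

Let nu_cvg A : measurable A -> (fun n => a n A) @ U --> fine (ultra_charge A).
Proof.
by move=> mA; have [] := ultra_bounded_cvg UU (fun n => a_bound n mA ltr01).
Qed.

Let nu_bound A (K : R) : measurable A -> 0 < K ->
  `|fine (ultra_charge A)| <= K / 2 * muQ A + (2 * K)^-1 * E.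
Proof.
by move=> mA K0; have [] := ultra_bounded_cvg UU (fun n => a_bound n mA K0).
Qed.

Let nuU A B : measurable A -> measurable B -> A `&` B = set0 ->
  ultra_charge (A `|` B) = (ultra_charge A + ultra_charge B)%E.
Proof.
move=> mA mB AB; rewrite -EFinD; congr EFin.
apply: (@cvg_unique _ (@Rhausdorff R) ((fun n => a n (A `|` B)) @ U)).
  by apply: (nu_cvg (measurableU _ _ mA mB)).
rewrite (_ : (fun n => _) = (fun n => a n A + a n B)).
  by apply: cvgD; exact: nu_cvg.
apply/funext => n; rewrite /a setIUl Rintegral_setU//.
- exact: measurableI.
- exact: measurableI.
- apply: (L2bound_integrable (fE n)).
    by apply: measurableU; exact: measurableI.
  apply: le_lt_trans Qoo; rewrite -setIUl; apply: le_measure; rewrite ?inE//.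
  by apply: measurableI => //; exact: measurableU.
- apply/disj_setPS => x [[Ax _] [Bx _]].
  by have : (A `&` B) x by []; rewrite AB.
Qed.

Let nu0 : ultra_charge set0 = 0%E.
Proof.
rewrite /ultra_charge (_ : (fun n => _) = (fun=> 0)); first by rewrite lim_cst.
by apply/funext => n; rewrite /a set0I Rintegral_set0.
Qed.

Let nu_fin A : measurable A -> ultra_charge A \is a fin_num.
Proof. by []. Qed.

Let nu_sigma : semi_sigma_additive ultra_charge.
Proof.
move=> F mF tF mUF.
pose B n := \big[setU/set0]_(i < n) F i.
have mB n : measurable (B n) by exact: bigsetU_measurable.
have sumE n : (\sum_(0 <= i < n) ultra_charge (F i) = ultra_charge (B n))%E.
  elim: n => [|n IH]; first by rewrite big_geq// /B big_ord0 nu0.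
  have -> : B n.+1 = B n `|` F n by rewrite /B big_ord_recr.
  rewrite big_nat_recr//= IH; apply/esym/nuU => //.
  apply/seteqP; split => // x [].
  rewrite /B -bigcup_mkord => -[k /= kn Fk Fn].
  have kE := tF k n Logic.I Logic.I (ex_intro _ x (conj Fk Fn)).
  by rewrite kE ltnn in kn.
have BX n : B n `<=` \bigcup_k F k by exact: bigsetU_bigcup.
(* Finite additivity reduces countable additivity to the vanishing of the charge on the tails, whose
   measure tends to 0. *)
have splitX n : fine (ultra_charge (\bigcup_k F k)) - fine (ultra_charge (B n)) =
    fine (ultra_charge ((\bigcup_k F k) `\` B n)).
  have -> : ultra_charge (\bigcup_k F k) = (ultra_charge (B n) +
      ultra_charge ((\bigcup_k F k) `\` B n))%E.
    rewrite -nuU//; [by rewrite setDUK|exact: measurableD|].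
    by rewrite setDE setICA setICr setI0.
  by rewrite fineD// addrAC subrr add0r.
have mucvg : (fun n => muQ ((\bigcup_k F k) `\` B n)) @ \oo --> (0 : R).
  have : (fun n => m (((\bigcup_k F k) `\` B n) `&` Q)) @ \oo --> m set0.
    have <- : \bigcap_n (((\bigcup_k F k) `\` B n) `&` Q) = set0.
      apply/seteqP; split => // x /= H.
      have [[[k _ Fkx] _] _] := H 0%N Logic.I.
      have [[_ nB] _] := H k.+1 Logic.I; apply: nB.
      by rewrite /B big_ord_recr/=; right.
    apply: nonincreasing_cvg_mu.
    - by apply: le_lt_trans Qoo; apply: le_measure; rewrite ?inE//;
        apply: measurableI => //; exact: measurableD.
    - by move=> i; apply: measurableI => //; exact: measurableD.
    - apply: bigcap_measurable; first by exists 0%N.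
      by move=> i _; apply: measurableI => //; exact: measurableD.
    - move=> p q pq; apply/subsetPset; apply: setSI; apply: setDS.
      exact: subset_bigsetU.
  by rewrite measure0 => /fine_cvg.
under eq_fun do rewrite sumE.
apply/cvg_EFin; first by apply: nearW => n.
apply/cvgrPdist_le => /= e e0.
have E0 : 0 <= E by have [n _] := filter_ex (filterT : U setT); exact: L2bound_ge0 (fE n).
(* With this [K] the energy term of [nu_bound] is at most [e / 2] whatever the set; the [+ 1] keeps
   [K] positive when [E = 0]. *)
pose K := E / e + 1.
have K0 : 0 < K by rewrite ltr_pwDr// divr_ge0// ltW.
have Kd0 : 0 < e / K by rewrite divr_gt0.
move/cvgrPdist_le : mucvg => /(_ _ Kd0); apply: filterS => n /=.
rewrite sub0r normrN ger0_norm ?fine_ge0// => muK.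
rewrite [_ - _]splitX.
apply: le_trans (nu_bound (measurableD mUF (mB n)) K0) _.
have -> : e = K / 2 * (e / K) + e / 2 by field; rewrite gt_eqF.
apply: lerD; first by rewrite ler_pM2l// divr_gt0.
rewrite mulrC ler_pdivrMr ?mulr_gt0//.
have -> : e / 2 * (2 * K) = E + e by rewrite /K; field; rewrite gt_eqF.
by rewrite lerDl ltW.
Qed.

HB.instance Definition _ := isCharge.Build _ T R ultra_charge nu0 nu_fin nu_sigma.

(** On a null set only the energy term of [nu_bound] remains, and it is as small as desired for
    large [K]. *)
Let nu_dom : ultra_charge `<< m.
Proof.
move=> N mN A mA AN.
have mA0 : muQ A = 0.
  by rewrite /muQ (mN (A `&` Q)) ?fine0//; [exact: measurableI|by move=> x [/AN]].
have E0 : 0 <= E by have [n _] := filter_ex (filterT : U setT); exact: L2bound_ge0 (fE n).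
rewrite -[LHS]fineK ?nu_fin//; congr EFin; apply/eqP; rewrite -normr_le0.
apply/ler_addgt0Pl => e e0; rewrite addr0.
have K0 : 0 < E / e + 1 by rewrite ltr_pwDr// divr_ge0// ltW.
apply: le_trans (nu_bound mA K0) _; rewrite mA0 mulr0 add0r mulrC.
rewrite ler_pdivrMr ?mulr_gt0//.
have -> : e * (2 * (E / e + 1)) = 2 * E + 2 * e by field; rewrite gt_eqF.
by lra.
Qed.

(* The ultrafilter limits of the integrals over each set form a charge,
   absolutely continuous by the energy bound; g is its Radon-Nikodym derivative. *)
Lemma L2_weak_compact : exists g : T -> R,
  [/\ measurable_fun [set: T] g, m.-integrable [set: T] (EFin \o g),
      (forall x, ~ Q x -> g x = 0) &
      forall A, measurable A -> A `<=` Q ->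
        (fun n => \int[m]_(x in A) f n x) @ U --> \int[m]_(x in A) g x].
Proof.
pose g0 := Radon_Nikodym ultra_charge m.
have g0fin x : g0 x \is a fin_num by exact: Radon_Nikodym_fin_num nu_dom.
have ig0 : m.-integrable [set: T] g0 by exact: Radon_Nikodym_integrable nu_dom.
have ig1 : m.-integrable [set: T] (EFin \o (fine \o g0)).
  by apply: eq_integrable ig0 => // x _ /=; rewrite fineK.
exists ((fine \o g0) \_ Q); split.
- apply/(measurable_restrictT _ mQ)/measurable_funTS/measurable_EFinP.
  exact: (measurable_int m).
- have -> : EFin \o ((fine \o g0) \_ Q) = (EFin \o (fine \o g0)) \_ Q.
    by rewrite restrict_EFin.
  by apply/(integrable_mkcond _ mQ); exact: integrableS ig1.
- by move=> x Qx; rewrite /patch memNset.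
move=> A mA AQ.
have := nu_cvg mA; rewrite (Radon_Nikodym_integral nu_dom mA) -/g0.
rewrite (_ : (fun n => a n A) = fun n => \int[m]_(x in A) f n x).
  have -> // : fine (\int[m]_(x in A) g0 x)%E = \int[m]_(x in A) ((fine \o g0) \_ Q) x.
  rewrite /Rintegral; congr fine.
  apply: eq_integral => x xA; rewrite /patch mem_set; last exact/AQ/set_mem.
  by rewrite /= fineK.
by apply/funext => n; rewrite /a setIidl.
Qed.

End weak_compactness.

(** The integer part counts the positive integers up to [y]: rounding down thus becomes a sum of
    indicators of superlevel sets. *)
Lemma count_lt_truncn (R : realType) (y : R) (N : nat) :
  (\sum_(k < N) (k.+1%:R <= y)%R = minn N (Num.truncn y))%N.
Proof.
elim: N => [|N IH]; first by rewrite big_ord0 min0n.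
rewrite big_ord_recr/= IH -truncn_gt_nat.
by case: ltnP => NT; lia.
Qed.

(** * Weak limits against bounded functions and lower semicontinuity *)

Section weak_limit.
Context d (T : measurableType d) (R : realType).
Variable m : {measure set T -> \bar R}.
Variables (I : Type) (U : set_system I) (f : I -> T -> R) (g : T -> R) (E : R)
  (Q : set T).
Hypothesis UU : UltraFilter U.
Hypothesis fE : forall n, L2bound m (f n) E.
Hypothesis mQ : measurable Q.
Hypothesis Qoo : (m Q < +oo)%E.
Hypothesis ig : m.-integrable Q (EFin \o g).
Hypothesis fg : forall A, measurable A -> A `<=` Q ->
  (fun n => \int[m]_(x in A) f n x) @ U --> \int[m]_(x in A) g x.

Lemma integrable_mul_bounded (u h : T -> R) (M : R) : m.-integrable Q (EFin \o u) ->
  measurable_fun Q h -> (forall x, Q x -> `|h x| <= M) ->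
  m.-integrable Q (EFin \o (fun x => u x * h x)).
Proof.
move=> iu mh hM.
have iM : m.-integrable Q (fun x => M%:E * (EFin \o u) x)%E by exact: integrableZl.
apply: le_integrable iM => //.
  apply/measurable_EFinP; apply: measurable_funM => //.
  exact/measurable_EFinP/(measurable_int m).
move=> x Qx; rewrite -EFinM !abse_EFin lee_fin !normrM mulrC ler_wpM2r//.
by rewrite (le_trans (hM _ Qx))// ler_norm.
Qed.

Lemma Rintegral_mul_bounded (u h : T -> R) (M : R) : m.-integrable Q (EFin \o u) ->
  measurable_fun Q h -> (forall x, Q x -> `|h x| <= M) ->
  `|\int[m]_(x in Q) (u x * h x)| <= M * \int[m]_(x in Q) `|u x|.
Proof.
move=> iu mh hM.
have iuh := integrable_mul_bounded iu mh hM.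
apply: (le_trans (le_normr_Rintegral mQ iuh)).
rewrite -RintegralZl//; last exact: integrable_norm.
apply: le_Rintegral => //.
- exact: integrable_norm.
- by apply: integrable_EFinZ => //; exact: integrable_norm.
- by move=> x Qx; rewrite normrM mulrC ler_wpM2r// hM.
Qed.

(** The admissible test functions: indicators of measurable sets, then bounded linear combinations,
    then uniform limits. *)
Let P h := (fun n => \int[m]_(x in Q) (f n x * h x)) @ U -->
  \int[m]_(x in Q) (g x * h x).

Let if_ n : m.-integrable Q (EFin \o f n).
Proof. exact: (L2bound_integrable (fE n)). Qed.

Let P_zero : P (fun=> 0).
Proof.
have R0 (u : T -> R) : \int[m]_(x in Q) (u x * 0) = 0.
  by rewrite /Rintegral integral0_eq// => x _; rewrite mulr0.
by rewrite /P R0; under eq_fun do rewrite R0; exact: cvg_cst.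
Qed.

Let P_indic A : measurable A -> P (\1_A).
Proof.
move=> mA.
have E0 (u : T -> R) : \int[m]_(x in Q) (u x * \1_A x) = \int[m]_(x in Q `&` A) u x.
  rewrite Rintegral_mkcondr; apply: eq_Rintegral => x _.
  rewrite /patch indicE; case: ifP => _; first by rewrite mulr1.
  by rewrite mulr0.
rewrite /P E0; under eq_fun do rewrite E0.
by apply: fg; [exact: measurableI|exact: subIsetl].
Qed.

Let P_lin (c : R) (h1 h2 : T -> R) (M1 M2 : R) : measurable_fun Q h1 -> measurable_fun Q h2 ->
  (forall x, Q x -> `|h1 x| <= M1) -> (forall x, Q x -> `|h2 x| <= M2) ->
  P h1 -> P h2 -> P (fun x => c * h1 x + h2 x).
Proof.
move=> m1 m2 b1 b2 P1 P2.
have E0 (u : T -> R) : m.-integrable Q (EFin \o u) ->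
    \int[m]_(x in Q) (u x * (c * h1 x + h2 x)) =
    c * \int[m]_(x in Q) (u x * h1 x) + \int[m]_(x in Q) (u x * h2 x).
  move=> iu; rewrite -RintegralZl//; last exact: integrable_mul_bounded b1.
  rewrite -RintegralD//.
  - by apply: eq_Rintegral => x _; ring.
  - by apply: integrable_EFinZ => //; exact: integrable_mul_bounded b1.
  - exact: integrable_mul_bounded b2.
rewrite /P E0//; under eq_fun do rewrite (E0 _ (if_ _)).
by apply: cvgD => //; exact: cvgMr.
Qed.

(** Replacing [h] by [h'] costs at most the uniform distance times an L^1 norm, and [C] bounds these
    norms for [g] and for all [f n] at once. *)
Let P_unif (h : T -> R) (M : R) : measurable_fun Q h -> (forall x, Q x -> `|h x| <= M) ->
  (forall e, 0 < e -> exists h', [/\ P h', measurable_fun Q h' &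
     forall x, Q x -> `|h x - h' x| <= e]) -> P h.
Proof.
move=> mh bh Hh.
pose C := fine (m Q) + E + \int[m]_(x in Q) `|g x| + 1.
have E0 : 0 <= E by have [n _] := filter_ex (filterT : U setT); exact: L2bound_ge0 (fE n).
have g0 : 0 <= \int[m]_(x in Q) `|g x| by apply: Rintegral_ge0.
have Q0 : 0 <= fine (m Q) by exact: fine_ge0.
have C0 : 0 < C by rewrite /C; lra.
have fC n : \int[m]_(x in Q) `|f n x| <= C.
  rewrite -lee_fin fineK; last first.
    by apply: integrable_fin_num => //; exact: integrable_norm.
  apply: (le_trans (L2bound_norm_integral (fE n) mQ (a := fine (m Q)) _ ltr01)).
    by rewrite fineK// ge0_fin_numE.
  by rewrite lee_fin /C; lra.
apply/cvgrPdist_le => /= e e0.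
have [|h' [Ph' mh' hh']] := Hh (e / (4 * C)); first by rewrite divr_gt0// mulr_gt0.
have e2 : 0 < e / 2 by lra.
have bh' x : Q x -> `|h' x| <= M + e / (4 * C).
  move=> Qx; have -> : h' x = h x - (h x - h' x) by ring.
  by rewrite (le_trans (ler_normB _ _))// lerD// ?bh ?hh'.
have ed (u : T -> R) : m.-integrable Q (EFin \o u) -> \int[m]_(x in Q) `|u x| <= C ->
    `|\int[m]_(x in Q) (u x * h x) - \int[m]_(x in Q) (u x * h' x)| <= e / 4.
  move=> iu uC; rewrite -RintegralB//.
  - rewrite (_ : \int[m]_(x in Q) (u x * h x - u x * h' x) =
        \int[m]_(x in Q) (u x * (h x - h' x))); last first.
      by apply: eq_Rintegral => x _; rewrite mulrBr.
    apply: (le_trans (Rintegral_mul_bounded iu (measurable_funB mh mh') hh')).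
    have -> : e / 4 = e / (4 * C) * C by field; rewrite gt_eqF.
    by rewrite ler_wpM2l// ltW// divr_gt0// mulr_gt0.
  - exact: integrable_mul_bounded bh.
  - exact: integrable_mul_bounded bh'.
move/cvgrPdist_le : Ph' => /(_ _ e2); apply: filterS => n /= Hn.
have gC : \int[m]_(x in Q) `|g x| <= C by rewrite /C; lra.
have := ed _ ig gC; have := ed _ (if_ n) (fC n); move: Hn.
rewrite !ler_norml => /andP[? ?] /andP[? ?] /andP[? ?]; apply/andP; split; lra.
Qed.

(** An affine change brings [h] to [k] with values in [0, 1]; rounding [k] down to multiples of
    [1 / N] is a finite combination of indicators, uniformly within [1 / N] of [k]. *)
Lemma weak_limit_bounded (h : T -> R) (M : R) : measurable_fun Q h ->
  (forall x, Q x -> `|h x| <= M) ->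
  (fun n => \int[m]_(x in Q) (f n x * h x)) @ U -->
    \int[m]_(x in Q) (g x * h x).
Proof.
move=> mh hM.
pose M' := `|M| + 1.
have M0 : 0 < M' by rewrite /M'; have := normr_ge0 M; lra.
pose k x := (h x + M') / (2 * M').
have k01 x : Q x -> 0 <= k x <= 1.
  move=> /hM; rewrite ler_norml => /andP[h1 h2].
  have := ler_norm M => MM; rewrite /k ler_pdivlMr ?mulr_gt0// mul0r.
  by rewrite ler_pdivrMr ?mulr_gt0// /M'; lra.
have mk : measurable_fun Q k.
  by apply: measurable_funM => //; apply: measurable_funD.
have Pk : P k.
  apply: (@P_unif _ 1) => //.
    by move=> x /k01/andP[? ?]; rewrite ger0_norm.
  move=> e e0.
  pose N := (Num.truncn e^-1).+1.
  have N0 : 0 < N%:R :> R by rewrite ltr0n.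
  have Ni0 : 0 <= N%:R^-1 :> R by rewrite invr_ge0 ltW.
  have Ne : N%:R^-1 <= e.
    rewrite -[leRHS]invrK lef_pV2 ?posrE ?invr_gt0//.
    by rewrite ltW// truncnS_gt.
  pose A i := Q `&` [set x | i.+1%:R <= k x * N%:R].
  have mA i : measurable (A i).
    have mkN : measurable_fun Q (fun x => k x * N%:R) by exact: measurable_funM.
    rewrite /A (_ : [set x | _] = (fun x => k x * N%:R) @^-1` `[i.+1%:R, +oo[).
      exact: mkN.
    by apply/seteqP; split => x /=; rewrite in_itv/= andbT.
  pose S j x : R := \sum_(i < j) N%:R^-1 * \1_(A i) x.
  have mS j : measurable_fun Q (S j).
    apply: measurable_sum => i; apply: measurable_funM; first exact: measurable_cst.
    exact: measurable_indic.
  have bS j x : `|S j x| <= j%:R * N%:R^-1.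
    apply: (le_trans (ler_norm_sum _ _ _)).
    have -> : j%:R / N%:R = \sum_(i < j) N%:R^-1 :> R.
      by rewrite sumr_const card_ord mulr_natl.
    apply: ler_sum => i _; rewrite normrM (ger0_norm Ni0) ler_piMr//.
    by rewrite indicE; case: (_ \in _); rewrite ?normr1 ?normr0.
  have PS j : P (S j).
    elim: j => [|j IH].
      rewrite (_ : S 0%N = fun=> 0); first exact: P_zero.
      by apply/funext => x; rewrite /S big_ord0.
    have -> : S j.+1 = fun x => N%:R^-1 * \1_(A j) x + S j x.
      by apply/funext => x; rewrite /S big_ord_recr/= addrC.
    apply: (@P_lin _ _ _ 1 (j%:R * N%:R^-1)) => //.
    - by move=> x _; rewrite indicE; case: (_ \in _); rewrite ?normr1 ?normr0.
    - exact: P_indic.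
  exists (S N); split => // x Qx.
  have /andP[k0 k1] := k01 _ Qx.
  have kN0 : 0 <= k x * N%:R by rewrite mulr_ge0.
  have -> : S N x = N%:R^-1 * (Num.truncn (k x * N%:R))%:R.
    rewrite /S -mulr_sumr; congr (_ * _).
    have tN : (Num.truncn (k x * N%:R) <= N)%N.
      rewrite truncn_le_nat; apply: (@le_lt_trans _ _ (N%:R)); last by rewrite ltr_nat.
      by rewrite ler_piMl.
    rewrite -[in RHS](minn_idPr tN).
    rewrite -count_lt_truncn natr_sum; apply: eq_bigr => i _.
    rewrite indicE /A; congr (_%:R); congr nat_of_bool.
    apply/idP/idP => [/set_mem[]//|H]; exact/mem_set.
  have -> : k x - N%:R^-1 * (Num.truncn (k x * N%:R))%:R =
      N%:R^-1 * (k x * N%:R - (Num.truncn (k x * N%:R))%:R) by field; rewrite gt_eqF.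
  have /andP[t1 t2] := truncn_itv kN0.
  rewrite ger0_norm; last by rewrite mulr_ge0// subr_ge0.
  apply: le_trans Ne; rewrite ler_piMr//.
  by move: t2; rewrite -natr1; lra.
(* On [Q] the indicator [\1_Q] stands for the constant 1 in the formula giving [h] back from [k]. *)
have PQ : P \1_Q by exact: P_indic.
have Pc : P (fun x => 2 * M' * k x + (- M') * \1_Q x).
  have bQ x : `|(\1_Q x : R)| <= 1.
    by rewrite indicE; case: (_ \in _); rewrite ?normr1 ?normr0.
  have mQ1 : measurable_fun Q (\1_Q : T -> R).
    by apply: measurable_funTS; exact: measurable_indic.
  have P0 : P (fun x => (- M') * \1_Q x + (fun=> 0) x).
    apply: (@P_lin (- M') \1_Q (fun=> 0) 1 0) => //.
    by move=> x _; rewrite normr0.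
  have E0 : (fun x => - M' * \1_Q x) = fun x => (- M') * \1_Q x + (fun=> 0) x.
    by apply/funext => x; rewrite addr0.
  apply: (@P_lin _ _ _ 1 `|M'|) => //.
  - exact: measurable_funM.
  - by move=> x /k01/andP[? ?]; rewrite ger0_norm.
  - by move=> x _; rewrite normrM normrN ler_piMr.
  - by rewrite E0.
have hE (u : T -> R) : \int[m]_(x in Q) (u x * h x) =
    \int[m]_(x in Q) (u x * (2 * M' * k x + (- M') * \1_Q x)).
  apply: eq_Rintegral => x xQ; congr (_ * _).
  by rewrite indicE xQ mulr1 /k; field; rewrite gt_eqF.
by rewrite hE; under eq_fun do rewrite hE; exact: Pc.
Qed.

(* Test against the truncations h of g: 2 (f n) h - h^2 <= (f n)^2, and the
   left-hand side tends to the integral of 2 g h - h^2 = h^2. *)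
Lemma weak_lsc (c : R) : measurable_fun Q g ->
  (\forall n \near U, (\int[m]_(x in Q) (f n x ^+ 2)%:E <= c%:E)%E) ->
  (\int[m]_(x in Q) (g x ^+ 2)%:E <= c%:E)%E.
Proof.
move=> mg fc.
pose D M := Q `&` [set x | `|g x| <= M%:R].
have mD M : measurable (D M).
  have mng : measurable_fun Q (fun x => `|g x|) by exact: measurableT_comp.
  rewrite /D (_ : [set x | _] = (fun x => `|g x|) @^-1` `]-oo, M%:R]).
    exact: mng.
  by apply/seteqP; split => x /=; rewrite in_itv.
pose h M x := g x * \1_(D M) x.
have mh M : measurable_fun Q (h M).
  by apply: measurable_funM => //; exact: measurable_indic.
have hM M x : Q x -> `|h M x| <= M%:R.
  move=> Qx; rewrite /h indicE; case: (boolP (x \in D M)) => [/set_mem[_ /=]|_].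
    by rewrite mulr1.
  by rewrite mulr0 normr0.
have ih2 M : m.-integrable Q (EFin \o (fun x => h M x * h M x)).
  apply: (integrable_mul_bounded _ (mh M) (hM M)).
  apply: (integrable_mul_bounded (M := 1) ig); first exact: measurable_indic.
  by move=> x _; rewrite indicE; case: (_ \in _); rewrite ?normr1 ?normr0.
have key M : (\int[m]_(x in Q) (h M x ^+ 2)%:E <= c%:E)%E.
  suff : \int[m]_(x in Q) (h M x * h M x) <= c.
    have hfin := integrable_fin_num mQ (ih2 M).
    rewrite /Rintegral -lee_fin (fineK hfin).
    by move=> /=; under eq_integral do rewrite -expr2.
  have gh : \int[m]_(x in Q) (h M x * h M x) = \int[m]_(x in Q) (g x * h M x).
    apply: eq_Rintegral => x _; rewrite /h indicE.
    by case: (_ \in _); rewrite ?mulr1// !mulr0.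
  have lim1 := weak_limit_bounded (mh M) (hM M).
  have lim2 : (fun n => 2 * \int[m]_(x in Q) (f n x * h M x) -
      \int[m]_(x in Q) (h M x * h M x)) @ U -->
      2 * \int[m]_(x in Q) (g x * h M x) - \int[m]_(x in Q) (h M x * h M x).
    by apply: cvgB; [exact: cvgMr|exact: cvg_cst].
  suff : 2 * \int[m]_(x in Q) (g x * h M x) - \int[m]_(x in Q) (h M x * h M x) <= c.
    by rewrite -gh; lra.
  apply: (cvgr_to_le lim2); apply: filterS fc => n fnc.
  have if2 : m.-integrable Q (EFin \o (fun x => f n x ^+ 2)).
    apply/integrableP; split.
      apply/measurable_EFinP/measurable_funX/measurable_funTS.
      by case: (fE n).
    apply: le_lt_trans (ltry c); apply: le_trans fnc.
    by under eq_integral do rewrite /= ger0_norm ?sqr_ge0//.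
  have ifh : m.-integrable Q (EFin \o (fun x => f n x * h M x)).
    exact: (integrable_mul_bounded (if_ n) (mh M) (hM M)).
  apply: (@le_trans _ _ (\int[m]_(x in Q) (f n x ^+ 2))).
    rewrite -RintegralZl// -RintegralB//; last exact: integrable_EFinZ.
    apply: le_Rintegral => //.
      by apply: integrable_EFinB => //; exact: integrable_EFinZ.
    move=> x _; rewrite -subr_ge0.
    have -> : f n x ^+ 2 - (2 * (f n x * h M x) - h M x * h M x) =
      (f n x - h M x) ^+ 2 by ring.
    exact: sqr_ge0.
  have ffin := integrable_fin_num mQ if2.
  by rewrite /Rintegral -lee_fin (fineK ffin).
have h0 M x : Q x -> (0 <= (h M x ^+ 2)%:E)%E by rewrite lee_fin sqr_ge0.
have mh2 M : measurable_fun Q (fun x => (h M x ^+ 2)%:E).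
  by apply/measurable_EFinP; exact: measurable_funX.
have hnd x : Q x -> {homo (fun M => (h M x ^+ 2)%:E) : p q / (p <= q)%N >-> (p <= q)%E}.
  move=> Qx p q pq; rewrite lee_fin /h !exprMn ler_wpM2l ?sqr_ge0// !indicE.
  case: (boolP (x \in D p)) => [/set_mem[_ /= xp]|_].
    rewrite mem_set//; split => //=; apply: le_trans xp _.
    by rewrite ler_nat.
  by rewrite expr0n/= sqr_ge0.
(* At each point the truncation is eventually inactive, so monotone convergence passes the bound
   from the [h M] to [g]. *)
have := @cvg_monotone_convergence _ _ _ m _ mQ _ mh2 h0 hnd.
have -> : (\int[m]_(x in Q) limn (fun M => (h M x ^+ 2)%:E) =
    \int[m]_(x in Q) (g x ^+ 2)%:E)%E; last first.
  by move=> /cvge_to_le; apply; exact: nearW.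
apply: eq_integral => x /set_mem Qx; apply/cvg_lim => //.
apply: cvg_near_cst; near=> M.
rewrite /h indicE mem_set ?mulr1//; split => //=.
near: M; exists (Num.truncn `|g x|).+1 => // M /= gM.
by rewrite ltW// (lt_le_trans (truncnS_gt _))// ler_nat.
Unshelve. all: by end_near. Qed.

End weak_limit.

(** * The unit square and velocities in H^1_0 *)

Section unit_square.
Variable R : realType.
Local Notation mu := (@lebesgue_measure R).
Local Notation X := (measurableTypeR R).
Local Notation I01 := (`[0%R, 1%R]%classic : set X).
Implicit Types (f v dv : R -> R -> R) (g : X * X -> R) (c : R -> R) (s t x : R).

Definition square : set (X * X) := I01 `*` I01.

Definition mu2 : {measure set (X * X)%type -> \bar R} := (mu \x mu)%E.

Lemma mu2X (A B : set X) : measurable A -> measurable B ->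
  (mu2 (A `*` B) = mu A * mu B)%E.
Proof. exact: product_measure1E. Qed.

Lemma mu2_tonelli (F : X * X -> \bar R) : measurable_fun [set: X * X] F ->
  (forall p, 0 <= F p)%E -> (\int[mu2]_p F p = \int[mu]_x \int[mu]_y F (x, y))%E.
Proof. exact: fubini_tonelli1. Qed.

Lemma mu2_tonelli_measurable (F : X * X -> \bar R) : measurable_fun [set: X * X] F ->
  (forall p, 0 <= F p)%E ->
  measurable_fun [set: X] (fun x => \int[mu]_y F (x, y))%E.
Proof. exact: measurable_fun_fubini_tonelli_F. Qed.

Lemma mu2_fubini (F : X * X -> \bar R) : mu2.-integrable [set: X * X] F ->
  (\int[mu2]_p F p = \int[mu]_x \int[mu]_y F (x, y))%E.
Proof. by move=> iF; apply/esym; exact: (integral12_prod_meas1 iF). Qed.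

Lemma mu2_fubini_integrable (F : X * X -> \bar R) : mu2.-integrable [set: X * X] F ->
  mu.-integrable [set: X] (fun x => \int[mu]_y F (x, y))%E.
Proof. exact: integrable_fubini_F. Qed.

Lemma measurable_itvX (i : interval R) : measurable ([set` i]%classic : set X).
Proof. exact: measurable_itv. Qed.

Lemma mu_I01 : mu I01 = 1%E.
Proof. by rewrite lebesgue_measure_itv/= lte_fin ltr01 oppr0 addr0. Qed.

Lemma I01E t : I01 t = (0 <= t <= 1) :> Prop.
Proof. by rewrite /= in_itv. Qed.

Lemma measurable_square : measurable square.
Proof. by apply: measurableX; exact: measurable_itv. Qed.

Lemma mu2_square : mu2 square = 1%E.
Proof.
rewrite /square mu2X; [|exact: measurable_itv..].
by rewrite mu_I01 mul1e.
Qed.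

Lemma mu2_square_lty : (mu2 square < +oo)%E.
Proof. by rewrite mu2_square ltry. Qed.

(** Extension by zero: the values of a field outside the square are arbitrary, and integrals over
    the whole plane fit the product measure directly. *)
Definition ext f : X * X -> R := (fun p => f p.1 p.2) \_ square.

Lemma ext_in f t x : 0 <= t <= 1 -> 0 <= x <= 1 -> ext f (t, x) = f t x.
Proof. by move=> t01 x01; rewrite /ext /patch mem_set//; split; rewrite I01E. Qed.

Lemma ext_out f p : ~ square p -> ext f p = 0.
Proof. by move=> p0; rewrite /ext /patch memNset. Qed.

Lemma measurable_ext f : measurable_fun square (fun p : X * X => f p.1 p.2) ->
  measurable_fun [set: X * X] (ext f).
Proof. by move=> mf; apply/(measurable_restrictT _ measurable_square). Qed.

Lemma ge0_integral_square (F : R -> R -> \bar R) :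
  measurable_fun [set: X * X] (fun p => F p.1 p.2) ->
  (forall t x, (0 <= F t x)%E) ->
  (forall t x, ~ (0 <= t <= 1) \/ ~ (0 <= x <= 1) -> F t x = 0%E) ->
  (\int[mu2]_p F p.1 p.2 = \int[mu]_(t in I01) \int[mu]_(x in I01) F t x)%E.
Proof.
move=> mF F0 Fout; rewrite (mu2_tonelli mF)//.
rewrite [RHS]integral_mkcond; apply: eq_integral => t _ /=.
rewrite /patch; case: ifPn => tI.
  rewrite [RHS]integral_mkcond; apply: eq_integral => x _ /=.
  rewrite /patch; case: ifPn => // xI; rewrite Fout//; right => x01.
  by move: xI; rewrite mem_set// I01E.
rewrite integral0_eq// => x _ /=; rewrite Fout//; left => t01.
by move: tI; rewrite mem_set// I01E.
Qed.

Lemma integral_ext_sqr f : measurable_fun square (fun p : X * X => f p.1 p.2) ->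
  (\int[mu2]_p (ext f p ^+ 2)%:E =
   \int[mu]_(t in I01) \int[mu]_(x in I01) (f t x ^+ 2)%:E)%E.
Proof.
move=> mf.
rewrite (_ : (fun p => _) = fun p => (fun t x => (ext f (t, x) ^+ 2)%:E) p.1 p.2);
  last by rewrite funeqE => -[].
rewrite (ge0_integral_square (F := fun t x => (ext f (t, x) ^+ 2)%:E)).
- apply: eq_integral => t /set_mem; rewrite I01E => t01.
  apply: eq_integral => x /set_mem; rewrite I01E => x01.
  by rewrite ext_in.
- apply/measurable_EFinP/measurable_funX.
  rewrite (_ : (fun _ => _) = ext f); first exact: measurable_ext.
  by apply/funext => -[].
- by move=> t x; rewrite lee_fin sqr_ge0.
- move=> t x tx; rewrite ext_out ?expr0n// => -[] /=; rewrite !in_itv/= => t01 x01.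
  by case: tx.
Qed.

(** Half-open in time, like the stripes whose energies add up; closed in space, to match the
    interval [[0, x]] of [H10field]. *)
Definition region s t c : set (X * X) :=
  [set p | s < p.1 <= t /\ 0 <= p.2 <= c p.1].

Lemma measurable_region s t c : measurable_fun [set: X] c ->
  measurable (region s t c).
Proof.
move=> mc.
have -> : region s t c = (`]s, t] `*` `[0, +oo[) `&`
    ((fun p : X * X => c p.1 - p.2) @^-1` `[0, +oo[).
  apply/seteqP; split => -[r y] /=; rewrite !in_itv/= !andbT.
    by move=> [-> /andP[-> ryc]]; rewrite subr_ge0.
  by rewrite subr_ge0 => -[[srt y0] yc]; split => //=; rewrite y0.
apply: measurableI; first by apply: measurableX; exact: measurable_itv.
rewrite -[X in measurable X]setTI.
have mf : measurable_fun [set: X * X] (fun p : X * X => c p.1 - p.2).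
  apply: measurable_funB => //; apply: measurableT_comp => //.
by apply: mf => //; exact: measurable_itv.
Qed.

Lemma mu2_region_le s t c : measurable_fun [set: X] c -> s <= t ->
  (mu2 (region s t c `&` square) <= (t - s)%:E)%E.
Proof.
move=> mc st.
have -> : (t - s)%:E = mu2 (`]s, t] `*` I01).
  rewrite mu2X; [|exact: measurable_itv..].
  rewrite !lebesgue_measure_itv/= !lte_fin ltr01 oppr0 addr0 mule1.
  by move: st; rewrite le_eqVlt => /predU1P[->|->//]; rewrite ltxx subrr.
apply: le_measure; rewrite ?inE.
- by apply: measurableI; [exact: measurable_region|exact: measurable_square].
- by apply: measurableX; exact: measurable_itv.
- by move=> p /= [[p1 _] [_]] /=; rewrite !in_itv/=.
Qed.

(** * The velocity along a curve as a slice integral *)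

Section H10.
Variables (v dv : R -> R -> R).
Hypothesis H : H10field v dv.

Let mdv : measurable_fun square (fun p : X * X => dv p.1 p.2).
Proof. by case: H. Qed.

Let g := ext dv.

Lemma H10_L2bound (E : R) :
  (\int[mu]_(t in I01) \int[mu]_(x in I01) (dv t x ^+ 2)%:E <= E%:E)%E ->
  L2bound mu2 g E.
Proof. by move=> dvE; split; [exact: measurable_ext|rewrite integral_ext_sqr]. Qed.

Lemma H10_L2bound_ex : exists E : R, L2bound mu2 g E.
Proof.
case: H => _ dvoo _ _ _.
exists (fine (\int[mu]_(t in I01) \int[mu]_(x in I01) ((dv t x) ^+ 2)%:E)%E).
apply: H10_L2bound; rewrite fineK// ge0_fin_numE//.
by apply: integral_ge0 => t _; apply: integral_ge0 => x _; rewrite lee_fin sqr_ge0.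
Qed.

Lemma H10_integrable A : measurable A ->
  mu2.-integrable [set: X * X] (EFin \o (g \_ A)).
Proof.
move=> mA; have [E gE] := H10_L2bound_ex.
have ig : mu2.-integrable square (EFin \o g).
  by apply: (L2bound_integrable gE measurable_square); exact: mu2_square_lty.
have igT : mu2.-integrable [set: X * X] (EFin \o g).
  apply/integrableP; split; first by apply/measurable_EFinP; case: gE.
  case/integrableP : ig => _; apply: le_lt_trans.
  rewrite [leRHS]integral_mkcond; apply: ge0_le_integral => //.
  - by apply/measurable_EFinP; apply: measurableT_comp => //; case: gE.
  - apply/(measurable_restrictT _ measurable_square)/measurable_funTS.
    by apply/measurable_EFinP; apply: measurableT_comp => //; case: gE.
  - move=> x _; rewrite /patch; case: ifPn => //= xQ.
    by rewrite /g ext_out ?normr0// => /mem_set; exact/negP.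
rewrite -restrict_EFin; apply/(integrable_mkcond _ mA).
exact: integrableS igT.
Qed.

Lemma H10_inner s t c r : 0 <= s -> t <= 1 -> s < r <= t -> 0 <= c r <= 1 ->
  (\int[mu]_y (EFin \o (g \_ (region s t c))) (r, y) = (v r (c r))%:E)%E.
Proof.
move=> s0 t1 /andP[sr rt] cr01; case: H => _ _ _ vE _.
have r01 : 0 <= r <= 1 by rewrite (le_trans s0 (ltW sr)) (le_trans rt t1).
rewrite vE ?in_itv//= [RHS]integral_mkcond; apply: eq_integral => y _ /=.
rewrite /patch; case: (boolP ((r, y) \in region s t c)) => [/set_mem[/= _ ycr]|ycr].
  rewrite mem_set/= ?in_itv//= /g ext_in//.
  by case/andP: ycr cr01 => -> ycr /andP[_]; exact: le_trans.
rewrite memNset//= in_itv/= => ycr'; move/negP : ycr; apply.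
by apply/mem_set; split => //=; rewrite sr.
Qed.

Lemma H10_inner_out s t c r : ~ (s < r <= t) ->
  (\int[mu]_y (EFin \o (g \_ (region s t c))) (r, y) = 0)%E.
Proof.
move=> srt; rewrite integral0_eq// => y _ /=.
by rewrite /patch memNset// => -[].
Qed.

(** Fubini on the region: its slice at time [r] is [[0, c r]], over which [dv r] integrates to
    [v r (c r)]. Fubini also provides the measurability of [v r (c r)] in [r], since [H10field]
    states nothing on how [v] depends on time. *)
Lemma H10_flow_integral s t c : measurable_fun [set: X] c ->
  0 <= s -> t <= 1 -> (forall r, 0 <= r <= 1 -> 0 <= c r <= 1) ->
  mu.-integrable `]s, t] (fun r => (v r (c r))%:E) /\
  (\int[mu]_(r in `[s, t]) (v r (c r))%:E =
    (\int[mu2]_(p in region s t c) g p)%:E)%E.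
Proof.
move=> mc s0 t1 c01.
have mA := @measurable_region s t c mc.
have ig := H10_integrable mA.
have iF := mu2_fubini_integrable ig.
have eqF r : s < r <= t ->
    (\int[mu]_y (EFin \o (g \_ (region s t c))) (r, y) = (v r (c r))%:E)%E.
  move=> srt; rewrite H10_inner//.
  by apply: c01; case/andP: srt => sr rt; rewrite (le_trans s0 (ltW sr)) (le_trans rt t1).
have iv : mu.-integrable `]s, t] (fun r => (v r (c r))%:E).
  have iF' : mu.-integrable `]s, t]
      (fun r => \int[mu]_y (EFin \o (g \_ (region s t c))) (r, y))%E.
    by apply: integrableS iF => //; exact: measurable_itv.
  have eqF' : {in `]s, t]%classic,
      (fun r => \int[mu]_y (EFin \o (g \_ (region s t c))) (r, y))%E =1
      (fun r : X => (v r (c r))%:E)}.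
    by move=> r /set_mem; rewrite /= in_itv/=; exact: eqF.
  exact: (eq_integrable (measurable_itvX _) _ _ eqF' iF').
split => //.
rewrite -integral_itv_obnd_cbnd; last exact: (measurable_int mu).
rewrite /Rintegral fineK; last first.
  rewrite integral_mkcond restrict_EFin.
  by apply: integrable_fin_num.
rewrite [RHS]integral_mkcond restrict_EFin (mu2_fubini ig).
rewrite [LHS]integral_mkcond; apply: eq_integral => r _.
rewrite /patch; case: ifPn => [rst|rst].
  by rewrite eqF//; move/set_mem: rst; rewrite /= in_itv.
rewrite H10_inner_out// => srt; move/negP : rst; apply.
by apply/mem_set; rewrite /= in_itv.
Qed.

End H10.
End unit_square.

(** * Flow increments as area integrals *)

Section flows.
Variable R : realType.
Local Notation mu := (@lebesgue_measure R).
Local Notation X := (measurableTypeR R).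
Local Notation I01 := (`[0%R, 1%R]%classic : set X).
Local Notation mu2 := (mu2 R).
Local Notation square := (@square R).
Implicit Types (f v dv phi : R -> R -> R) (g : X * X -> R) (c : R -> R) (r s t x : R).

(** A flow is constrained only at times of [0, 1], whereas measurability and regions are stated for
    curves on the whole line: curves are precomposed with this retraction. *)
Definition clamp r : R := Num.max 0 (Num.min 1 r).

Lemma clamp01 r : 0 <= clamp r <= 1.
Proof. by rewrite /clamp le_max lexx/= ge_max ler01 ge_min lexx. Qed.

Lemma clamp_id r : 0 <= r <= 1 -> clamp r = r.
Proof. by move=> /andP[r0 r1]; rewrite /clamp (min_idPr r1) (max_idPr r0). Qed.

Lemma clampP r : [\/ r <= 0 /\ clamp r = 0, 0 <= r <= 1 /\ clamp r = r |
  1 <= r /\ clamp r = 1].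
Proof.
have [r0|r0] := leP r 0.
  apply: Or31; split => //; rewrite /clamp; apply/max_idPl.
  by rewrite ge_min r0 orbT.
have [r1|r1] := leP r 1; first by apply: Or32; rewrite clamp_id ltW//=.
by apply: Or33; rewrite (ltW r1) /clamp (min_idPl (ltW r1)) (max_idPr ler01).
Qed.

Lemma clamp_lipschitz r s : `|clamp r - clamp s| <= `|r - s|.
Proof.
have := ler_norm (r - s); have := ler_norm (s - r); rewrite (distrC s r).
by rewrite ler_norml; case: (clampP r) => -[? ->];
  case: (clampP s) => -[? ->] ? ?; apply/andP; split; lra.
Qed.

Lemma uniformly_continuous_clamp (f : R -> R) :
  (forall e, 0 < e -> exists2 d : R, 0 < d & forall s t, 0 <= s -> s <= t -> t <= 1 ->
     t - s < d -> `|f t - f s| < e) ->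
  continuous (fun r => f (clamp r)).
Proof.
move=> fe r; apply/cvgrPdist_lt => /= e e0.
have [d d0 fd] := fe _ e0.
apply: filterS (nbhsx_ballx r d d0) => s /= rs'.
have rs : `|clamp r - clamp s| < d by rewrite (le_lt_trans (clamp_lipschitz _ _)).
have /andP[r0 r1] := clamp01 r; have /andP[s0 s1] := clamp01 s.
have [rs1|sr] := leP (clamp r) (clamp s).
  by rewrite distrC fd// (le_lt_trans (ler_norm _))// distrC.
apply: fd => //; first exact: ltW.
by rewrite (le_lt_trans (ler_norm _)).
Qed.

Lemma abs_continuous_clamp (f : R -> R) : abs_continuous_on 0 1 f ->
  measurable_fun [set: X] (fun r => f (clamp r)).
Proof.
move=> ac; apply: continuous_measurable_fun; apply: uniformly_continuous_clamp.
move=> e /ac[d d0 H]; exists d => // s t s0 st t1 std.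
(* With a single interval, absolute continuity is uniform continuity. *)
have := H 1%N (fun=> s) (fun=> t); rewrite !big_ord1; apply => //.
by move=> i j /andP[ij]; case: j ij.
Qed.

Definition stripe s t : set (X * X) := `]s, t]%classic `*` [set: X].

Lemma measurable_stripe s t : measurable (stripe s t).
Proof. by apply: measurableX => //; exact: measurable_itv. Qed.

(** The energy spent in a time window. Unlike the global bound [E] it is additive over consecutive
    windows, so its sum over disjoint intervals stays below the total. *)
Definition stripe_energy g s t : R := fine (\int[mu2]_(p in stripe s t) (g p ^+ 2)%:E)%E.

Lemma stripe_energy_fin g E s t : L2bound mu2 g E ->
  (\int[mu2]_(p in stripe s t) (g p ^+ 2)%:E)%E = (stripe_energy g s t)%:E.
Proof.
move=> [mg gE]; rewrite fineK// ge0_fin_numE//; last first.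
  by apply: integral_ge0 => p _; rewrite lee_fin sqr_ge0.
apply: le_lt_trans (ltry E); apply: le_trans gE.
apply: ge0_subset_integral => //; first exact: measurable_stripe.
  by apply/measurable_EFinP; exact: measurable_funX.
by move=> p _; rewrite lee_fin sqr_ge0.
Qed.

Lemma stripe_energy_ge0 g s t : 0 <= stripe_energy g s t.
Proof. by rewrite fine_ge0//; apply: integral_ge0 => p _; rewrite lee_fin sqr_ge0. Qed.

Lemma stripe_energy_le g E s t : L2bound mu2 g E -> stripe_energy g s t <= E.
Proof.
move=> gE; rewrite -lee_fin -(stripe_energy_fin s t gE); case: gE => mg gE.
apply: le_trans gE; apply: ge0_subset_integral => //; first exact: measurable_stripe.
  by apply/measurable_EFinP; exact: measurable_funX.
by move=> p _; rewrite lee_fin sqr_ge0.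
Qed.

Lemma stripe_energyD g E r s t : L2bound mu2 g E -> r <= s -> s <= t ->
  stripe_energy g r t = stripe_energy g r s + stripe_energy g s t.
Proof.
move=> gE rs st; apply: EFin_inj; rewrite EFinD -!(stripe_energy_fin _ _ gE).
have -> : stripe r t = stripe r s `|` stripe s t.
  apply/seteqP; split => -[y z]; rewrite /stripe /= !in_itv/=.
    move=> [/andP[ry yt] _]; case: (leP y s) => ys; [left|right]; split => //.
    by rewrite ry.
  move=> [|] [/andP[ry ys] _]; split => //.
    by rewrite ry (le_trans ys st).
  by rewrite ys (le_lt_trans rs ry).
rewrite ge0_integral_setU//.
- exact: measurable_stripe.
- exact: measurable_stripe.
- apply/measurable_funTS/measurable_EFinP; apply: measurable_funX.
  by case: gE.
- by move=> p _; rewrite lee_fin sqr_ge0.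
- apply/disj_setPS => -[y z] [] [/=]; rewrite !in_itv/= => /andP[_ ys] _ [/andP[sy _] _].
  by move: (lt_le_trans sy ys); rewrite ltxx.
Qed.

(** The area that counts is that of the region inside the square, at most [t - s], since [g]
    vanishes elsewhere. The energy is that of the window alone, so that such bounds can be added. *)
Lemma region_bound g E s t c (K : R) : L2bound mu2 g E ->
  (forall p, ~ square p -> g p = 0) ->
  measurable_fun [set: X] c -> s <= t -> 0 < K ->
  `|\int[mu2]_(p in region s t c) g p| <=
    K / 2 * (t - s) + (2 * K)^-1 * stripe_energy g s t.
Proof.
move=> gE g0 mc st K0; set D := region s t c `&` square.
have mD : measurable D.
  by apply: measurableI; [exact: measurable_region|exact: measurable_square].
have gD : L2bound mu2 (g \_ D) (stripe_energy g s t).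
  split; first by apply/(measurable_restrictT _ mD)/measurable_funTS; case: gE.
  rewrite -(stripe_energy_fin s t gE) [leRHS]integral_mkcond.
  apply: ge0_le_integral => //.
  - by move=> p _; rewrite lee_fin sqr_ge0.
  - apply/measurable_EFinP/measurable_funX.
    by apply/(measurable_restrictT _ mD)/measurable_funTS; case: gE.
  - apply/(measurable_restrictT _ (measurable_stripe s t))/measurable_funTS.
    by apply/measurable_EFinP/measurable_funX; case: gE.
  - move=> p _; rewrite /patch; case: ifPn => [/set_mem[[pst _] _]|_].
      by rewrite mem_set//; split => //=; rewrite in_itv.
    rewrite expr0n/=; case: ifPn => // _; by rewrite lee_fin sqr_ge0.
have -> : \int[mu2]_(p in region s t c) g p = \int[mu2]_(p in D) (g \_ D) p.
  rewrite [LHS]Rintegral_mkcond [RHS]Rintegral_mkcond; congr (Rintegral _ _ _).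
  apply/funext => p; rewrite /patch /D in_setI.
  case: (p \in region s t c) => //=; case: (boolP (p \in square)) => //= ps.
  by rewrite g0// => /mem_set; exact/negP.
exact: L2bound_Rintegral gD mD (mu2_region_le mc st) K0.
Qed.

Lemma sum_increments (e : R -> R) (n : nat) (s t : nat -> R) b :
  (forall r u, 0 <= r -> r <= u -> e r <= e u) -> 0 <= b ->
  (forall i, (i < n)%N -> 0 <= s i /\ s i <= t i /\ t i <= b) ->
  (forall i j, (i < j < n)%N -> t i <= s j) ->
  \sum_(i < n) (e (t i) - e (s i)) <= e b - e 0.
Proof.
move=> emono; elim: n b => [|n IH] b b0 st ts.
  by rewrite big_ord0 subr_ge0 emono.
rewrite big_ord_recr/=; have [sn0 [stn tnb]] := st n (ltnSn n).
(* The earlier intervals end before [s n], which becomes the right end in the induction. *)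
have : \sum_(i < n) (e (t i) - e (s i)) <= e (s n) - e 0.
  apply: IH => //.
    move=> i iln; have [? [? ?]] := st i (ltnW iln); split => //; split => //.
    by apply: ts; rewrite iln/=.
  by move=> i j /andP[ij jn]; apply: ts; rewrite ij ltnW.
have := emono _ _ (le_trans sn0 stn) tnb.
by lra.
Qed.

(** When [region_bound] is summed over disjoint intervals, the lengths contribute less than [e / 2]
    because their sum is below [e / K], and the window energies, at most [E] in total, contribute at
    most [e / 2]. *)
Lemma region_abs_continuous g E c (f : R -> R) : L2bound mu2 g E ->
  (forall p, ~ square p -> g p = 0) -> measurable_fun [set: X] c ->
  (forall s t, 0 <= s -> s < t -> t <= 1 ->
     f t - f s = \int[mu2]_(p in region s t c) g p) ->
  abs_continuous_on 0 1 f.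
Proof.
move=> gE g0 mc fE e e0.
have E0 : 0 <= E by exact: L2bound_ge0 gE.
pose K := E / e + 1.
have K0 : 0 < K by rewrite ltr_wpDl// divr_ge0// ltW.
exists (e / K); first by rewrite divr_gt0.
move=> n s t st ts lt_d.
have step i : (i < n)%N -> `|f (t i) - f (s i)| <= K / 2 * (t i - s i) +
    (2 * K)^-1 * (stripe_energy g 0 (t i) - stripe_energy g 0 (s i)).
  move=> /st[s0 [sti t1]].
  rewrite (stripe_energyD gE s0 sti) addrAC subrr add0r.
  move: sti; rewrite le_eqVlt => /predU1P[->|sti].
    rewrite !subrr normr0 mulr0 add0r mulr_ge0 ?stripe_energy_ge0//.
    by rewrite invr_ge0 mulr_ge0// ltW.
  by rewrite fE// (region_bound gE g0 mc (ltW sti) K0).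
apply: (@le_lt_trans _ _ (\sum_(i < n) (K / 2 * (t i - s i) +
    (2 * K)^-1 * (stripe_energy g 0 (t i) - stripe_energy g 0 (s i))))).
  by apply: ler_sum => i _; exact: step.
rewrite big_split/= -!mulr_sumr.
have := @sum_increments (stripe_energy g 0) n s t 1 _ ler01 st ts.
have emono r u : 0 <= r -> r <= u -> stripe_energy g 0 r <= stripe_energy g 0 u.
  by move=> r0 ru; rewrite (stripe_energyD gE r0 ru) lerDl stripe_energy_ge0.
move=> /(_ emono) sumE.
have {}sumE : \sum_(i < n) (stripe_energy g 0 (t i) - stripe_energy g 0 (s i)) <= E.
  apply: le_trans sumE _; have := stripe_energy_le 0 1 gE.
  by have := stripe_energy_ge0 g 0 0; lra.
have h1 : K / 2 * \sum_(i < n) (t i - s i) < e / 2.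
  have -> : e / 2 = K / 2 * (e / K) by field; rewrite gt_eqF.
  by rewrite ltr_pM2l// divr_gt0.
have h2 : (2 * K)^-1 * \sum_(i < n) (stripe_energy g 0 (t i) - stripe_energy g 0 (s i))
    <= e / 2.
  rewrite mulrC ler_pdivrMr ?mulr_gt0//; apply: le_trans sumE _.
  have -> : e / 2 * (2 * K) = E + e by rewrite /K; field; rewrite gt_eqF.
  by rewrite lerDl ltW.
by lra.
Qed.

(** For an [H10field], the integral identity and measurability in time already imply the clauses of
    [LagFlow] on absolute continuity and integrability, because increments are area integrals of a
    square integrable function. *)
Lemma LagFlow_mk v dv phi : H10field v dv ->
  (forall t x, t \in `[0, 1] -> x \in `[0, 1] -> phi t x \in `[0, 1]) ->
  (forall t, t \in `[0, 1] -> {in `[0, 1] &, forall x y, x <= y -> phi t x <= phi t y}) ->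
  (forall x, x \in `[0, 1] -> exists2 c, measurable_fun [set: X] c &
     forall r, 0 <= r <= 1 -> c r = phi r x) ->
  (forall x, x \in `[0, 1] -> forall s t, 0 <= s -> s < t -> t <= 1 ->
     ((phi t x - phi s x)%:E = \int[mu]_(r in `[s, t]) (v r (phi r x))%:E)%E) ->
  LagFlow v phi.
Proof.
move=> Hv phi01 phimono phim phiE; split => // x x01.
have [c mc cE] := phim x x01.
have c01 r : 0 <= r <= 1 -> 0 <= c r <= 1.
  by move=> r01; rewrite cE//; have := phi01 r x; rewrite !in_itv/=; apply.
have vE s t : 0 <= s -> t <= 1 ->
   (\int[mu]_(r in `[s, t]) (v r (phi r x))%:E =
    \int[mu]_(r in `[s, t]) (v r (c r))%:E)%E.
  move=> s0 t1; apply: eq_integral => r /set_mem/=; rewrite in_itv/= => /andP[sr rt].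
  by rewrite cE// (le_trans s0 sr) (le_trans rt t1).
have [E gE] := H10_L2bound_ex Hv.
split.
- apply: (region_abs_continuous gE (@ext_out _ _) mc) => s t s0 st t1.
  apply: EFin_inj; rewrite phiE// vE//.
  by have [_ ->] := H10_flow_integral Hv mc s0 t1 c01.
- have [iv _] := H10_flow_integral Hv mc (lexx 0) (lexx 1) c01.
  have eqc : {in `]0, 1]%classic, (fun r : X => (v r (c r))%:E) =1
      fun r => (v r (phi r x))%:E}.
    move=> r /set_mem/=; rewrite in_itv/= => /andP[r0 r1].
    by rewrite cE// (ltW r0).
  have iphi := eq_integrable (measurable_itvX _) _ _ eqc iv.
  have mphi : measurable_fun I01 (fun r : X => (v r (phi r x))%:E).
    by apply/emeasurable_fun_itv_obnd_cbndP; exact: (measurable_int mu iphi).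
  (* Integrability is known on the half-open interval; the missing time 0 is a null set. *)
  have m0 : measurable ([set 0] : set X) by exact: measurable_set1.
  have mu0 : mu [set 0] = 0%E by exact: lebesgue_measure_set1.
  apply: (negligible_integrable m0 (measurable_itvX _) mphi mu0).2.
  by rewrite setDitv1l.
- by move=> s t s0 st t1; exact: phiE.
Qed.

Lemma LagFlow_region v dv phi x : H10field v dv -> LagFlow v phi -> 0 <= x <= 1 ->
  let c := fun r => phi (clamp r) x in
  [/\ measurable_fun [set: X] c, (forall r, 0 <= c r <= 1),
      (forall r, 0 <= r <= 1 -> c r = phi r x) &
      forall s t, 0 <= s -> s < t -> t <= 1 ->
        phi t x - phi s x = \int[mu2]_(p in region s t c) ext dv p].
Proof.
move=> Hv [phi01 _ /(_ x)]; rewrite in_itv/= => phiE x01.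
set c := fun r => phi (clamp r) x.
have {phiE}[ac iv phiE] := phiE x01.
have mc : measurable_fun [set: X] c by exact: (@abs_continuous_clamp (phi ^~ x)).
have c01 r : 0 <= c r <= 1.
  by have := phi01 (clamp r) x; rewrite !in_itv/=; apply => //; exact: clamp01.
have cE r : 0 <= r <= 1 -> c r = phi r x by move=> r01; rewrite /c clamp_id.
split => // s t s0 st t1; apply: EFin_inj; rewrite phiE//.
have [_ <-] := H10_flow_integral Hv mc s0 t1 (fun r _ => c01 r).
apply: eq_integral => r /set_mem/=; rewrite in_itv/= => /andP[sr rt].
by rewrite cE// (le_trans s0 sr) (le_trans rt t1).
Qed.

(** With the best [K] this is Hoelder continuity of exponent 1/2 with constant [Num.sqrt E], uniform
    in [x] and in the flow chosen for the field. *)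
Lemma LagFlow_equicontinuous v dv phi E x s t (K : R) :
  H10field v dv -> LagFlow v phi -> L2bound mu2 (ext dv) E ->
  0 <= x <= 1 -> 0 <= s -> s <= t -> t <= 1 -> 0 < K ->
  `|phi t x - phi s x| <= K / 2 * (t - s) + (2 * K)^-1 * E.
Proof.
move=> Hv Lphi gE x01 s0 st t1 K0.
have E0 : 0 <= E by exact: L2bound_ge0 gE.
have K20 : 0 <= (2 * K)^-1 by rewrite invr_ge0 mulr_ge0// ltW.
move: st; rewrite le_eqVlt => /predU1P[->|st].
  by rewrite !subrr normr0 mulr0 add0r mulr_ge0.
have [mc _ _ ->//] := LagFlow_region Hv Lphi x01.
apply: (le_trans (region_bound gE (@ext_out _ _) mc (ltW st) K0)).
by rewrite lerD2l ler_wpM2l// (stripe_energy_le _ _ gE).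
Qed.

End flows.

(** * Measurability of the velocity and duality with its derivative *)

Section velocity.
Variable R : realType.
Local Notation mu := (@lebesgue_measure R).
Local Notation X := (measurableTypeR R).
Local Notation I01 := (`[0%R, 1%R]%classic : set X).
Local Notation mu2 := (mu2 R).
Local Notation square := (@square R).
Implicit Types (t x y : R).

Lemma mu2_swap (F : X * X -> \bar R) : mu2.-integrable [set: X * X] F ->
  (\int[mu]_x \int[mu]_y F (x, y) = \int[mu]_y \int[mu]_x F (x, y))%E.
Proof. by move=> iF; exact: Fubini. Qed.

Lemma mu2_integrable (F : X * X -> \bar R) : measurable_fun [set: X * X] F ->
  (\int[mu]_x \int[mu]_y `|F (x, y)| < +oo)%E -> mu2.-integrable [set: X * X] F.
Proof. by move=> mF iF; apply/integrable12ltyP. Qed.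

Lemma tonelli3_measurable (G : (X * X) * X -> \bar R) :
  measurable_fun [set: (X * X) * X] G -> (forall q, 0 <= G q)%E ->
  measurable_fun [set: X * X] (fun p => \int[mu]_y G (p, y))%E.
Proof. exact: measurable_fun_fubini_tonelli_F. Qed.

Section one_field.
Variables (v dv : R -> R -> R).
Hypothesis H : H10field v dv.
Let g := ext dv.

Let mg : measurable_fun [set: X * X] g.
Proof. by apply: measurable_ext; case: H. Qed.

Lemma ext_slice_integrable t : mu.-integrable [set: X] (fun y => (ext dv (t, y))%:E).
Proof.
rewrite -/g.
have [t01|t01] := pselect (0 <= t <= 1); last first.
  rewrite (_ : (fun y => _) = cst 0%E); first exact: integrable0.
  by apply/funext => y; rewrite /g ext_out//= => -[] /=; rewrite in_itv.
case: H => _ _ /(_ t); rewrite in_itv/= => /(_ t01) idv _ _.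
have : mu.-integrable [set: X] ((fun y => (dv t y)%:E) \_ I01).
  exact/(integrable_mkcond _ (measurable_itvX _)).
rewrite (_ : (_ \_ _) = fun y => (g (t, y))%:E)//; apply/funext => y.
rewrite /patch; case: ifPn => yI.
  by rewrite /g ext_in//; move/set_mem : yI; rewrite /= in_itv.
rewrite /g ext_out// => -[_] /= yI'; move/negP : yI; apply; exact/mem_set.
Qed.

(** The triples [((t, x), y)] with [y] in [[0, x]]: integrating [dv t y] over [y] there gives
    [v t x]. *)
Let W : set ((X * X) * X) := [set q | square q.1 /\ 0 <= q.2 <= q.1.2].

Let mW : measurable W.
Proof.
have -> : W = (square `*` `[0, +oo[) `&`
    ((fun q : (X * X) * X => q.1.2 - q.2) @^-1` `[0, +oo[).
  apply/seteqP; split => -[p y]; rewrite /W /= !in_itv/= !andbT.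
    by move=> [ps /andP[-> yp]]; rewrite subr_ge0.
  by rewrite subr_ge0 => -[[ps ->] ->].
apply: measurableI.
  by apply: measurableX; [exact: measurable_square|exact: measurable_itv].
rewrite -[Z in measurable Z]setTI.
have mf : measurable_fun [set: (X * X) * X] (fun q : (X * X) * X => q.1.2 - q.2).
  apply: measurable_funB; last exact: measurable_snd.
  by apply: measurableT_comp => //; exact: measurable_fst.
by apply: mf => //; exact: measurable_itv.
Qed.

Let F (q : (X * X) * X) : R := ((fun q => g (q.1.1, q.2)) \_ W) q.

Let mF : measurable_fun [set: (X * X) * X] F.
Proof.
apply/(measurable_restrictT _ mW)/measurable_funTS.
apply: (measurableT_comp mg); apply/measurable_fun_pairP; split => /=.
  by rewrite (_ : _ \o _ = (fun q => q.1.1))//; apply: measurableT_comp => //; exact: measurable_fst.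
by rewrite (_ : _ \o _ = snd)//; exact: measurable_snd.
Qed.

Lemma ext_velocityE p : (ext v p)%:E =
  (\int[mu]_y (g (p.1, y) * (\1_(`[0, p.2]%classic : set X) y) * \1_square p)%:E)%E.
Proof.
case: p => t x /=.
have [[]/=|ns] := pselect (square (t, x)); last first.
  by rewrite ext_out// integral0_eq// => y _; rewrite [\1_square _]indicE memNset// mulr0.
rewrite !in_itv/= => t01 x01; rewrite ext_in//.
have tI : (t : R) \in `[0%R, 1%R] by rewrite in_itv.
have xI : (x : R) \in `[0%R, 1%R] by rewrite in_itv.
case: H => _ _ _ vE _; rewrite (vE t x tI xI) [LHS]integral_mkcond.
apply: eq_integral => y _; rewrite [\1_square _]indicE mem_set ?mulr1; last first.
  by split; rewrite /= in_itv.
rewrite indicE /patch; case: ifPn => [|_]; last by rewrite mulr0.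
move/set_mem; rewrite /= in_itv/= => /andP[y0 yx].
by rewrite mulr1 /g ext_in// y0 (le_trans yx)//; case/andP: x01.
Qed.

(** [H10field] asks for joint measurability of [dv] only. That of [v] comes from Tonelli applied to
    the positive and negative parts of [F], which requires no integrability over the triples. *)
Lemma measurable_ext_velocity : measurable_fun [set: X * X] (ext v).
Proof.
apply/measurable_EFinP.
have -> : EFin \o ext v = (fun p => \int[mu]_y (F (p, y))%:E)%E.
  apply/funext => -[t x] /=; rewrite ext_velocityE; apply: eq_integral => y _.
  rewrite /F /patch !indicE /=; case: (boolP ((t, x) \in square)) => txs; last first.
    rewrite mulr0 memNset// => -[/= txs' _]; move/negP: txs; apply; exact/mem_set.
  rewrite mulr1; case: (boolP (y \in `[0, x]%classic)) => yx.
    rewrite mulr1 mem_set//; split => /=; first exact: set_mem.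
    by move/set_mem : yx; rewrite /= in_itv.
  rewrite mulr0 memNset// => -[/= _ yx']; move/negP: yx; apply; apply/mem_set.
  by rewrite /= in_itv.
have mFE : measurable_fun [set: (X * X) * X] (EFin \o F) by exact/measurable_EFinP.
rewrite (_ : (fun p => _) =
  (fun p => \int[mu]_y (EFin \o F)^\+ (p, y)) \- (fun p => \int[mu]_y (EFin \o F)^\- (p, y)))%E.
  apply: emeasurable_funB.
    exact: (tonelli3_measurable (measurable_funepos mFE) (fun q => funepos_ge0 _ q)).
  exact: (tonelli3_measurable (measurable_funeneg mFE) (fun q => funeneg_ge0 _ q)).
by apply/funext => p; rewrite integralE; congr (_ - _)%E; apply: eq_integral => y _; rewrite ?funeposE ?funenegE.
Qed.

(** Cauchy-Schwarz on [[0, x]], of length at most 1, obtained from Young's inequality with [K] equal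
    to the absolute value of [v t x]. A zero velocity and an infinite right-hand side are set
    apart. *)
Lemma velocity_sqr_le t x : 0 <= t <= 1 -> 0 <= x <= 1 ->
  ((v t x ^+ 2)%:E <= \int[mu]_(y in I01) (dv t y ^+ 2)%:E)%E.
Proof.
move=> t01 x01.
case: H => _ _ /(_ t); rewrite in_itv/= => /(_ t01) idv vE _.
have mdv : measurable_fun I01 (dv t) by apply/measurable_EFinP; exact: (measurable_int mu idv).
have [->|] := eqVneq (v t x) 0.
  by rewrite expr0n/= integral_ge0// => y _; rewrite lee_fin sqr_ge0.
rewrite -normr_gt0 => v0.
have D0 : (0 <= \int[mu]_(y in I01) (dv t y ^+ 2)%:E)%E.
  by rewrite integral_ge0// => y _; rewrite lee_fin sqr_ge0.
have [Doo|] := ltP (\int[mu]_(y in I01) (dv t y ^+ 2)%:E)%E +oo%E; last first.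
  by rewrite leye_eq => /eqP ->; rewrite leey.
rewrite -(fineK (x := \int[mu]_(y in I01) (dv t y ^+ 2)%:E)%E) ?ge0_fin_numE//.
set D := fine _.
have L : L2bound mu (dv t \_ I01) D.
  split; first exact/(measurable_restrictT _ (measurable_itvX _)).
  rewrite /D fineK ?ge0_fin_numE// [leRHS]integral_mkcond.
  apply: ge0_le_integral => //.
  - by move=> y _; rewrite lee_fin sqr_ge0.
  - apply/measurable_EFinP/measurable_funX.
    exact/(measurable_restrictT _ (measurable_itvX _)).
  - apply/(measurable_restrictT _ (measurable_itvX _))/measurable_EFinP.
    exact: measurable_funX.
  - by move=> y _; rewrite /patch; case: ifP => //; rewrite expr0n.
have mux : (mu (`[0%R, x]%classic : set X) <= 1%:E)%E.
  rewrite lebesgue_measure_itv/=; case: ifP => _; last by rewrite lee_fin.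
  by rewrite oppr0 addr0 lee_fin; case/andP: x01.
have := L2bound_Rintegral L (measurable_itvX `[0%R, x]) mux v0.
have -> : \int[mu]_(y in (`[0%R, x]%classic : set X)) (dv t \_ I01) y = v t x.
  apply: EFin_inj; rewrite vE ?in_itv//= /Rintegral.
  have -> : (\int[mu]_(y in (`[0%R, x]%classic : set X)) ((dv t \_ I01) y)%:E =
      \int[mu]_(y in (`[0%R, x]%classic : set X)) (dv t y)%:E)%E.
    apply: eq_integral => y /set_mem/=; rewrite in_itv/= => /andP[y0 yx].
    rewrite /patch mem_set//= in_itv/= y0 (le_trans yx)//.
    by case/andP: x01.
  by rewrite -vE ?in_itv.
rewrite mulr1 lee_fin -(real_normK (num_real (v t x))); set w := `|v t x| => wD.
have {}wD : w / 2 <= (2 * w)^-1 * D by lra.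
have : w / 2 * (2 * w) <= (2 * w)^-1 * D * (2 * w) by rewrite ler_wpM2r// mulr_ge0// ltW.
have -> : w / 2 * (2 * w) = w ^+ 2 by field.
have -> // : (2 * w)^-1 * D * (2 * w) = D by field; rewrite gt_eqF.
Qed.

Lemma Lenergy_ext : Lenergy v dv =
  (\int[mu2]_p (ext v p ^+ 2)%:E + 4^-1%:E * \int[mu2]_p (ext dv p ^+ 2)%:E)%E.
Proof.
have mv := measurable_ext_velocity.
have m1 : measurable_fun [set: X * X] (fun p => (ext v p ^+ 2)%:E).
  by apply/measurable_EFinP; exact: measurable_funX.
have m2 : measurable_fun [set: X * X] (fun p => (ext dv p ^+ 2)%:E).
  by apply/measurable_EFinP; exact: measurable_funX.
have p1 p : setT p -> (0 <= (ext v p ^+ 2)%:E)%E by rewrite lee_fin sqr_ge0.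
have p2 p : setT p -> (0 <= (ext dv p ^+ 2)%:E)%E by rewrite lee_fin sqr_ge0.
have k0 : (0 <= (4^-1%:E : \bar R))%E by rewrite lee_fin invr_ge0.
have p3 p : setT p -> (0 <= 4^-1%:E * (ext dv p ^+ 2)%:E)%E by move=> _; exact: mule_ge0 k0 (p2 p I).
have m3 : measurable_fun [set: X * X] (fun p => 4^-1%:E * (ext dv p ^+ 2)%:E)%E.
  exact: measurable_funeM.
rewrite -(ge0_integralZl mu2 measurableT m2 p2 k0) -(ge0_integralD mu2 measurableT p1 m1 p3 m3).
pose G t x : \bar R := (ext v (t, x) ^+ 2 + 4^-1 * ext dv (t, x) ^+ 2)%:E.
have -> : (\int[mu2]_p ((ext v p ^+ 2)%:E + 4^-1%:E * (ext dv p ^+ 2)%:E) =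
    \int[mu2]_p G p.1 p.2)%E.
  by apply: eq_integral => -[t x] _; rewrite /G/= EFinD EFinM.
rewrite (ge0_integral_square (F := G)).
- apply: eq_integral => t /set_mem/=; rewrite in_itv/= => t01.
  apply: eq_integral => x /set_mem/=; rewrite in_itv/= => x01.
  by rewrite /G !ext_in// mulrC.
- rewrite (_ : (fun p => _) = (fun p => (ext v p ^+ 2)%:E + 4^-1%:E * (ext dv p ^+ 2)%:E)%E).
    by apply: emeasurable_funD => //; exact: measurable_funeM.
  by apply/funext => -[t x]; rewrite /G/= EFinD EFinM.
- move=> t x; rewrite lee_fin; apply: addr_ge0; first exact: sqr_ge0.
  by apply: mulr_ge0; [rewrite invr_ge0|exact: sqr_ge0].
- move=> t x tx; rewrite /G !ext_out ?expr0n/= ?mulr0 ?addr0// => -[] /=;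
    rewrite !in_itv/= => t01 x01; by case: tx.
Qed.

End one_field.

(* By Fubini, h (t, y) is the length of the set of x >= y with (t, x) in A: weak
   convergence of the derivatives dv thus entails that of the velocities v. *)
Lemma velocity_test (A : set (X * X)) : measurable A -> A `<=` square ->
  exists h : X * X -> R, [/\ measurable_fun [set: X * X] h, (forall p, 0 <= h p <= 1) &
    forall v dv, H10field v dv -> mu2.-integrable A (EFin \o ext v) ->
      \int[mu2]_(p in A) ext v p = \int[mu2]_(p in square) (ext dv p * h p)].
Proof.
move=> mA AS.
pose B : set ((X * X) * X) := [set q | 0 <= q.1.2 <= q.2 /\ A (q.1.1, q.2)].
have mB : measurable B.
  have -> : B = ([set: X] `*` `[0, +oo[ `*` [set: X]) `&`
      ((fun q : (X * X) * X => q.2 - q.1.2) @^-1` `[0, +oo[) `&`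
      ((fun q : (X * X) * X => (q.1.1, q.2)) @^-1` A).
    apply/seteqP; split => -[[t y] x]; rewrite /B /= !in_itv/= !andbT.
      by move=> [/andP[-> yp] ?]; rewrite subr_ge0.
    by rewrite subr_ge0 => -[[[[_ ->] _] ->] ?].
  have mf1 : measurable_fun [set: (X * X) * X] (fun q : (X * X) * X => q.1.2).
    by apply: measurableT_comp => //; exact: measurable_fst.
  have mf2 : measurable_fun [set: (X * X) * X] (fun q : (X * X) * X => q.1.1).
    by apply: measurableT_comp => //; exact: measurable_fst.
  apply: measurableI; first apply: measurableI.
  - apply: measurableX => //; apply: measurableX => //; exact: measurable_itv.
  - rewrite -[Z in measurable Z]setTI.
    have mf : measurable_fun [set: (X * X) * X] (fun q : (X * X) * X => q.2 - q.1.2).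
      by apply: measurable_funB => //; exact: measurable_snd.
    by apply: mf => //; exact: measurable_itv.
  - rewrite -[Z in measurable Z]setTI.
    have mf : measurable_fun [set: (X * X) * X] (fun q : (X * X) * X => (q.1.1, q.2)).
      by apply/measurable_fun_pairP; split => //=; exact: measurable_snd.
    exact: mf.
pose h (p : X * X) : R := fine (\int[mu]_x (\1_B (p, x))%:E)%E.
have mB1 : measurable_fun [set: (X * X) * X] (fun q => (\1_B q : R)%:E).
  by apply/measurable_EFinP; exact: measurable_indic.
have B01 q : 0 <= (\1_B q : R) <= 1.
  by rewrite indicE; case: (_ \in _); rewrite ?lexx ?ler01.
have B_le p x : (\1_B (p, x) : R) <= \1_I01 x.
  rewrite indicE; case: (boolP (_ \in _)) => [/set_mem[_ /AS[_ /= xI]]|_].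
    by rewrite indicE mem_set.
  by rewrite indicE; case: (_ \in _).
have mBx p : measurable_fun [set: X] (fun x => (\1_B (p, x) : R)%:E).
  by apply: (measurableT_comp mB1).
have intB p : (0 <= \int[mu]_x (\1_B (p, x))%:E <= 1)%E.
  rewrite integral_ge0/=; last by move=> x _; rewrite lee_fin; case/andP: (B01 (p, x)).
  apply: (@le_trans _ _ (\int[mu]_x (\1_I01 x)%:E)%E).
    apply: ge0_le_integral => //.
    - by apply/measurable_EFinP; apply: measurable_indic; exact: measurable_itv.
    - by move=> x _; rewrite lee_fin.
  rewrite (integral_indic mu measurableT (measurable_itvX _)) setIT.
  by rewrite le_eqVlt; apply/orP; left; apply/eqP; exact: mu_I01.
have intB_fin p : (\int[mu]_x (\1_B (p, x))%:E)%E \is a fin_num.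
  have /andP[i0 i1] := intB p; rewrite ge0_fin_numE//; exact: le_lt_trans i1 (ltry 1).
have mh : measurable_fun [set: X * X] h.
  apply/measurable_EFinP.
  rewrite (_ : _ \o _ = fun p => \int[mu]_x (\1_B (p, x))%:E)%E; last first.
    by apply/funext => p; rewrite /h /= fineK.
  have B0 q : (0 <= (\1_B q : R)%:E)%E by rewrite lee_fin; case/andP: (B01 q).
  exact: (tonelli3_measurable mB1 B0).
have h01 p : 0 <= h p <= 1.
  have /andP[i0 i1] := intB p.
  by rewrite -!lee_fin /h fineK// i0 i1.
exists h; split => // v dv Hv iv.
pose g := ext dv.
have igT : mu2.-integrable [set: X * X] (EFin \o g).
  have := H10_integrable Hv measurableT.
  by rewrite (_ : _ \_ _ = g)//; apply/funext => p; rewrite /patch in_setT.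
have mg : measurable_fun [set: X * X] g by apply: measurable_ext; case: Hv.
have igh : mu2.-integrable [set: X * X] (EFin \o (fun p => g p * h p)).
  apply: le_integrable igT => //.
    by apply/measurable_EFinP; exact: measurable_funM.
  move=> p _; rewrite /= lee_fin normrM ler_piMr//.
  by have /andP[h0 h1] := h01 p; rewrite ger0_norm.
have ivT : mu2.-integrable [set: X * X] (EFin \o (ext v \_ A)).
  by rewrite -restrict_EFin; apply/(integrable_mkcond _ mA).
rewrite [LHS]Rintegral_mkcond [RHS]Rintegral_mkcond /Rintegral; congr fine.
have -> : (\int[mu2]_p (((fun p => ext dv p * h p) \_ square) p)%:E =
    \int[mu2]_p (g p * h p)%:E)%E.
  apply: eq_integral => p _; rewrite /patch; case: ifPn => // ps.
  by rewrite /g ext_out ?mul0r// => /mem_set; exact/negP.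
rewrite (mu2_fubini ivT) (mu2_fubini igh); apply: eq_integral => t _ /=.
(* The exchange of [x] and [y] is made at each fixed [t]: [Gt] is integrable because [dv t] is and
   [x] ranges over the unit interval. *)
pose Gt (q : X * X) : R := g (t, q.2) * (\1_B ((t, q.2), q.1) : R).
have igt := ext_slice_integrable Hv t.
have mGt : measurable_fun [set: X * X] (EFin \o Gt).
  apply/measurable_EFinP; apply: measurable_funM.
    by apply: (measurableT_comp mg); apply: measurable_fun_pair.
  have mp : measurable_fun [set: X * X] (fun q : X * X => ((t, q.2), q.1)).
    by apply: measurable_fun_pair => //; apply: measurable_fun_pair.
  by apply/measurable_EFinP; exact: (measurableT_comp mB1 mp).
have iGt : mu2.-integrable [set: X * X] (EFin \o Gt).
  apply: mu2_integrable => //.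
  case/integrableP: igt => mgt igt.
  apply: (@le_lt_trans _ _ (\int[mu]_(x in I01) \int[mu]_y `|(g (t, y))%:E|)%E).
    rewrite [leRHS]integral_mkcond; apply: ge0_le_integral => //.
    - by move=> x _; apply: integral_ge0.
    - apply: (@mu2_tonelli_measurable R (fun q => `|(EFin \o Gt) q|%E)) => //.
      exact: measurableT_comp.
    - apply/(measurable_restrictT _ (measurable_itvX _)); exact: measurable_cst.
    - move=> x _; rewrite /patch; case: ifPn => xI.
        apply: ge0_le_integral => //.
        + apply: measurableT_comp => //.
          by apply: (measurableT_comp mGt); apply: measurable_fun_pair.
        + exact: measurableT_comp.
        + move=> y _; rewrite /= lee_fin /Gt/= normrM ler_piMr//.
          by have /andP[b0 b1] := B01 (t, y, x); rewrite ger0_norm.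
      rewrite integral0_eq// => y _; rewrite /= /Gt/= indicE memNset ?mulr0 ?normr0//.
      by move=> [_ /AS[_ /= xI']]; move/negP: xI; apply; exact/mem_set.
  have -> // : (\int[mu]_(x in I01) (\int[mu]_y `|(g (t, y))%:E|) =
      \int[mu]_y `|(g (t, y))%:E|)%E.
  apply: etrans; first exact: (integral_cst mu (measurable_itvX _)).
  by apply: etrans; [apply: congr1; exact: mu_I01|exact: mule1].
transitivity (\int[mu]_x \int[mu]_y (EFin \o Gt) (x, y))%E.
  apply: eq_integral => x _; rewrite /patch; case: ifPn => xA.
    rewrite (ext_velocityE Hv); apply: eq_integral => y _; congr EFin.
    rewrite /Gt /=  -mulrA; congr (_ * _); rewrite !indicE.
    have txS : (t, x) \in square by apply/mem_set/AS/set_mem.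
    rewrite txS mulr1; congr (nat_of_bool _)%:R; apply/idP/idP.
      move=> /set_mem/=; rewrite in_itv/= => yx; apply/mem_set; split => //=.
      exact: set_mem.
    by move=> /set_mem[/= yx _]; apply/mem_set; rewrite /= in_itv.
  rewrite integral0_eq// => y _; rewrite /= /Gt/= indicE memNset ?mulr0//.
  by move=> [_ /= xA']; move/negP: xA; apply; exact/mem_set.
rewrite (mu2_swap iGt); apply: eq_integral => y _ /=.
under eq_integral do rewrite /Gt/= EFinM.
have iB : mu.-integrable [set: X] (fun x => (\1_B (t, y, x) : R)%:E).
  apply/integrableP; split => //.
  under eq_integral do rewrite gee0_abs ?lee_fin ?(andP (B01 _)).1//.
  by have /andP[_ i1] := intB (t, y); exact: le_lt_trans i1 (ltry 1).
apply: etrans; first exact: (integralZl measurableT iB (g (t, y))).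
by rewrite /h EFinM fineK.
Qed.

End velocity.

(** * Affine changes of time *)

Section affine.
Variable R : realType.
Local Notation mu := (@lebesgue_measure R).
Local Notation X := (measurableTypeR R).
Variables (k b : R).
Hypothesis k0 : k != 0.
Implicit Types (v dv phi : R -> R -> R) (x s t : R).
Let tau (t : X) : X := k * t + b.

Let mtau : measurable_fun [set: X] tau.
Proof. by apply: measurable_funD => //; apply: measurable_funM. Qed.

Let m : {measure set X -> \bar R} := mscale (NngNum (normr_ge0 k))
  (measure_function_pushforward__canonical__measure_function_Measure mu mtau).

(** It is enough to compare the two measures on half-open intervals. For [k < 0], the case of time
    reversal, the preimage is open at the other end but has the same length. *)
Lemma lebesgue_measure_affine (A : set X) : measurable A ->
  mu A = (`|k|%:E * mu (tau @^-1` A))%E.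
Proof.
have -> : (`|k|%:E * mu (tau @^-1` A))%E = m A by [].
move: A; apply: lebesgue_measure_unique => _ [[x y] _ <-] /=.
have -> : m (`]x, y]%classic : set X) = (`|k|%:E * mu (tau @^-1` `]x, y]))%E by [].
have kE (z : R) : k * ((z - b) / k) + b = z by field.
have [kp|kn] : 0 < k \/ k < 0 by move: k0; rewrite neq_lt => /orP[|]; [right|left].
- have -> : tau @^-1` `]x, y] = `](x - b) / k, (y - b) / k]%classic.
    apply/seteqP; split => t /=; rewrite !in_itv/= /tau ltr_pdivrMr// ler_pdivlMr//;
      by rewrite ltrBlDr lerBrDr mulrC.
  rewrite !lebesgue_measure_itv/= !lte_fin ltr_pM2r ?invr_gt0// ltrD2r.
  case: ifPn => _; last by rewrite mule0.
  by rewrite gtr0_norm// -EFinD -EFinM; congr EFin; field.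
- have -> : tau @^-1` `]x, y] = `[(y - b) / k, (x - b) / k[%classic.
    apply/seteqP; split => t /=; rewrite !in_itv/= /tau ler_ndivrMr// ltr_ndivlMr//;
      by rewrite ltrBlDr lerBrDr mulrC andbC.
  rewrite !lebesgue_measure_itv/= !lte_fin ltr_nM2r ?invr_lt0// ltrD2r.
  case: ifPn => _; last by rewrite mule0.
  by rewrite ltr0_norm// -EFinD -EFinM; congr EFin; field.
Qed.

Lemma ge0_integral_affine (F : X -> \bar R) : measurable_fun [set: X] F ->
  (forall x, 0 <= F x)%E -> (\int[mu]_x F x = `|k|%:E * \int[mu]_x F (tau x))%E.
Proof.
move=> mF F0.
rewrite (eq_measure_integral m); last by move=> A mA _; exact: lebesgue_measure_affine.
rewrite ge0_integral_mscale//; congr (_ * _)%E.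
by rewrite ge0_integral_pushforward// preimage_setT.
Qed.

Lemma ge0_integral_affine_on (D : set X) (F : X -> \bar R) : measurable D ->
  measurable_fun D F -> (forall x, D x -> 0 <= F x)%E ->
  (\int[mu]_(x in tau @^-1` D) F (tau x) = `|k|^-1%:E * \int[mu]_(x in D) F x)%E.
Proof.
move=> mD mF F0; rewrite [X in (_ * X)%E]integral_mkcond ge0_integral_affine//.
- rewrite muleA -EFinM mulVf ?normr_eq0// mul1e.
  by rewrite [LHS]integral_mkcond.
- exact/(measurable_restrictT _ mD).
- by move=> x; rewrite /patch; case: ifPn => // /set_mem/F0.
Qed.

Lemma integral_affine_on (D : set X) (F : X -> \bar R) : measurable D ->
  mu.-integrable D F ->
  (\int[mu]_(x in tau @^-1` D) F (tau x) = `|k|^-1%:E * \int[mu]_(x in D) F x)%E.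
Proof.
move=> mD iF; have mF := measurable_int mu iF.
rewrite integralE [in RHS]integralE muleBr//; last exact: integrable_add_def.
rewrite -(ge0_integral_affine_on mD (measurable_funepos mF))//.
rewrite -(ge0_integral_affine_on mD (measurable_funeneg mF))//.
by congr (_ - _)%E; apply: eq_integral => x _; rewrite ?funeposE ?funenegE.
Qed.

Lemma affine_flow v phi x s t : LagFlow v phi -> 0 <= x <= 1 -> s < t ->
  0 <= tau s <= 1 -> 0 <= tau t <= 1 ->
  ((phi (tau t) x - phi (tau s) x)%:E =
   \int[mu]_(r in `[s, t]) (k * v (tau r) (phi (tau r) x))%:E)%E.
Proof.
move=> [_ _ /(_ x)]; rewrite in_itv/= => phix x01 st /andP[s0 s1] /andP[t0 t1].
have {phix x01}[_ iv phiE] := phix x01.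
pose G (r : X) : \bar R := (k * v r (phi r x))%:E.
have iG (D : set X) : measurable D -> D `<=` `[0, 1]%classic -> mu.-integrable D G.
  move=> mD D01; have iv' := integrableS (measurable_itvX _) mD D01 iv.
  exact: (integrableZl mD k iv').
have GE (D : set X) : measurable D -> D `<=` `[0, 1]%classic ->
    (\int[mu]_(r in D) G r = k%:E * \int[mu]_(r in D) (v r (phi r x))%:E)%E.
  move=> mD D01; have iv' := integrableS (measurable_itvX _) mD D01 iv.
  by rewrite -integralZl.
have [kp|kn] : 0 < k \/ k < 0 by move: k0; rewrite neq_lt => /orP[|]; [right|left].
- have D01 : `[tau s, tau t]%classic `<=` (`[0, 1]%classic : set X).
    by move=> r /=; rewrite !in_itv/= => /andP[sr rt]; rewrite (le_trans s0 sr) (le_trans rt t1).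
  have tst : tau s < tau t by rewrite /tau ltrD2r ltr_pM2l.
  have -> : (`[s, t]%classic : set X) = tau @^-1` `[tau s, tau t].
    by apply/seteqP; split => r /=; rewrite !in_itv/= /tau !lerD2r !ler_pM2l.
  rewrite (integral_affine_on (measurable_itvX _) (iG _ (measurable_itvX _) D01)).
  rewrite (GE _ (measurable_itvX _) D01) muleA -EFinM gtr0_norm// mulVf// mul1e.
  by rewrite phiE.
(* Reversal exchanges the ends of the interval and changes the sign of the field; the two signs
   cancel. *)
- have D01 : `[tau t, tau s]%classic `<=` (`[0, 1]%classic : set X).
    by move=> r /=; rewrite !in_itv/= => /andP[sr rt]; rewrite (le_trans t0 sr) (le_trans rt s1).
  have tst : tau t < tau s by rewrite /tau ltrD2r ltr_nM2l.
  have -> : (`[s, t]%classic : set X) = tau @^-1` `[tau t, tau s].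
    by apply/seteqP; split => r /=; rewrite !in_itv/= /tau !lerD2r !ler_nM2l// andbC.
  rewrite (integral_affine_on (measurable_itvX _) (iG _ (measurable_itvX _) D01)).
  rewrite (GE _ (measurable_itvX _) D01) muleA -EFinM ltr0_norm// invrN mulNr mulVf//.
  by rewrite -phiE// -EFinM mulN1r opprB.
Qed.

End affine.

(** * Reversal and concatenation of flows *)

Section time_change.
Variable R : realType.
Local Notation mu := (@lebesgue_measure R).
Local Notation X := (measurableTypeR R).
Local Notation I01 := (`[0%R, 1%R]%classic : set X).
Implicit Types (v dv phi : R -> R -> R).

(** The weights let the same lemmas serve the energy ([1] and [4^-1]), the square integrability of
    [dv] ([0] and [1]) and the norm of [v] ([1] and [0]). *)
Definition inner_energy (c e : R) v dv (t : X) : \bar R :=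
  (\int[mu]_(x in I01) (c * v t x ^+ 2 + e * dv t x ^+ 2)%:E)%E.

Lemma inner_energy_ge0 c e v dv t : 0 <= c -> 0 <= e -> (0 <= inner_energy c e v dv t)%E.
Proof.
by move=> c0 e0; apply: integral_ge0 => x _; rewrite lee_fin addr_ge0// mulr_ge0// sqr_ge0.
Qed.

Lemma measurable_inner_energy c e v dv : 0 <= c -> 0 <= e -> H10field v dv ->
  measurable_fun I01 (inner_energy c e v dv).
Proof.
move=> c0 e0 Hv.
pose G (p : X * X) : \bar R := (c * ext v p ^+ 2 + e * ext dv p ^+ 2)%:E.
have mG : measurable_fun [set: X * X] G.
  apply/measurable_EFinP; apply: measurable_funD; apply: measurable_funM => //.
    by apply: measurable_funX; exact: measurable_ext_velocity Hv.
  by apply: measurable_funX; apply: measurable_ext; case: Hv.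
have G0 p : (0 <= G p)%E by rewrite lee_fin addr_ge0// mulr_ge0// sqr_ge0.
have := measurable_funTS (D := I01) (mu2_tonelli_measurable mG G0).
apply: eq_measurable_fun => t /set_mem/=; rewrite in_itv/= => t01.
rewrite /inner_energy [RHS]integral_mkcond; apply: eq_integral => x _.
rewrite /patch; case: ifPn => [|xI].
  by move=> /set_mem/=; rewrite in_itv/= => x01; rewrite /G !ext_in.
rewrite /G !ext_out ?expr0n/= ?mulr0 ?addr0//;
  by move=> -[_ /= xI']; move/negP: xI; apply; exact/mem_set.
Qed.

Lemma inner_energy_scale c e v dv v' dv' (k : R) s t : 0 <= c -> 0 <= e ->
  H10field v dv -> 0 <= t <= 1 ->
  (forall x, 0 <= x <= 1 -> v' s x = k * v t x) ->
  (forall x, 0 <= x <= 1 -> dv' s x = k * dv t x) ->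
  inner_energy c e v' dv' s = ((k ^+ 2)%:E * inner_energy c e v dv t)%E.
Proof.
move=> c0 e0 Hv t01 vE dvE.
have mt : measurable_fun [set: X] (fun x : X => ((t : X), x)).
  exact: measurable_fun_pair.
have mv : measurable_fun I01 (v t).
  have := measurable_funTS (D := I01) (measurableT_comp (measurable_ext_velocity Hv) mt).
  apply: eq_measurable_fun => x /set_mem/=; rewrite in_itv/= => x01.
  by rewrite /= ext_in.
have mdv : measurable_fun I01 (dv t).
  have mg : measurable_fun [set: X * X] (ext dv) by apply: measurable_ext; case: Hv.
  have := measurable_funTS (D := I01) (measurableT_comp mg mt).
  apply: eq_measurable_fun => x /set_mem/=; rewrite in_itv/= => x01.
  by rewrite /= ext_in.
have mG : measurable_fun I01 (fun x => (c * v t x ^+ 2 + e * dv t x ^+ 2)%:E).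
  apply/measurable_EFinP; apply: measurable_funD; apply: measurable_funM => //;
    exact: measurable_funX.
have G0 x : I01 x -> (0 <= (c * v t x ^+ 2 + e * dv t x ^+ 2)%:E)%E.
  by move=> _; rewrite lee_fin addr_ge0// mulr_ge0// sqr_ge0.
have k20 : (0 <= ((k ^+ 2)%:E : \bar R))%E by rewrite lee_fin sqr_ge0.
rewrite /inner_energy -(ge0_integralZl mu (measurable_itvX _) mG G0 k20).
apply: eq_integral => x /set_mem/=; rewrite in_itv/= => x01.
by rewrite vE// dvE// -EFinM; congr EFin; ring.
Qed.

(** The square of the speed contributes [k ^+ 2] and the change of variables the inverse of the
    absolute value of [k]. *)
Lemma integral_affine_energy c e v dv v' dv' (k b : R) (D : set X) : k != 0 ->
  0 <= c -> 0 <= e -> H10field v dv -> measurable D -> D `<=` I01 ->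
  (forall s x, D (k * s + b) -> 0 <= x <= 1 -> v' s x = k * v (k * s + b) x) ->
  (forall s x, D (k * s + b) -> 0 <= x <= 1 -> dv' s x = k * dv (k * s + b) x) ->
  let J := (fun s : X => k * s + b) @^-1` D in
  measurable_fun J (inner_energy c e v' dv') /\
  (\int[mu]_(s in J) inner_energy c e v' dv' s =
   `|k|%:E * \int[mu]_(s in D) inner_energy c e v dv s)%E.
Proof.
move=> k0 c0 e0 Hv mD D01 vE dvE J.
have mI := measurable_funS (measurable_itvX _) D01 (measurable_inner_energy c0 e0 Hv).
have mtau : measurable_fun [set: X] (fun s : X => k * s + b).
  by apply: measurable_funD => //; apply: measurable_funM.
have mJ : measurable J by rewrite -[J]setTI; exact: mtau.
have EE : {in J, (fun s => (k ^+ 2)%:E * inner_energy c e v dv (k * s + b)%R)%E =1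
    inner_energy c e v' dv'}.
  move=> s /set_mem Js; rewrite (@inner_energy_scale c e v dv v' dv' k s (k * s + b))//.
  - by have := D01 _ Js; rewrite /= in_itv.
  - by move=> x x01; exact: vE.
  - by move=> x x01; exact: dvE.
have mIJ : measurable_fun J (fun s => inner_energy c e v dv (k * s + b)).
  apply: (measurable_comp (F := D)) => //; first by move=> _ [s Js <-].
  exact: measurable_funTS.
split.
  move: (measurable_funeM (k ^+ 2)%:E mIJ); apply: eq_measurable_fun => s; exact: EE.
have k20 : (0 <= ((k ^+ 2)%:E : \bar R))%E by rewrite lee_fin sqr_ge0.
have G0 s : J s -> (0 <= inner_energy c e v dv (k * s + b)%R)%E.
  by move=> _; exact: inner_energy_ge0.
rewrite -(eq_integral _ _ EE) (ge0_integralZl mu mJ mIJ G0 k20).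
have G1 s : D s -> (0 <= inner_energy c e v dv s)%E by move=> _; exact: inner_energy_ge0.
rewrite (@ge0_integral_affine_on R k b k0 D _ mD mI G1).
rewrite muleA -EFinM; congr (_%:E * _)%E.
by rewrite -real_normK ?num_real// expr2 mulfK// normr_eq0.
Qed.

Lemma H10_pointwise_scale v dv v' dv' (k : R) s t : H10field v dv -> 0 <= t <= 1 ->
  (forall x, v' s x = k * v t x) -> (forall x, dv' s x = k * dv t x) ->
  [/\ mu.-integrable I01 (fun y => (dv' s y)%:E),
    (forall x, x \in `[0, 1] ->
       ((v' s x)%:E = \int[mu]_(y in `[0%R, x]%classic) (dv' s y)%:E)%E) &
    v' s 1 = 0].
Proof.
move=> [_ _ /(_ t) idv vE /(_ t) v1] t01 v'E dv'E.
have tI : t \in `[0%R, 1%R] by rewrite in_itv.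
have -> : dv' s = fun y => k * dv t y by apply/funext.
split.
- by apply: integrable_EFinZ; [exact: measurable_itv|exact: idv].
- move=> x x01; have x0I : `[0, x]%classic `<=` I01.
    move: x01; rewrite in_itv/= => /andP[_ x1] y /=; rewrite !in_itv/= => /andP[-> yx].
    exact: le_trans x1.
  have ix := integrableS (measurable_itvX _) (measurable_itvX _) x0I (idv tI).
  rewrite v'E EFinM vE//; exact/esym/(integralZl (measurable_itvX _) ix).
- by rewrite v'E v1// mulr0.
Qed.

Lemma Lenergy_inner v dv :
  Lenergy v dv = (\int[mu]_(t in I01) inner_energy 1 (4^-1) v dv t)%E.
Proof.
apply: eq_integral => t _; apply: eq_integral => x _.
by rewrite mul1r [_ / 4]mulrC.
Qed.

Lemma sqr_inner v dv :
  (\int[mu]_(t in I01) \int[mu]_(x in I01) ((dv t x) ^+ 2)%:E =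
   \int[mu]_(t in I01) inner_energy 0 1 v dv t)%E.
Proof.
apply: eq_integral => t _; apply: eq_integral => x _.
by rewrite mul0r add0r mul1r.
Qed.

(** The reversed field is minus the field at time [1 - t], an affine change of slope -1, hence of
    the same energy. *)
Lemma Admissible_rev (phi0 phi1 : R -> R) v dv : Admissible phi0 phi1 v dv ->
  exists v' dv', Admissible phi1 phi0 v' dv' /\ Lenergy v' dv' = Lenergy v dv.
Proof.
move=> [Hv [phi [Lphi phi0E phi1E]]].
pose v' (t x : R) : R := -1 * v (-1 * t + 1) x.
pose dv' (t x : R) : R := -1 * dv (-1 * t + 1) x.
have k0 : (-1 : R) != 0 by rewrite oppr_eq0 oner_eq0.
have J01 : (fun s : X => -1 * s + 1) @^-1` I01 = I01.
  apply/seteqP; split => s /=; rewrite !in_itv/= => /andP[? ?]; apply/andP; split; lra.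
have en c e : 0 <= c -> 0 <= e -> (\int[mu]_(t in I01) inner_energy c e v' dv' t =
    \int[mu]_(t in I01) inner_energy c e v dv t)%E.
  move=> c0 e0.
  have [_] := @integral_affine_energy c e v dv v' dv' (-1) 1 I01 k0 c0 e0 Hv
    (measurable_itvX _) (@subset_refl _ _) (fun _ _ _ _ => erefl) (fun _ _ _ _ => erefl).
  by rewrite J01 normrN normr1 mul1e.
have t'01 (t : R) : t \in `[0%R, 1%R] -> 0 <= -1 * t + 1 <= 1.
  by rewrite in_itv/= => /andP[? ?]; apply/andP; split; lra.
have Hv' : H10field v' dv'.
  split.
  - have mg : measurable_fun [set: X * X] (ext dv) by apply: measurable_ext; case: Hv.
    have mp : measurable_fun [set: X * X] (fun p : X * X => (-1 * p.1 + 1, p.2)).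
      apply: measurable_fun_pair => //; apply: measurable_funD => //.
      by apply: measurable_funM.
    have mgp : measurable_fun [set: X * X] (fun p : X * X => -1 * ext dv (-1 * p.1 + 1, p.2)).
      by apply: measurable_funM => //; exact: (measurableT_comp mg mp).
    have := measurable_funTS (D := @square R) mgp.
    apply: eq_measurable_fun => -[t x] /set_mem[/= t01 x01].
    by rewrite ext_in// ?t'01//; move: x01; rewrite in_itv.
  - rewrite (sqr_inner v') en// -sqr_inner; by case: Hv.
  - by move=> t tI; have [] := H10_pointwise_scale Hv (t'01 t tI)
      (v' := v') (dv' := dv') (k := -1) (s := t) (fun=> erefl) (fun=> erefl).
  - by move=> t x tI; have [_ + _] := H10_pointwise_scale Hv (t'01 t tI)
      (v' := v') (dv' := dv') (k := -1) (s := t) (fun=> erefl) (fun=> erefl); apply.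
  - by move=> t tI; have [] := H10_pointwise_scale Hv (t'01 t tI)
      (v' := v') (dv' := dv') (k := -1) (s := t) (fun=> erefl) (fun=> erefl).
exists v', dv'; split; last by rewrite !Lenergy_inner en.
split => //; exists (fun t => phi (-1 * t + 1)); split.
- apply: (LagFlow_mk Hv').
  + by move=> t x tI xI; case: Lphi => + _ _; apply => //; rewrite in_itv/= t'01.
  + by move=> t tI; case: Lphi => _ + _; apply; rewrite in_itv/= t'01.
  + move=> x; rewrite in_itv/= => x01; exists (fun r => phi (clamp (-1 * r + 1)) x).
      have [mc _ _ _] := LagFlow_region Hv Lphi x01.
      by apply: (measurableT_comp mc); apply: measurable_funD.
    by move=> r r01; rewrite clamp_id// t'01// in_itv.
  + move=> x; rewrite in_itv/= => x01 s t s0 st t1.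
    by apply: (affine_flow k0 Lphi) => //; apply: t'01; rewrite in_itv/=;
      [rewrite s0 ltW// (lt_le_trans st)|rewrite t1 (le_trans s0)// ltW].
- by move=> x xI; rewrite mulr0 add0r phi1E.
- by move=> x xI; rewrite mulr1 addNr phi0E.
Qed.

Lemma H10_flow_integrable v dv (s t : R) (c : R -> R) : H10field v dv -> measurable_fun [set: X] c ->
  0 <= s -> t <= 1 -> (forall r, 0 <= r <= 1 -> 0 <= c r <= 1) ->
  mu.-integrable `[s, t] (fun r => (v r (c r))%:E).
Proof.
move=> Hv mc s0 t1 c01.
have [iv _] := H10_flow_integral Hv mc s0 t1 c01.
have [ts|st] := ltP t s; first by rewrite set_itv_ge ?bnd_simp -?ltNge//; exact: integrable_set0.
have mv : measurable_fun (`[s, t]%classic : set X) (fun r : X => (v r (c r))%:E).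
  by apply/emeasurable_fun_itv_obnd_cbndP; exact: (measurable_int mu iv).
have m0 : measurable ([set s] : set X) by exact: measurable_set1.
have mu0 : mu [set s] = 0%E by exact: lebesgue_measure_set1.
apply: (negligible_integrable m0 (measurable_itvX _) mv mu0).2.
by rewrite setDitv1l.
Qed.

Lemma Admissible_cat (phi0 phi1 phi2 : R -> R) v1 dv1 v2 dv2 (th : R) : 0 < th < 1 ->
  Admissible phi0 phi1 v1 dv1 -> Admissible phi1 phi2 v2 dv2 ->
  exists v dv, Admissible phi0 phi2 v dv /\
    Lenergy v dv = (th^-1%:E * Lenergy v1 dv1 + (1 - th)^-1%:E * Lenergy v2 dv2)%E.
Proof.
move=> /andP[th0 th1] [H1 [f1 [L1 f10 f11]]] [H2 [f2 [L2 f20 f21]]].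
have th'0 : 0 < 1 - th by rewrite subr_gt0.
have thn0 : th != 0 by rewrite gt_eqF.
have th'n0 : 1 - th != 0 by rewrite gt_eqF.
(* Chosen so that [t1] maps [[0, th]] and [t2] maps [[th, 1]] onto [[0, 1]]; the two slopes are the
   factors of the energies. *)
pose k1 : R := th^-1; pose k2 : R := (1 - th)^-1; pose b2 : R := - (th / (1 - th)).
have k1p : 0 < k1 by rewrite invr_gt0.
have k2p : 0 < k2 by rewrite invr_gt0.
have k10 : k1 != 0 by rewrite gt_eqF.
have k20 : k2 != 0 by rewrite gt_eqF.
pose t1 (t : R) : R := k1 * t + 0; pose t2 (t : R) : R := k2 * t + b2.
have t1E (t : R) : t1 t = t / th by rewrite /t1 /k1; ring.
have t2E (t : R) : t2 t = (t - th) / (1 - th) by rewrite /t2 /k2 /b2; ring.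
have t101 (t : R) : 0 <= t -> t <= th -> 0 <= t1 t <= 1.
  move=> t_0 tth; rewrite t1E; apply/andP; split; first by rewrite divr_ge0// ltW.
  by rewrite ler_pdivrMr// mul1r.
have t201 (t : R) : th <= t -> t <= 1 -> 0 <= t2 t <= 1.
  move=> tth t_1; rewrite t2E; apply/andP; split.
    by rewrite divr_ge0// ?subr_ge0// ltW.
  by rewrite ler_pdivrMr// mul1r lerD2r.
pose v (t x : R) : R := if t <= th then k1 * v1 (t1 t) x else k2 * v2 (t2 t) x.
pose dv (t x : R) : R := if t <= th then k1 * dv1 (t1 t) x else k2 * dv2 (t2 t) x.
pose f (t x : R) : R := if t <= th then f1 (clamp (t1 t)) x else f2 (clamp (t2 t)) x.
have mle : measurable_fun [set: X] (fun t : X => t <= th) by exact: measurable_fun_ler.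
have mt1 : measurable_fun [set: X] (t1 : X -> X).
  by apply: measurable_funD => //; apply: measurable_funM.
have mt2 : measurable_fun [set: X] (t2 : X -> X).
  by apply: measurable_funD => //; apply: measurable_funM.
(* [D2] is half-open so that the two preimages partition [[0, 1]], in agreement with the test
   [t <= th]. *)
pose D1 : set X := I01; pose D2 : set X := `]0%R, 1%R]%classic.
have J1 : (fun s : X => k1 * s + 0) @^-1` D1 = `[0, th]%classic.
  apply/seteqP; split => s; rewrite /D1 /= !in_itv/= -/(t1 s) t1E.
    by rewrite ler_pdivlMr// mul0r ler_pdivrMr// mul1r.
  by rewrite ler_pdivlMr// mul0r ler_pdivrMr// mul1r.
have J2 : (fun s : X => k2 * s + b2) @^-1` D2 = `]th, 1]%classic.
  apply/seteqP; split => s; rewrite /D2 /= !in_itv/= -/(t2 s) t2E.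
    by rewrite ltr_pdivlMr// mul0r subr_gt0 ler_pdivrMr// mul1r lerD2r.
  by rewrite ltr_pdivlMr// mul0r subr_gt0 ler_pdivrMr// mul1r lerD2r.
have D201 : D2 `<=` I01.
  by move=> s; rewrite /D2 /= !in_itv/= => /andP[/ltW -> ->].
have en c e : 0 <= c -> 0 <= e -> (\int[mu]_(t in I01) inner_energy c e v dv t =
    th^-1%:E * \int[mu]_(t in I01) inner_energy c e v1 dv1 t +
    (1 - th)^-1%:E * \int[mu]_(t in I01) inner_energy c e v2 dv2 t)%E.
  move=> c0 e0.
  have JJ1 s : D1 (k1 * s + 0) -> s <= th.
    move=> Ds; have : ((fun s : X => k1 * s + 0) @^-1` D1) s by [].
    by rewrite J1 /= in_itv/= => /andP[].
  have JJ2 s : D2 (k2 * s + b2) -> (s <= th) = false.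
    move=> Ds; have : ((fun s : X => k2 * s + b2) @^-1` D2) s by [].
    by rewrite J2 /= in_itv/= => /andP[ths _]; rewrite leNgt ths.
  have vE1 s x : D1 (k1 * s + 0) -> 0 <= x <= 1 -> v s x = k1 * v1 (k1 * s + 0) x.
    by move=> /JJ1 sth _; rewrite /v sth.
  have dvE1 s x : D1 (k1 * s + 0) -> 0 <= x <= 1 -> dv s x = k1 * dv1 (k1 * s + 0) x.
    by move=> /JJ1 sth _; rewrite /dv sth.
  have vE2 s x : D2 (k2 * s + b2) -> 0 <= x <= 1 -> v s x = k2 * v2 (k2 * s + b2) x.
    by move=> /JJ2 sth _; rewrite /v sth.
  have dvE2 s x : D2 (k2 * s + b2) -> 0 <= x <= 1 -> dv s x = k2 * dv2 (k2 * s + b2) x.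
    by move=> /JJ2 sth _; rewrite /dv sth.
  have [] := @integral_affine_energy c e v1 dv1 v dv k1 0 D1 k10 c0 e0 H1
    (measurable_itvX _) (@subset_refl _ _) vE1 dvE1.
  rewrite J1 => m1 E1.
  have [] := @integral_affine_energy c e v2 dv2 v dv k2 b2 D2 k20 c0 e0 H2
    (measurable_itvX _) D201 vE2 dvE2.
  rewrite J2 => m2 E2.
  have split01 : I01 = `[0, th]%classic `|` `]th, 1]%classic.
    apply/seteqP; split => s /=; rewrite !in_itv/=.
      by move=> /andP[s0 s1]; case: (leP s th) => sth; [left; rewrite s0|right; rewrite s1].
    by move=> [/andP[-> sth]|/andP[ths ->]]; [rewrite (le_trans sth (ltW th1))|
      rewrite (le_trans (ltW th0) (ltW ths))].
  have mA1 : measurable (`[0, th]%classic : set X) by exact: measurable_itv.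
  have mA2 : measurable (`]th, 1]%classic : set X) by exact: measurable_itv.
  have mU : measurable_fun ((`[0, th]%classic : set X) `|` `]th, 1]%classic)
      (inner_energy c e v dv) by apply/measurable_funU.
  have U0 s : ((`[0, th]%classic : set X) `|` `]th, 1]%classic) s ->
      (0 <= inner_energy c e v dv s)%E by move=> _; exact: inner_energy_ge0.
  have dU : [disjoint (`[0, th]%classic : set X) & `]th, 1]%classic].
    apply/disj_setPS => s [] /=; rewrite !in_itv/= => /andP[_ sth] /andP[ths _].
    by move: (lt_le_trans ths sth); rewrite ltxx.
  rewrite [in LHS]split01.
  apply: etrans; first exact: ge0_integral_setU.
  rewrite E1 E2 !gtr0_norm//; congr (_ + _ * _)%E.
  rewrite integral_itv_obnd_cbnd//.
  by apply: measurable_funS (measurable_inner_energy c0 e0 H2).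
have pw (t : R) : t \in `[0%R, 1%R] ->
    [/\ mu.-integrable I01 (fun y => (dv t y)%:E),
    (forall x, x \in `[0, 1] ->
       ((v t x)%:E = \int[mu]_(y in `[0%R, x]%classic) (dv t y)%:E)%E) &
    v t 1 = 0].
  rewrite in_itv/= => /andP[t_0 t_1]; have [tth|tth] := leP t th.
    by apply: (H10_pointwise_scale H1 (t101 _ t_0 tth) (k := k1)) => x; rewrite /v /dv tth.
  by apply: (H10_pointwise_scale H2 (t201 _ (ltW tth) t_1) (k := k2)) => x;
    rewrite /v /dv leNgt tth.
have Hv : H10field v dv.
  split.
  - have mg1 : measurable_fun [set: X * X] (ext dv1) by apply: measurable_ext; case: H1.
    have mg2 : measurable_fun [set: X * X] (ext dv2) by apply: measurable_ext; case: H2.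
    have mp1 : measurable_fun [set: X * X] (fun p : X * X => (t1 p.1, p.2)).
      by apply: measurable_fun_pair => //; exact: (measurableT_comp mt1).
    have mp2 : measurable_fun [set: X * X] (fun p : X * X => (t2 p.1, p.2)).
      by apply: measurable_fun_pair => //; exact: (measurableT_comp mt2).
    have mgp : measurable_fun [set: X * X] (fun p : X * X =>
        if p.1 <= th then k1 * ext dv1 (t1 p.1, p.2) else k2 * ext dv2 (t2 p.1, p.2)).
      apply: measurable_fun_ifT.
      + exact: (measurableT_comp mle measurable_fst).
      + by apply: measurable_funM => //; exact: (measurableT_comp mg1 mp1).
      + by apply: measurable_funM => //; exact: (measurableT_comp mg2 mp2).
    have := measurable_funTS (D := @square R) mgp.
    apply: eq_measurable_fun => -[t x] /set_mem[/=]; rewrite !in_itv/=.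
    move=> /andP[t_0 t_1] x01; rewrite /dv; case: leP => tth.
      by rewrite ext_in// t101.
    by rewrite ext_in// t201// ltW.
  - rewrite (sqr_inner v) en// -!sqr_inner.
    case: H1 => _ h1 _ _ _; case: H2 => _ h2 _ _ _.
    by apply: lte_add_pinfty; apply: lte_mul_pinfty => //; rewrite lee_fin ltW.
  - by move=> t /pw[].
  - by move=> t x /pw[_ + _]; apply.
  - by move=> t /pw[].
exists v, dv; split; last first.
  by rewrite !Lenergy_inner en// invr_ge0.
split => //; exists f.
have f01 t x : t \in `[0%R, 1%R] -> x \in `[0%R, 1%R] -> f t x \in `[0%R, 1%R].
  move=> _ xI; rewrite /f; case: ifP => _.
    by case: L1 => + _ _; apply => //; rewrite in_itv/= clamp01.
  by case: L2 => + _ _; apply => //; rewrite in_itv/= clamp01.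
have mf x : x \in `[0%R, 1%R] -> measurable_fun [set: X] (fun r => f r x).
  rewrite in_itv/= => x01; apply: measurable_fun_ifT => //.
    have [mc _ _ _] := LagFlow_region H1 L1 x01.
    exact: (measurableT_comp mc mt1).
  have [mc _ _ _] := LagFlow_region H2 L2 x01.
  exact: (measurableT_comp mc mt2).
have fE1 t x : 0 <= t -> t <= th -> f t x = f1 (t1 t) x.
  by move=> t_0 tth; rewrite /f tth clamp_id// t101.
have t1th : t1 th = 1 by rewrite t1E divff.
have t2th : t2 th = 0 by rewrite t2E subrr mul0r.
(* At [t = th] both formulas hold: the first flow ends at [phi1], where the second one starts. *)
have fE2 t x : x \in `[0%R, 1%R] -> th <= t -> t <= 1 -> f t x = f2 (t2 t) x.
  move=> xI; rewrite le_eqVlt => /predU1P[<- _|tht t_1].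
    by rewrite (fE1 _ _ (ltW th0) (lexx th)) t1th t2th f11// f20.
  by rewrite /f leNgt tht/= clamp_id// t201// ltW.
split.
- apply: (LagFlow_mk Hv f01).
  + move=> t tI x y xI yI xy; rewrite /f; case: ifP => _.
      by case: L1 => _ + _; apply => //; rewrite in_itv/= clamp01.
    by case: L2 => _ + _; apply => //; rewrite in_itv/= clamp01.
  + by move=> x xI; exists (fun r => f r x) => //; exact: mf.
  + move=> x xI.
    have x01 : 0 <= x <= 1 by move: xI; rewrite in_itv.
    have iV s t : 0 <= s -> t <= 1 -> mu.-integrable `[s, t] (fun r => (v r (f r x))%:E).
      move=> s_0 t_1; apply: (H10_flow_integrable Hv (mf x xI) s_0 t_1) => r r01.
      by have := f01 r x; rewrite !in_itv/=; apply.
    have P1 s t : 0 <= s -> s < t -> t <= th ->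
        ((f t x - f s x)%:E = \int[mu]_(r in `[s, t]) (v r (f r x))%:E)%E.
      move=> s_0 st tth; have sth := le_trans (ltW st) tth.
      rewrite !fE1 ?(le_trans s_0 (ltW st))//.
      rewrite (affine_flow k10 L1 x01 st) -/(t1 s) -/(t1 t) ?t101// ?(le_trans s_0 (ltW st))//.
      apply: eq_integral => r /set_mem/=; rewrite in_itv/= => /andP[sr rt].
      by rewrite /v (le_trans rt tth) fE1 ?(le_trans s_0 sr)// (le_trans rt tth).
    have P2 s t : th <= s -> s < t -> t <= 1 ->
        ((f t x - f s x)%:E = \int[mu]_(r in `[s, t]) (v r (f r x))%:E)%E.
      move=> ths st t_1; have s_0 := le_trans (ltW th0) ths.
      rewrite !fE2 ?(le_trans ths (ltW st))// ?(le_trans (ltW st) t_1)//.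
      rewrite (affine_flow k20 L2 x01 st) -/(t2 s) -/(t2 t);
        [|by rewrite t201// (le_trans (ltW st))|by rewrite t201// (le_trans ths (ltW st))].
      (* The left end is left out because at [s = th] the field [v] still takes its value from
         [v1]. *)
      have eqV : {in `]s, t]%classic, (fun r : X => (v r (f r x))%:E) =1
          fun r => (k2 * v2 (k2 * r + b2) (f2 (k2 * r + b2) x))%:E}.
        move=> r /set_mem/=; rewrite in_itv/= => /andP[sr rt].
        have thr := le_lt_trans ths sr.
        have -> : f r x = f2 (t2 r) x.
          by apply: fE2 => //; [exact: ltW|exact: le_trans t_1].
        by rewrite /v leNgt thr/=.
      have mV : measurable_fun (`]s, t]%classic : set X) (fun r : X => (v r (f r x))%:E).
        by apply/emeasurable_fun_itv_obnd_cbndP; exact: (measurable_int mu (iV s t s_0 t_1)).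
      rewrite -(integral_itv_obnd_cbnd (f := fun r => (v r (f r x))%:E))//.
      have mV2 : measurable_fun (`]s, t]%classic : set X)
          (fun r : X => (k2 * v2 (k2 * r + b2) (f2 (k2 * r + b2) x))%:E).
        by move: mV; apply: eq_measurable_fun; exact: eqV.
      rewrite -(integral_itv_obnd_cbnd mV2).
      by apply: eq_integral => r rI; exact/esym/eqV.
    move=> s t s_0 st t_1.
    have [tth|tht] := leP t th; first exact: P1.
    have [ths|sth] := leP th s; first exact: P2.
    have i1 := iV s t s_0 t_1.
    have -> : (f t x - f s x)%:E = ((f th x - f s x) + (f t x - f th x))%:E.
      by congr EFin; ring.
    rewrite EFinD P1// P2//.
    have := Rintegral_itvB (x := th) i1; rewrite !bnd_simp => /(_ (ltW sth) (ltW tht)) RB.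
    have i2 := iV th t (ltW th0) t_1.
    have i3 := iV s th s_0 (ltW th1).
    have io : mu.-integrable `]th, t] (EFin \o (fun r => v r (f r x))).
      apply: (integrableS (measurable_itvX _) (measurable_itvX _) _ i2).
      by move=> r /=; rewrite !in_itv/= => /andP[/ltW -> ->].
    move: RB; rewrite (Rintegral_itv_obnd_cbnd io) => RB.
    rewrite -(fineK (integrable_fin_num (measurable_itvX _) i1)).
    rewrite -(fineK (integrable_fin_num (measurable_itvX _) i2)).
    rewrite -(fineK (integrable_fin_num (measurable_itvX _) i3)) -EFinD.
    congr EFin; move: RB; rewrite /Rintegral/= => <-; ring.
- by move=> x xI; rewrite (fE1 _ _ (lexx 0) (ltW th0)) /t1 mulr0 addr0 f10.
- by move=> x xI; rewrite (fE2 _ _ xI (ltW th1) (lexx 1)) t2E divff// f21.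
Qed.

End time_change.

(** * Compactness of admissible fields *)

Section limits.
Variable R : realType.
Local Notation mu := (@lebesgue_measure R).
Local Notation X := (measurableTypeR R).
Local Notation I01 := (`[0%R, 1%R]%classic : set X).
Local Notation mu2 := (mu2 R).
Local Notation square := (@square R).
Implicit Types (v dv : R -> R -> R) (g : X * X -> R) (c : R -> R) (E e s t x : R).

(* An alias of [mu2] on which the sigma-finiteness instance can be declared. *)
Definition mu2s : set (X * X) -> \bar R := mu2.
HB.instance Definition _ := Measure.on mu2s.

Let mu2s_sigma_finite : sigma_finite [set: X * X] mu2s.
Proof.
pose F n : set X := `[- n%:R, n%:R]%classic.
exists (fun n => F n `*` F n).
  apply/seteqP; split => // -[x y] _.
  exists (Num.truncn `|x| + Num.truncn `|y|).+1 => //.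
  have xx : `|x| <= (Num.truncn `|x| + Num.truncn `|y|).+1%:R.
    by rewrite ltW// (lt_le_trans (truncnS_gt _))// ler_nat ltnS leq_addr.
  have yy : `|y| <= (Num.truncn `|x| + Num.truncn `|y|).+1%:R.
    by rewrite ltW// (lt_le_trans (truncnS_gt _))// ler_nat ltnS leq_addl.
  by split; rewrite /F /= in_itv/= -ler_norml.
move=> n; split; first by apply: measurableX; exact: measurable_itv.
rewrite /mu2s mu2X; [|exact: measurable_itv..].
rewrite lebesgue_measure_itv/=; case: ifP => _; last by rewrite mule0 ltry.
by rewrite -EFinD -EFinM ltry.
Qed.

HB.instance Definition _ := Measure_isSigmaFinite.Build _ _ _ mu2s mu2s_sigma_finite.

(** Poincare's inequality with constant 1: [velocity_sqr_le] integrated over the unit square. *)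
Lemma velocity_L2bound v dv E : H10field v dv -> L2bound mu2 (ext dv) E ->
  L2bound mu2 (ext v) E.
Proof.
move=> Hv [_ dvE]; have mv := measurable_ext_velocity Hv.
have mvS : measurable_fun square (fun p : X * X => v p.1 p.2).
  have := measurable_funTS (D := square) mv; apply: eq_measurable_fun => -[t x] /set_mem[/=].
  by rewrite !in_itv/= => t01 x01; rewrite ext_in.
split => //; apply: le_trans dvE; rewrite !integral_ext_sqr//; last by case: Hv.
rewrite (sqr_inner v dv).
have -> : (\int[mu]_(t in I01) \int[mu]_(x in I01) (v t x ^+ 2)%:E =
    \int[mu]_(t in I01) inner_energy 1 0 v dv t)%E.
  apply: eq_integral => t _; apply: eq_integral => x _.
  by rewrite mul1r mul0r addr0.
apply: ge0_le_integral.
- exact: measurable_itv.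
- by move=> t _; exact: inner_energy_ge0.
- exact: measurable_inner_energy.
- exact: measurable_inner_energy.
move=> t; rewrite /= in_itv/= => t01.
have -> : inner_energy 0 1 v dv t = (\int[mu]_(y in I01) (dv t y ^+ 2)%:E)%E.
  by apply: eq_integral => x _; rewrite mul0r add0r mul1r.
set D := (X in (_ <= X)%E).
have D0 : (0 <= D)%E by apply: integral_ge0 => x _; rewrite lee_fin sqr_ge0.
have mt : measurable_fun [set: X] (fun x : X => ((t : X), x)).
  exact: measurable_fun_pair.
have mvt : measurable_fun I01 (v t).
  have := measurable_funTS (D := I01) (measurableT_comp mv mt).
  apply: eq_measurable_fun => x /set_mem/=; rewrite in_itv/= => x01.
  by rewrite /= ext_in.
apply: (@le_trans _ _ (\int[mu]_(x in I01) D)%E); last first.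
  have -> // : (\int[mu]_(x in I01) D = D)%E.
  apply: etrans; first exact: (integral_cst mu (measurable_itvX _)).
  by apply: etrans; [apply: congr1; exact: mu_I01|exact: mule1].
apply: ge0_le_integral.
- exact: measurable_itv.
- by move=> x _; rewrite lee_fin mul1r mul0r addr0 sqr_ge0.
- apply/measurable_EFinP; apply: measurable_funD; apply: measurable_funM => //.
    exact: measurable_funX.
  apply: measurable_funX; apply/measurable_EFinP.
  case: Hv => _ _ /(_ t); rewrite in_itv/= => /(_ t01) idv _ _.
  exact: (measurable_int mu idv).
- exact: measurable_cst.
- move=> x; rewrite /= in_itv/= => x01; rewrite mul1r mul0r addr0.
  exact: (velocity_sqr_le Hv t01 x01).
Qed.

(** A modulus of continuity that depends on [E] only: [K] brings the energy term below [e / 2], then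
    [d] brings the other one below [e / 4]. *)
Lemma amgm_modulus E e : 0 <= E -> 0 < e -> exists K d : R, [/\ 0 < K, 0 < d &
  forall u, 0 <= u -> u <= d -> K / 2 * u + (2 * K)^-1 * E < e].
Proof.
move=> E0 e0; pose K := E / e + 1.
have K0 : 0 < K by rewrite ltr_wpDl// divr_ge0// ltW.
exists K, (e / (2 * K)); split => //; first by rewrite divr_gt0// mulr_gt0.
move=> u u0 ud.
have h1 : K / 2 * u <= e / 4.
  have -> : e / 4 = K / 2 * (e / (2 * K)) by field; rewrite gt_eqF.
  by rewrite ler_wpM2l// divr_ge0// ltW.
have h2 : (2 * K)^-1 * E <= e / 2.
  rewrite mulrC ler_pdivrMr ?mulr_gt0//.
  have -> : e / 2 * (2 * K) = E + e by rewrite /K; field; rewrite gt_eqF.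
  by rewrite lerDl ltW.
by lra.
Qed.

(** Two regions below curves at uniform distance at most [eta] differ only inside this neighbourhood
    of one of the curves. *)
Definition tube c (eta : R) : set (X * X) :=
  [set p | 0 <= p.1 <= 1 /\ `|p.2 - c p.1| <= eta].

Lemma measurable_tube c eta : measurable_fun [set: X] c -> measurable (tube c eta).
Proof.
move=> mc.
have -> : tube c eta = (I01 `*` [set: X]) `&`
    ((fun p : X * X => p.2 - c p.1) @^-1` `[- eta, eta]).
  by apply/seteqP; split => -[r y]; rewrite /tube /= !in_itv/= -ler_norml; tauto.
apply: measurableI; first by apply: measurableX => //; exact: measurable_itv.
rewrite -[Z in measurable Z]setTI.
have mf : measurable_fun [set: X * X] (fun p : X * X => p.2 - c p.1).
  apply: measurable_funB; first exact: measurable_snd.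
  by apply: (measurableT_comp mc); exact: measurable_fst.
by apply: mf => //; exact: measurable_itv.
Qed.

Lemma mu2_tube c eta : measurable_fun [set: X] c -> 0 <= eta ->
  (mu2 (tube c eta) <= (2 * eta)%:E)%E.
Proof.
move=> mc eta0; have mT := measurable_tube eta mc.
have -> : mu2 (tube c eta) = (\int[mu2]_p (\1_(tube c eta) p)%:E)%E.
  by rewrite integral_indic// setIT.
rewrite mu2_tonelli; last 2 first.
- by apply/measurable_EFinP; exact: measurable_indic.
- by move=> p; rewrite lee_fin indicE; case: (_ \in _).
have -> : (2 * eta)%:E = (\int[mu]_(t in I01) (2 * eta)%:E)%E.
  apply/esym; apply: etrans; first exact: (integral_cst mu (measurable_itvX _)).
  by apply: etrans; [apply: congr1; exact: mu_I01|exact: mule1].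
rewrite [leRHS]integral_mkcond; apply: ge0_le_integral => //.
- by move=> t _; apply: integral_ge0 => y _; rewrite lee_fin indicE; case: (_ \in _).
- apply: (@mu2_tonelli_measurable R (fun p => (\1_(tube c eta) p)%:E)).
    by apply/measurable_EFinP; exact: measurable_indic.
  by move=> p; rewrite lee_fin indicE; case: (_ \in _).
- by apply/(measurable_restrictT _ (measurable_itvX _)); exact: measurable_cst.
move=> t _; rewrite /patch; case: ifPn => tI; last first.
  rewrite integral0_eq// => y _; rewrite indicE memNset// => -[/= t01 _].
  by move/negP: tI; apply; apply/mem_set; rewrite /= in_itv.
have -> : (2 * eta)%:E = mu (`[c t - eta, c t + eta]%classic : set X).
  rewrite lebesgue_measure_itv/= lte_fin; case: ltP => h.
    by rewrite -EFinD; congr EFin; ring.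
  by congr EFin; lra.
rewrite -[X in (_ <= mu X)%E]setIT.
have -> : mu (`[c t - eta, c t + eta]%classic `&` [set: X]) =
  (\int[mu]_y (\1_(`[c t - eta, c t + eta]%classic : set X) y)%:E)%E.
  by apply/esym; exact: (integral_indic mu measurableT (measurable_itvX _)).
apply: ge0_le_integral => //.
- apply/measurable_EFinP.
  have mt : measurable_fun [set: X] (fun y : X => ((t : X), y)).
    exact: measurable_fun_pair.
  exact: (measurableT_comp (measurable_indic mT) mt).
- by apply/measurable_EFinP; apply: measurable_indic; exact: measurable_itv.
- move=> y _; rewrite lee_fin !indicE; case: (boolP (_ \in tube c eta)) => [/set_mem[/= _ yc]|_].
    rewrite mem_set//= in_itv/=; move: yc; rewrite ler_norml => /andP[? ?].
    by apply/andP; split; lra.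
  by case: (_ \in _).
Qed.

Lemma L2bound_integrableT g E : L2bound mu2 g E -> (forall p, ~ square p -> g p = 0) ->
  mu2.-integrable [set: X * X] (EFin \o g).
Proof.
move=> gE g0.
have := L2bound_integrable gE (@measurable_square R) (@mu2_square_lty R).
move/(integrable_mkcond _ (@measurable_square R)); rewrite restrict_EFin.
rewrite (_ : g \_ square = g)//; apply/funext => p; rewrite /patch.
by case: ifPn => // /negP ps; rewrite g0// => /mem_set.
Qed.

Lemma region_dist g E s t c c' eta (K : R) : L2bound mu2 g E ->
  (forall p, ~ square p -> g p = 0) ->
  measurable_fun [set: X] c -> measurable_fun [set: X] c' ->
  0 <= s -> t <= 1 -> 0 <= eta -> 0 < K ->
  (forall r, 0 <= r <= 1 -> `|c' r - c r| <= eta) ->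
  `|\int[mu2]_(p in region s t c') g p - \int[mu2]_(p in region s t c) g p| <=
    K / 2 * (2 * eta) + (2 * K)^-1 * E.
Proof.
move=> gE g0 mc mc' s0 t1 eta0 K0 cc'.
have igT := L2bound_integrableT gE g0.
have mA c0 : measurable_fun [set: X] c0 -> measurable (region s t c0).
  exact: measurable_region.
have iA c0 : measurable_fun [set: X] c0 ->
    mu2.-integrable [set: X * X] (EFin \o (g \_ (region s t c0))).
  move=> mc0; rewrite -restrict_EFin; apply/(integrable_mkcond _ (mA _ mc0)).
  exact: (integrableS measurableT (mA _ mc0) _ igT).
rewrite ![\int[mu2]_(p in region _ _ _) _]Rintegral_mkcond -RintegralB//; last 2 first.
- exact: iA.
- exact: iA.
have iD := integrable_EFinB measurableT (iA _ mc') (iA _ mc).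
apply: le_trans (le_normr_Rintegral measurableT iD) _.
rewrite -lee_fin fineK; last first.
  by apply: integrable_fin_num => //; exact: integrable_norm iD.
have mT := measurable_tube eta mc.
apply: le_trans (L2bound_norm_integral gE mT (mu2_tube mc eta0) K0).
rewrite [leRHS]integral_mkcond; apply: ge0_le_integral => //.
- apply/measurable_EFinP; apply: measurableT_comp => //.
  by apply/measurable_EFinP; exact: (measurable_int mu2 iD).
- apply/(measurable_restrictT _ mT)/measurable_funTS/measurable_EFinP.
  by apply: measurableT_comp => //; case: gE.
move=> p _; rewrite /patch /=.
have [pt|pt] := boolP (p \in tube c eta).
  case: (boolP (p \in region s t c')) => _; case: (boolP (p \in region s t c)) => _;
    by rewrite lee_fin ?subrr ?subr0 ?sub0r ?normrN ?normr0.
suff -> : (p \in region s t c') = (p \in region s t c) by rewrite subrr normr0.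
have np : ~ tube c eta p by move=> /mem_set; exact/negP.
case: p np {pt} => r y np.
apply/idP/idP => /set_mem[/= /andP[sr rt] /andP[y0 yc]]; apply/mem_set; split => //=;
  rewrite ?sr ?y0//=; rewrite leNgt; apply/negP => cy; apply: np;
  have r01 : 0 <= r <= 1 by rewrite (le_trans s0 (ltW sr)) (le_trans rt t1).
  split => //=; have := cc' r r01; rewrite ler_norml => /andP[? ?].
  by rewrite ler_norml; apply/andP; split; lra.
split => //=; have := cc' r r01; rewrite ler_norml => /andP[? ?].
by rewrite ler_norml; apply/andP; split; lra.
Qed.

(** This is the boundary condition [v t 1 = 0] integrated over a set of times, a form that survives
    weak limits. *)
Lemma H10_strip_zero v dv (B : set X) : H10field v dv -> measurable B ->
  \int[mu2]_(p in B `*` [set: X]) ext dv p = 0.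
Proof.
move=> Hv mB.
have mBT : measurable (B `*` [set: X]) by exact: measurableX.
rewrite Rintegral_mkcond; apply: EFin_inj; rewrite fineK; last first.
  by apply: integrable_fin_num => //; exact: (H10_integrable Hv).
rewrite (mu2_fubini (H10_integrable Hv mBT)).
apply: integral0_eq => t _ /=.
have [tB|tB] := pselect (B t); last first.
  by rewrite integral0_eq// => y _; rewrite /patch memNset// => -[].
have [t01|t01] := pselect (0 <= t <= 1); last first.
  rewrite integral0_eq// => y _; rewrite /patch; case: ifP => // _.
  by rewrite ext_out// => -[/=]; rewrite in_itv.
case: Hv => _ _ _ vE v1.
have tI : (t : R) \in `[0%R, 1%R] by rewrite in_itv.
have I1 : (1 : R) \in `[0%R, 1%R] by rewrite in_itv/= ler01 lexx.
transitivity ((v t 1)%:E); last by rewrite v1.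
rewrite (vE t 1 tI I1) [RHS]integral_mkcond; apply: eq_integral => y _.
rewrite /patch mem_set//; case: ifPn => yI.
  by rewrite ext_in//; move/set_mem: yI; rewrite /= in_itv.
by rewrite ext_out// => -[_ /= yI']; move/negP: yI; apply; exact/mem_set.
Qed.

Lemma eq_Rintegral_slices (A : set (X * X)) (N : set X) (u w : X * X -> R) :
  measurable A -> measurable N -> mu N = 0%E ->
  measurable_fun [set: X * X] u -> measurable_fun [set: X * X] w ->
  (forall p, ~ N p.1 -> u p = w p) ->
  \int[mu2]_(p in A) u p = \int[mu2]_(p in A) w p.
Proof.
move=> mA mN N0 mu_ mw uw; rewrite /Rintegral; congr fine.
apply: ae_eq_integral => //.
- by apply/measurable_EFinP; exact: measurable_funTS.
- by apply/measurable_EFinP; exact: measurable_funTS.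
exists (N `*` [set: X]); split.
- exact: measurableX.
- by rewrite mu2X// N0 mul0e.
- move=> p /= pN; split => //; apply: contrapT => pN'; apply: pN => _.
  by rewrite uw.
Qed.

(* A field of [H10field] is constrained at every time, a weak limit only at almost
   every one: dv is set to 0 on the exceptional times N. *)
Lemma H10_of_weak_limit g E : L2bound mu2 g E ->
  (forall p, ~ square p -> g p = 0) ->
  (forall B : set X, measurable B -> \int[mu2]_(p in B `*` [set: X]) g p = 0) ->
  exists v dv (N : set X), [/\ H10field v dv, measurable N, mu N = 0%E,
    forall p, ~ N p.1 -> ext dv p = g p & forall p, `|ext dv p| <= `|g p|].
Proof.
move=> gE g0 gB.
have mg : measurable_fun [set: X * X] g by case: gE.
have mgE : measurable_fun [set: X * X] (EFin \o g) by exact/measurable_EFinP.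
have igT := L2bound_integrableT gE g0.
pose A t : \bar R := (\int[mu]_y `|(g (t, y))%:E|)%E.
pose F t : \bar R := (\int[mu]_y (g (t, y))%:E)%E.
have mA : measurable_fun [set: X] A.
  apply: (@mu2_tonelli_measurable R (fun p => `|(EFin \o g) p|)%E) => //.
  exact: measurableT_comp.
have iF : mu.-integrable [set: X] F by exact: (mu2_fubini_integrable igT).
have mF := measurable_int mu iF.
(* The exceptional times: the slice of [g] is not integrable, or its integral is not 0. *)
pose N : set X := A @^-1` [set +oo%E] `|` F @^-1` (~` [set 0%E]).
have mN : measurable N.
  apply: measurableU.
    by rewrite -[Z in measurable Z]setTI; apply: mA => //; exact: emeasurable_set1.
  rewrite -[Z in measurable Z]setTI; apply: mF => //; apply: measurableC.
  exact: emeasurable_set1.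
have N0 : mu N = 0%E.
  have aeA : {ae mu, forall t, A t \is a fin_num}.
    apply: filterS (ae_integrable1 igT) => t /integrableP[_ tlt].
    by rewrite ge0_fin_numE//; apply: integral_ge0.
  (* By [gB] the function [F] integrates to 0 over every measurable set of times. *)
  have aeF : ae_eq mu [set: X] F (cst 0%E).
    apply: (@integral_ae_eq _ X R mu setT measurableT (cst 0%E) F iF).
      exact: measurable_cst.
    move=> B _ mB; rewrite [RHS]integral0_eq//.
    have iB := integrableS measurableT mB (@subsetT _ B) iF.
    have mBT : measurable (B `*` [set: X]) by exact: measurableX.
    have iBT : mu2.-integrable [set: X * X] (EFin \o (g \_ (B `*` [set: X]))).
      rewrite -restrict_EFin; apply/(integrable_mkcond _ mBT).
      exact: (integrableS measurableT mBT _ igT).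
    have gB0 : (\int[mu2]_(p in B `*` [set: X]) g p)%:E = 0%E by rewrite gB.
    rewrite -gB0 Rintegral_mkcond fineK; last exact: (integrable_fin_num measurableT iBT).
    rewrite (mu2_fubini iBT) [LHS]integral_mkcond.
    apply: eq_integral => t _; rewrite /patch; case: ifPn => tB.
      by apply: eq_integral => y _; rewrite /= mem_set//; split => //; exact: set_mem.
    rewrite integral0_eq// => y _; rewrite /= memNset// => -[/= tB' _].
    by move/negP: tB; apply; exact/mem_set.
  case: aeA => M1 [mM1 M10 AM1]; case: aeF => M2 [mM2 M20 FM2].
  have NM : N `<=` M1 `|` M2.
    move=> t [/= At|/= Ft]; [left; apply: AM1|right; apply: FM2] => /=; first by rewrite At.
    by move=> /(_ I).
  apply/eqP; rewrite eq_le measure_ge0 andbT.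
  have mM : measurable (M1 `|` M2) by exact: measurableU.
  apply: le_trans (le_measure _ (mem_set mN) (mem_set mM) NM) _.
  apply: le_trans (measureU2 mu mM1 mM2) _.
  by rewrite [X in (X + _)%E]M10 [X in (_ + X)%E]M20 adde0.
pose dv (t y : R) : R := if pselect (N t) then 0 else g (t, y).
pose v (t x : R) : R := fine (\int[mu]_(y in `[0%R, x]%classic) (dv t y)%:E)%E.
have dvE p : ext dv p = g p * \1_(~` N) p.1.
  case: p => t y; have [pS|pS] := pselect (square (t, y)); last first.
    by rewrite ext_out// g0// mul0r.
  case: (pS) => /=; rewrite !in_itv/= => t01 y01.
  rewrite ext_in// /dv indicE; case: pselect => tN.
    by rewrite memNset ?mulr0// => /(_ tN).
  by rewrite mem_set ?mulr1.
have good t : ~ N t -> mu.-integrable [set: X] (fun y => (g (t, y))%:E) /\ F t = 0%E.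
  move=> Nt; split.
    apply/integrableP; split.
      have mt : measurable_fun [set: X] (fun y : X => ((t : X), y)).
        exact: measurable_fun_pair.
      exact: (measurableT_comp mgE mt).
    by rewrite ltey; apply/eqP => AE; apply: Nt; left.
  by apply: contrapT => Ft; apply: Nt; right.
have idv t : mu.-integrable I01 (fun y => (dv t y)%:E).
  rewrite /dv; case: pselect => tN; first exact: integrable0.
  exact: (integrableS measurableT (measurable_itvX _) (@subsetT _ _) (good t tN).1).
exists v, dv, N; split => //.
- have mdv : measurable_fun square (fun p : X * X => dv p.1 p.2).
    have mG : measurable_fun [set: X * X] (fun p => g p * \1_(~` N) p.1).
      apply: measurable_funM => //.
      have mi : measurable_fun [set: X] (\1_(~` N) : X -> R).
        by apply: measurable_indic; exact: measurableC.
      exact: (measurableT_comp mi measurable_fst).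
    have := measurable_funTS (D := square) mG; apply: eq_measurable_fun => -[t y] /set_mem[/=].
    by rewrite !in_itv/= => t01 y01; rewrite -dvE ext_in.
  split => //.
  + rewrite -integral_ext_sqr//; apply: le_lt_trans (ltry E); case: gE => _; apply: le_trans.
    apply: ge0_le_integral => //.
    * by move=> p _; rewrite lee_fin sqr_ge0.
    * by apply/measurable_EFinP/measurable_funX; exact: measurable_ext.
    * by apply/measurable_EFinP; exact: measurable_funX.
    * move=> p _; rewrite lee_fin dvE exprMn ler_piMr ?sqr_ge0// indicE.
  + move=> t x _; rewrite in_itv/= => /andP[x0 x1]; rewrite /v fineK//.
    apply: integrable_fin_num; first exact: measurable_itv.
    apply: (integrableS (measurable_itvX _) (measurable_itvX _) _ (idv t)).
    by move=> y /=; rewrite !in_itv/= => /andP[-> yx]; exact: le_trans x1.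
  + move=> t _; rewrite /v /dv; case: pselect => tN.
      by rewrite integral0_eq.
    have -> : (\int[mu]_(y in `[0%R, 1%R]%classic) (g (t, y))%:E = F t)%E.
      rewrite [LHS]integral_mkcond; apply: eq_integral => y _; rewrite /patch.
      case: ifPn => // yI; rewrite g0// => -[_ /= yI'].
      by move/negP: yI; apply; exact/mem_set.
    by have [_ ->] := good t tN.
- move=> p Np; rewrite dvE indicE mem_set ?mulr1//.
- by move=> p; rewrite dvE normrM ler_piMr// indicE; case: (p.1 \in ~` N); rewrite ?normr1 ?normr0.
Qed.

End limits.

(** * The limit flow and the compactness theorem *)

Section compactness.
Variable R : realType.
Local Notation mu := (@lebesgue_measure R).
Local Notation X := (measurableTypeR R).
Local Notation I01 := (`[0%R, 1%R]%classic : set X).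
Local Notation mu2 := (mu2 R).
Local Notation square := (@square R).

Lemma Lenergy_split (v dv : R -> R -> R) (C : R) : H10field v dv ->
  (Lenergy v dv <= C%:E)%E -> exists p q : R,
  [/\ (\int[mu2]_z (ext v z ^+ 2)%:E = p%:E)%E, (\int[mu2]_z (ext dv z ^+ 2)%:E = q%:E)%E,
      0 <= p, 0 <= q & Lenergy v dv = (p + 4^-1 * q)%:E].
Proof.
move=> Hv; rewrite (Lenergy_ext Hv) => LC.
set P := (\int[mu2]_z (ext v z ^+ 2)%:E)%E in LC *.
set Q := (\int[mu2]_z (ext dv z ^+ 2)%:E)%E in LC *.
have P0 : (0 <= P)%E by apply: integral_ge0 => z _; rewrite lee_fin sqr_ge0.
have Q0 : (0 <= Q)%E by apply: integral_ge0 => z _; rewrite lee_fin sqr_ge0.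
have k0 : (0 <= 4^-1%:E * Q)%E by apply: mule_ge0 => //; rewrite lee_fin invr_ge0.
have Pfin : P \is a fin_num.
  rewrite ge0_fin_numE//; apply: le_lt_trans (ltry C); apply: le_trans LC.
  exact: leeDl.
have Qfin : Q \is a fin_num.
  have : (4^-1%:E * Q <= C%:E)%E by apply: le_trans LC; exact: leeDr.
  have k40 : (0 < (4^-1%:E : \bar R))%E by rewrite lte_fin invr_gt0.
  by case: (Q) Q0 => [r| |] // _; rewrite gt0_muley.
exists (fine P), (fine Q); rewrite !fineK//; split => //; [exact: fine_ge0..|].
by rewrite EFinD EFinM !fineK.
Qed.

Lemma ultra_lim_unique (U : set_system nat) (u : nat -> R) (l l' : R) : UltraFilter U ->
  u @ U --> l -> u @ U --> l' -> l = l'.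
Proof. by move=> UU; exact: cvg_unique. Qed.

Section limit_flow.
Variables (U : set_system nat) (vn dvn phin : nat -> R -> R -> R) (C : R).
Hypothesis UU : UltraFilter U.
Hypothesis Hn : forall n, H10field (vn n) (dvn n).
Hypothesis Ln : forall n, LagFlow (vn n) (phin n).
Hypothesis gC : forall n, L2bound mu2 (ext (dvn n)) C.

Let C0 : 0 <= C. Proof. exact: L2bound_ge0 (gC 0%N). Qed.

(** The two [clamp] keep all terms in [0, 1], so that the limit along [U] exists for all real [t]
    and [x]. *)
Definition limit_flow (t x : R) : R :=
  lim ((fun n => phin n (clamp t) (clamp x)) @ U).

Let phin01 n t x : 0 <= phin n (clamp t) (clamp x) <= 1.
Proof.
case: (Ln n) => + _ _ => /(_ (clamp t) (clamp x)).
by rewrite !in_itv/=; apply; exact: clamp01.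
Qed.

Lemma limit_flow_cvg t x : 0 <= t <= 1 -> 0 <= x <= 1 ->
  (fun n => phin n t x) @ U --> limit_flow t x.
Proof.
move=> t01 x01.
have b n : `|phin n (clamp t) (clamp x)| <= 1.
  by have /andP[p0 p1] := phin01 n t x; rewrite ger0_norm.
have [h _] := ultra_bounded_cvg UU b.
by move: h; rewrite /limit_flow !clamp_id.
Qed.

Lemma limit_flow01 t x : 0 <= limit_flow t x <= 1.
Proof.
have b n : `|phin n (clamp t) (clamp x)| <= 1.
  by have /andP[p0 p1] := phin01 n t x; rewrite ger0_norm.
have [h _] := ultra_bounded_cvg UU b.
apply/andP; split.
  by apply: (cvgr_to_ge h); apply: (@filterE _ U) => n; case/andP: (phin01 n t x).
by apply: (cvgr_to_le h); apply: (@filterE _ U) => n; case/andP: (phin01 n t x).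
Qed.

Lemma limit_flow_mono t x y : 0 <= t <= 1 -> 0 <= x <= 1 -> 0 <= y <= 1 -> x <= y ->
  limit_flow t x <= limit_flow t y.
Proof.
move=> t01 x01 y01 xy.
apply: (ler_cvg_to (limit_flow_cvg t01 x01) (limit_flow_cvg t01 y01)).
apply: (@filterE _ U) => n; case: (Ln n) => _ + _ => /(_ t); rewrite in_itv/= => /(_ t01).
by apply => //; rewrite in_itv.
Qed.

Lemma limit_flow_equicontinuous x s t (K : R) : 0 <= x <= 1 -> 0 <= s -> s <= t -> t <= 1 ->
  0 < K -> `|limit_flow t x - limit_flow s x| <= K / 2 * (t - s) + (2 * K)^-1 * C.
Proof.
move=> x01 s0 st t1 K0.
have t01 : 0 <= t <= 1 by rewrite t1 (le_trans s0 st).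
have s01 : 0 <= s <= 1 by rewrite s0 (le_trans st t1).
have FU : Filter U by exact: (@filter_filter _ U).
have h : (fun n => `|phin n t x - phin n s x|) @ U --> `|limit_flow t x - limit_flow s x|.
  exact: cvg_norm (cvgB (limit_flow_cvg t01 x01) (limit_flow_cvg s01 x01)).
apply: (cvgr_to_le h); apply: (@filterE _ U) => n /=.
exact: (LagFlow_equicontinuous (Hn n) (Ln n) (gC n)).
Qed.

(** The Arzela-Ascoli argument: convergence on a finite grid of times, and equicontinuity of the
    flows and of their limit between [t] and the grid time just below it, each at a cost of [e / 4].
    The grid has [N.+1] points so as to contain the time 1. *)
Lemma limit_flow_uniform x (e : R) : 0 <= x <= 1 -> 0 < e ->
  \forall n \near U, forall t, 0 <= t <= 1 -> `|phin n t x - limit_flow t x| <= e.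
Proof.
move=> x01 e0.
have e4 : 0 < e / 4 by lra.
have [K [d [K0 d0 Kd]]] := amgm_modulus C0 e4.
pose N := (Num.truncn d^-1).+1.
have N0 : 0 < N%:R :> R by rewrite ltr0n.
have Nd : N%:R^-1 <= d.
  rewrite -[leRHS]invrK lef_pV2 ?posrE ?invr_gt0//.
  by rewrite ltW// truncnS_gt.
have i01 (i : 'I_N.+1) : 0 <= (i%:R / N%:R : R) <= 1.
  apply/andP; split; first by rewrite divr_ge0// ltW.
  by rewrite ler_pdivrMr// mul1r ler_nat -ltnS.
have : \forall n \near U, forall i : 'I_N.+1,
    `|limit_flow (i%:R / N%:R) x - phin n (i%:R / N%:R) x| <= e / 4.
  apply: filter_forall => i.
  by have /cvgrPdist_le/(_ _ e4) := limit_flow_cvg (i01 i) x01.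
apply: filterS => n Hi t /andP[t0 t1].
have tN0 : 0 <= t * N%:R by rewrite mulr_ge0// ltW.
pose i := Num.truncn (t * N%:R).
have iN : (i < N.+1)%N.
  rewrite ltnS /i truncn_le_nat; apply: (@le_lt_trans _ _ (N%:R)); last by rewrite ltr_nat.
  by rewrite ler_piMl// ltW.
have /andP[i1 i2] := truncn_itv tN0.
have r1 : i%:R / N%:R <= t by rewrite ler_pdivrMr.
have r0 : 0 <= i%:R / N%:R :> R by rewrite divr_ge0// ltW.
have r2 : t - i%:R / N%:R <= d.
  apply: le_trans Nd; rewrite lerBlDr -[X in X + _]mul1r -mulrDl ler_pdivlMr// ltW//.
  by rewrite [X in _ < X]addrC natr1.
have tr0 : 0 <= t - i%:R / N%:R by rewrite subr_ge0.
have h1 := LagFlow_equicontinuous (Hn n) (Ln n) (gC n) x01 r0 r1 t1 K0.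
have h2 := limit_flow_equicontinuous x01 r0 r1 t1 K0.
have h3 := Kd _ tr0 r2.
have h4 := Hi (Ordinal iN).
move: h1 h2 h4 => /=; rewrite -/i !ler_norml => /andP[? ?] /andP[? ?] /andP[? ?].
by apply/andP; split; lra.
Qed.

Let c x (r : X) : R := limit_flow (clamp r) x.
Let cn n x (r : X) : R := phin n (clamp r) x.

Lemma measurable_limit_flow x : 0 <= x <= 1 ->
  measurable_fun [set: X] (fun r => limit_flow (clamp r) x).
Proof.
move=> x01; apply: continuous_measurable_fun.
apply: (@uniformly_continuous_clamp R (limit_flow ^~ x)) => e e0.
have [K [d [K0 d0 Kd]]] := amgm_modulus C0 e0.
exists d => // s t s0 st t1 std.
apply: le_lt_trans (limit_flow_equicontinuous x01 s0 st t1 K0) _.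
by apply: Kd; [rewrite subr_ge0|exact: ltW].
Qed.

(** Weak convergence applies on the region of the limit line, which does not depend on [n].
    Replacing the region of the [n]-th line by it costs little, by [region_dist], since the lines
    are uniformly close and the derivatives share the bound [C]. *)
Lemma limit_flow_region x s t (g : X * X -> R) : 0 <= x <= 1 -> 0 <= s -> s < t -> t <= 1 ->
  (forall A, measurable A -> A `<=` square ->
    (fun n => \int[mu2]_(p in A) ext (dvn n) p) @ U --> \int[mu2]_(p in A) g p) ->
  (forall p, ~ square p -> g p = 0) ->
  limit_flow t x - limit_flow s x = \int[mu2]_(p in region s t (c x)) g p.
Proof.
move=> x01 s0 st t1 wg g0.
have t01 : 0 <= t <= 1 by rewrite t1 (le_trans s0 (ltW st)).
have s01 : 0 <= s <= 1 by rewrite s0 (le_trans (ltW st) t1).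
apply: (ultra_lim_unique UU (cvgB (limit_flow_cvg t01 x01) (limit_flow_cvg s01 x01))).
have mA := measurable_region s t (measurable_limit_flow x01).
pose A := region s t (c x) `&` square.
have mAS : measurable A by apply: measurableI => //; exact: measurable_square.
have AE (u : X * X -> R) : (forall p, ~ square p -> u p = 0) ->
    \int[mu2]_(p in region s t (c x)) u p = \int[mu2]_(p in A) u p.
  move=> u0; rewrite [LHS]Rintegral_mkcond [RHS]Rintegral_mkcond; congr (Rintegral _ _ _).
  apply/funext => p; rewrite /patch.
  have -> : (p \in A) = (p \in region s t (c x)) && (p \in square) by exact: in_setI.
  have [ps|ps] := boolP (p \in square); first by rewrite andbT.
  by rewrite andbF u0 ?if_same// => /mem_set; exact/negP.
have wA := wg A mAS (@subIsetr _ _ _).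
rewrite (AE g g0).
apply/cvgrPdist_le => /= e e0.
have e2 : 0 < e / 2 by lra.
have [K [d [K0 d0 Kd]]] := amgm_modulus C0 e2.
(* Lines within [d / 2] give a tube of area at most [d], the range covered by the modulus. *)
have d2 : 0 < d / 2 by lra.
near=> n.
have [mcn _ _ cnE] := LagFlow_region (Hn n) (Ln n) x01.
suff : `|\int[mu2]_(p in A) g p - (phin n t x - phin n s x)| <= e by [].
rewrite (cnE _ _ s0 st t1) -/(cn n x).
have close r : 0 <= r <= 1 -> `|cn n x r - c x r| <= d / 2.
  move=> r01; rewrite /cn /c clamp_id//; move: r r01.
  by near: n; exact: limit_flow_uniform.
have := region_dist (gC n) (@ext_out _ _) (measurable_limit_flow x01) mcn s0 t1 (ltW d2) K0 close.
rewrite (AE _ (@ext_out _ _)) => h1.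
have h2 : `|\int[mu2]_(p in A) g p - \int[mu2]_(p in A) ext (dvn n) p| <= e / 2.
  by near: n; move/cvgrPdist_le : wA; apply.
have h3 : K / 2 * (2 * (d / 2)) + (2 * K)^-1 * C < e / 2.
  by rewrite (_ : 2 * (d / 2) = d); [apply: Kd => //; exact: ltW|field].
move: h1 h2; rewrite !ler_norml => /andP[? ?] /andP[? ?]; apply/andP; split; lra.
Unshelve. all: by end_near. Qed.

End limit_flow.

(** The last clause is lower semicontinuity of the energy. Stated for every eventual bound [c], it
    gives minimality along a minimizing sequence and, with [c] a common bound, existence and
    completeness. *)
Theorem Admissible_compact (a b : R -> R) (an bn : nat -> R -> R)
    (vn dvn : nat -> R -> R -> R) (C : R) :
  (forall n, Admissible (an n) (bn n) (vn n) (dvn n)) ->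
  (forall n, Lenergy (vn n) (dvn n) <= C%:E)%E ->
  (forall x, x \in `[0, 1] -> (fun n => an n x) @ \oo --> a x) ->
  (forall x, x \in `[0, 1] -> (fun n => bn n x) @ \oo --> b x) ->
  exists v dv, Admissible a b v dv /\
    forall c : R, (\forall n \near \oo, (Lenergy (vn n) (dvn n) <= c%:E)%E) ->
      (Lenergy v dv <= c%:E)%E.
Proof.
move=> adm LC ana bnb.
have [U [UU oU]] := @ultraFilterLemma nat \oo _.
have Hn n : H10field (vn n) (dvn n) by case: (adm n).
have flow n : exists phi, [/\ LagFlow (vn n) phi,
    (forall x, x \in `[0, 1] -> phi 0 x = an n x) &
    (forall x, x \in `[0, 1] -> phi 1 x = bn n x)] by case: (adm n).
pose phin n := sval (cid (flow n)).
have Ln n : LagFlow (vn n) (phin n) by rewrite /phin; case: cid => ? [].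
have phin0 n x : x \in `[0, 1] -> phin n 0 x = an n x.
  by rewrite /phin; case: cid => ? [? + _] /=; apply.
have phin1 n x : x \in `[0, 1] -> phin n 1 x = bn n x.
  by rewrite /phin; case: cid => ? [? _ +] /=; apply.
have [p pE] := choice (fun n => Lenergy_split (Hn n) (LC n)).
have {pE}[q pq] := choice pE.
(* The factor 4 undoes the weight 1/4 of the derivative in the energy. *)
have gC n : L2bound mu2 (ext (dvn n)) (4 * C).
  have [_ qE p0 q0 LE] := pq n.
  split; first by apply: measurable_ext; case: (Hn n).
  by have := LC n; rewrite qE LE !lee_fin; lra.
have gCv n : L2bound mu2 (ext (vn n)) C.
  have [pE _ p0 q0 LE] := pq n.
  split; first exact: measurable_ext_velocity (Hn n).
  by have := LC n; rewrite pE LE !lee_fin; lra.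
have mS := @measurable_square R.
have Soo := @mu2_square_lty R.
have [g0 [mg0 ig0 g0out wg0]] := L2_weak_compact (m := @mu2s R) UU gC mS Soo.
have ig0S : mu2.-integrable square (EFin \o g0).
  exact: (integrableS measurableT mS _ ig0).
have sqT (u : X * X -> R) : (forall z, ~ square z -> u z = 0) ->
    (\int[mu2]_z (u z ^+ 2)%:E = \int[mu2]_(z in square) (u z ^+ 2)%:E)%E.
  move=> u0; rewrite [RHS]integral_mkcond; apply: eq_integral => z _.
  rewrite /patch; case: ifPn => // /negP zS.
  by rewrite u0 ?expr0n// => /mem_set.
have lsc (f : nat -> X * X -> R) (g : X * X -> R) E : (forall n, L2bound mu2 (f n) E) ->
    mu2.-integrable square (EFin \o g) -> measurable_fun [set: X * X] g ->
    (forall z, ~ square z -> g z = 0) -> (forall n z, ~ square z -> f n z = 0) ->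
    (forall A, measurable A -> A `<=` square ->
      (fun n => \int[mu2]_(z in A) f n z) @ U --> \int[mu2]_(z in A) g z) ->
    forall r : R, (\forall n \near U, (\int[mu2]_z (f n z ^+ 2)%:E <= r%:E)%E) ->
      (\int[mu2]_z (g z ^+ 2)%:E <= r%:E)%E.
  move=> fE ig mg gout fout fg r fr; rewrite sqT//.
  apply: (weak_lsc UU fE mS Soo ig fg (measurable_funTS mg)).
  by apply: filterS fr => n; rewrite sqT//; exact: fout.
have g0C : L2bound mu2 g0 (4 * C).
  split => //; apply: (lsc _ _ _ gC) => //; first by move=> n z; exact: ext_out.
  by apply: (@filterE _ U) => n; case: (gC n).
have g0B (B : set X) : measurable B -> \int[mu2]_(z in B `*` [set: X]) g0 z = 0.
  move=> mB.
  have mBS : measurable ((B `*` [set: X]) `&` square).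
    by apply: measurableI => //; exact: measurableX.
  have BE (u : X * X -> R) : (forall z, ~ square z -> u z = 0) ->
      \int[mu2]_(z in B `*` [set: X]) u z = \int[mu2]_(z in (B `*` [set: X]) `&` square) u z.
    move=> u0; rewrite [LHS]Rintegral_mkcond [RHS]Rintegral_mkcond; congr (Rintegral _ _ _).
    apply/funext => z; rewrite /patch.
    have -> : (z \in (B `*` [set: X]) `&` square) = (z \in B `*` [set: X]) && (z \in square).
      exact: in_setI.
    have [zs|zs] := boolP (z \in square); first by rewrite andbT.
    by rewrite andbF u0 ?if_same// => /mem_set; exact/negP.
  have := wg0 _ mBS (@subIsetr _ _ _).
  rewrite BE//; set l := Rintegral _ _ g0 => h.
  apply: (ultra_lim_unique UU h).
  rewrite (_ : (fun n => _) = fun=> 0); first exact: cvg_cst.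
  apply/funext => n; rewrite -[RHS](H10_strip_zero (Hn n) mB) BE//.
  by move=> z; exact: ext_out.
have [v [dv [N [Hv mN N0 dvg dvle]]]] := H10_of_weak_limit g0C g0out g0B.
have mdv : measurable_fun [set: X * X] (ext dv) by apply: measurable_ext; case: Hv.
have dvE A : measurable A -> \int[mu2]_(z in A) ext dv z = \int[mu2]_(z in A) g0 z.
  by move=> mA; exact: (eq_Rintegral_slices mA mN N0).
have wdv A : measurable A -> A `<=` square ->
    (fun n => \int[mu2]_(z in A) ext (dvn n) z) @ U --> \int[mu2]_(z in A) ext dv z.
  by move=> mA AS; rewrite dvE//; exact: wg0.
have dvC : L2bound mu2 (ext dv) (4 * C).
  split => //; case: g0C => _; apply: le_trans; apply: ge0_le_integral => //.
  - by move=> z _; rewrite lee_fin sqr_ge0.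
  - by apply/measurable_EFinP; exact: measurable_funX.
  - by apply/measurable_EFinP; exact: measurable_funX.
  - move=> z _; rewrite lee_fin -[leLHS]real_normK ?num_real// -[leRHS]real_normK ?num_real//.
    by rewrite lerXn2r// nnegrE.
have vC := velocity_L2bound Hv dvC.
have iv : mu2.-integrable square (EFin \o ext v) by exact: (L2bound_integrable vC).
have wv A : measurable A -> A `<=` square ->
    (fun n => \int[mu2]_(z in A) ext (vn n) z) @ U --> \int[mu2]_(z in A) ext v z.
  move=> mA AS; have [h [mh h01 hE]] := velocity_test mA AS.
  rewrite (hE _ _ Hv); last exact: (integrableS mS mA AS iv).
  rewrite (_ : (fun n => _) = fun n => \int[mu2]_(z in square) (ext (dvn n) z * h z)).
    have hb z : square z -> `|h z| <= 1.
      by move=> _; have /andP[? ?] := h01 z; rewrite ger0_norm.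
    have idv : mu2.-integrable square (EFin \o ext dv) by exact: (L2bound_integrable dvC).
    exact: (weak_limit_bounded UU gC mS Soo idv wdv (measurable_funTS mh) hb).
  apply/funext => n; apply: (hE _ _ (Hn n)).
  exact: (L2bound_integrable (gCv n) mA (le_lt_trans (le_measure _ (mem_set mA) (mem_set mS) AS) Soo)).
exists v, dv; split.
- split => //; exists (limit_flow U phin).
  have lf01 t x : t \in `[0, 1] -> x \in `[0, 1] -> limit_flow U phin t x \in `[0, 1].
    by move=> _ _; rewrite in_itv/=; exact: (limit_flow01 UU Ln).
  split.
  + apply: (LagFlow_mk Hv lf01).
    * move=> t; rewrite in_itv/= => t01 x y; rewrite !in_itv/=.
      exact: (limit_flow_mono UU Ln).
    * move=> x; rewrite in_itv/= => x01.
      exists (fun r => limit_flow U phin (clamp r) x).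
        exact: (measurable_limit_flow UU Hn Ln gC x01).
      by move=> r r01; rewrite clamp_id.
    * move=> x; rewrite in_itv/= => x01 s t s0 st t1.
      have mcx := measurable_limit_flow UU Hn Ln gC x01.
      have [_ vE] := H10_flow_integral Hv mcx s0 t1 (fun r _ => limit_flow01 UU Ln _ _).
      rewrite (limit_flow_region UU Hn Ln gC x01 s0 st t1 wdv (@ext_out _ _)) -vE.
      apply: eq_integral => r /set_mem/=; rewrite in_itv/= => /andP[sr rt].
      by rewrite clamp_id// (le_trans s0 sr) (le_trans rt t1).
  + move=> x xI; have x01 : 0 <= x <= 1 by rewrite in_itv in xI.
    have I0 : 0 <= (0 : R) <= 1 by rewrite lexx ler01.
    apply: (ultra_lim_unique UU (limit_flow_cvg UU Ln I0 x01)).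
    under eq_fun do rewrite phin0//.
    by apply: cvg_trans (ana x xI) => B /oU.
  + move=> x xI; have x01 : 0 <= x <= 1 by rewrite in_itv in xI.
    have I1 : 0 <= (1 : R) <= 1 by rewrite lexx ler01.
    apply: (ultra_lim_unique UU (limit_flow_cvg UU Ln I1 x01)).
    under eq_fun do rewrite phin1//.
    by apply: cvg_trans (bnb x xI) => B /oU.
- move=> r Lr.
  (* The two parts of the energy are bounded, hence converge separately along [U]; lower
     semicontinuity is applied to each with its own limit. *)
  have pb n : `|p n| <= C.
    have [_ _ p0 q0 LE] := pq n; rewrite ger0_norm//.
    by have := LC n; rewrite LE lee_fin; lra.
  have qb n : `|q n| <= 4 * C.
    have [_ _ p0 q0 LE] := pq n; rewrite ger0_norm//.
    by have := LC n; rewrite LE lee_fin; lra.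
  have [pU _] := ultra_bounded_cvg UU pb.
  have [qU _] := ultra_bounded_cvg UU qb.
  set pl := lim _ in pU; set ql := lim _ in qU.
  have plql : pl + 4^-1 * ql <= r.
    apply: (cvgr_to_le (cvgD pU (cvgMr qU))).
    by move/oU : Lr; apply: filterS => n; have [_ _ _ _ ->] := pq n; rewrite lee_fin.
  have vp : (\int[mu2]_z (ext v z ^+ 2)%:E <= pl%:E)%E.
    apply/lee_addgt0Pr => e e0; rewrite -EFinD.
    apply: (lsc _ _ _ gCv iv) => //.
    - by case: vC.
    - by move=> z; exact: ext_out.
    - by move=> n z; exact: ext_out.
    move/cvgrPdist_le : pU => /(_ _ e0); apply: filterS => n.
    have [-> _ _ _ _] := pq n; rewrite lee_fin ler_norml => /andP[? ?]; lra.
  have dvq : (\int[mu2]_z (ext dv z ^+ 2)%:E <= ql%:E)%E.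
    apply/lee_addgt0Pr => e e0; rewrite -EFinD.
    apply: (lsc _ _ _ gC) => //.
    - by exact: (L2bound_integrable dvC).
    - by move=> z; exact: ext_out.
    - by move=> n z; exact: ext_out.
    move/cvgrPdist_le : qU => /(_ _ e0); apply: filterS => n.
    have [_ -> _ _ _] := pq n; rewrite lee_fin ler_norml => /andP[? ?]; lra.
  rewrite (Lenergy_ext Hv); apply: (@le_trans _ _ (pl%:E + 4^-1%:E * ql%:E)%E).
    by apply: leeD => //; apply: lee_wpmul2l => //; rewrite lee_fin invr_ge0.
  by rewrite -EFinM -EFinD lee_fin.
Qed.

End compactness.

(** * Existence of admissible fields *)

Section interpolation.
Variable R : realType.
Local Notation mu := (@lebesgue_measure R).
Local Notation X := (measurableTypeR R).
Local Notation I01 := (`[0%R, 1%R]%classic : set X).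
Local Notation square := (@square R).

Definition smoothstep (t : R) : R := t ^+ 2 * (3 - 2 * t).
Definition smoothslope (t : R) : R := 6 * t * (1 - t).

Lemma smoothstep01 t : 0 <= t <= 1 -> 0 <= smoothstep t <= 1.
Proof.
move=> /andP[t0 t1]; rewrite /smoothstep; apply/andP; split.
  by apply: mulr_ge0; [exact: sqr_ge0|lra].
rewrite -subr_ge0 (_ : _ - _ = (1 - t) ^+ 2 * (1 + 2 * t)); last by ring.
by apply: mulr_ge0; [exact: sqr_ge0|lra].
Qed.

(** The constant 12 is the limit at both ends of the quotient of [smoothslope t ^+ 2] by the product
    on the right. *)
Lemma smoothslope_sqr_le t : 0 <= t <= 1 ->
  smoothslope t ^+ 2 <= 12 * (smoothstep t * (1 - smoothstep t)).
Proof.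
move=> /andP[t0 t1]; rewrite -subr_ge0 /smoothslope /smoothstep.
rewrite (_ : _ - _ = 48 * (t * (1 - t)) ^+ 3); last by ring.
by apply: mulr_ge0 => //; apply: exprn_ge0; apply: mulr_ge0; lra.
Qed.

(* With a linear interpolation the energy of a gap opening from zero would
   diverge: the smoothstep makes the speed of a gap vanish like its square root. *)
Lemma smoothstep_gap t (p q : R) : 0 <= t <= 1 -> 0 <= p -> 0 <= q ->
  (smoothslope t * (q - p)) ^+ 2 <=
    12 * (p + q) * ((1 - smoothstep t) * p + smoothstep t * q).
Proof.
move=> t01 p0 q0; have sl := smoothslope_sqr_le t01; have /andP[s0 s1] := smoothstep01 t01.
rewrite exprMn; apply: (@le_trans _ _ (12 * (smoothstep t * (1 - smoothstep t)) * (q - p) ^+ 2)).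
  by rewrite ler_wpM2r// sqr_ge0.
set s := smoothstep t in s0 s1 *; rewrite -subr_ge0.
rewrite (_ : _ - _ = 12 * (((1 - s) * p) ^+ 2 + (s * q) ^+ 2 +
  (1 + 2 * (s * (1 - s))) * (p * q))); last by ring.
have s10 : 0 <= 1 - s by lra.
by rewrite mulr_ge0// addr_ge0 ?addr_ge0 ?sqr_ge0 ?mulr_ge0// addr_ge0// mulr_ge0// mulr_ge0.
Qed.

Lemma smoothstep_FTC (s t k : R) : s < t ->
  (\int[mu]_(r in `[s, t]) (smoothslope r * k)%:E =
    (smoothstep t * k - smoothstep s * k)%:E)%E.
Proof.
move=> st; rewrite EFinB.
have d (x : R) : is_derive x 1 (fun t : R => smoothstep t * k) (smoothslope x * k).
  rewrite /smoothstep /smoothslope; apply: is_derive_eq.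
  rewrite /GRing.scale/=; ring.
have cs : continuous (fun t : R => smoothstep t * k).
  by move=> x; apply/differentiable_continuous/derivable1_diffP; have [] := d x.
have cl : continuous (fun r : R => smoothslope r * k).
  move=> x; apply/differentiable_continuous/derivable1_diffP.
  by rewrite /smoothslope; apply: derivableM => //; do ?apply: derivableM => //.
apply: (continuous_FTC2 (F := fun t : R => smoothstep t * k)) => //.
- exact: continuous_subspaceT.
- split; first by move=> x _; have [] := d x.
  + by apply: cvg_at_right_filter; exact: cs.
  + by apply: cvg_at_left_filter; exact: cs.
- by move=> x _; rewrite derive1E; have [_ ->] := d x.
Qed.

Lemma measurable_smoothstep : measurable_fun [set: X] smoothstep.
Proof. by apply: measurable_funM => //; apply: measurable_funB => //; exact: measurable_funM. Qed.

Lemma measurable_smoothslope : measurable_fun [set: X] smoothslope.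
Proof. by apply: measurable_funM => //; first [exact: measurable_funM|exact: measurable_funB]. Qed.

(** * Fields joining two step maps *)

Section step_data.
Variables (M : nat) (a b : nat -> R) (K : R -> nat).
Hypotheses (a0 : a 0%N = 0) (b0 : b 0%N = 0) (aM : a M = 1) (bM : b M = 1).
Hypothesis amono : forall k, a k <= a k.+1.
Hypothesis bmono : forall k, b k <= b k.+1.
Hypothesis KM : forall x, (K x <= M)%N.
Hypothesis Kmono : {in `[0, 1] &, forall x y, x <= y -> (K x <= K y)%N}.

(** [h k] is the moving [k]-th value, [g k] the gap above it, and [c k] the growth rate of this gap
    relative to its length, that is, the slope of the velocity on [J k]. *)
Let h k (t : X) : R := (1 - smoothstep t) * a k + smoothstep t * b k.
Let g k (t : X) : R := h k.+1 t - h k t.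
(** [powR] with exponent -1 is a measurable inverse, with value 0 at a closed gap. *)
Let c k (t : X) : R :=
  smoothslope t * ((b k.+1 - b k) - (a k.+1 - a k)) * (g k t `^ (-1)).
Let J k (t : X) : set X := `]h k t, h k.+1 t]%classic.
Let dv (t y : R) : R := \sum_(k < M) c k t * \1_(J k t) y.
Let v (t x : R) : R := fine (\int[mu]_(y in `[0%R, x]%classic) (dv t y)%:E)%E.

Let gE k t : g k t = (1 - smoothstep t) * (a k.+1 - a k) + smoothstep t * (b k.+1 - b k).
Proof. by rewrite /g /h; ring. Qed.

Let g0 k t : 0 <= t <= 1 -> 0 <= g k t.
Proof.
move=> /smoothstep01/andP[s0 s1]; rewrite gE.
by rewrite addr_ge0// mulr_ge0// subr_ge0.
Qed.

Let hmono k l t : 0 <= t <= 1 -> (k <= l)%N -> h k t <= h l t.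
Proof.
move=> t01 /subnKC <-; elim: (l - k)%N => [|n IH]; first by rewrite addn0.
by rewrite addnS (le_trans IH)// -subr_ge0; exact: g0.
Qed.

Let hM t : h M t = 1. Proof. by rewrite /h aM bM; ring. Qed.
Let h0 t : h 0%N t = 0. Proof. by rewrite /h a0 b0; ring. Qed.

Let h01 k t : 0 <= t <= 1 -> (k <= M)%N -> 0 <= h k t <= 1.
Proof. by move=> t01 kM; rewrite -{1}(h0 t) -(hM t) !hmono. Qed.

(** When the gap is closed, [smoothstep_gap] forces its speed to vanish too, so the product is
    correct although the inverse is 0. *)
Let c_gap k t : 0 <= t <= 1 ->
  c k t * g k t = smoothslope t * ((b k.+1 - b k) - (a k.+1 - a k)).
Proof.
move=> t01; have gk := g0 k t01; rewrite /c powR_inv1//.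
have [g00|gn0] := eqVneq (g k t) 0; last by rewrite mulfVK.
have A0 : 0 <= a k.+1 - a k by rewrite subr_ge0.
have B0 : 0 <= b k.+1 - b k by rewrite subr_ge0.
have := smoothstep_gap t01 A0 B0; rewrite -gE g00 !mulr0 => sq0.
by apply/esym/eqP; rewrite -sqrf_eq0 eq_le sq0 sqr_ge0.
Qed.

(** The left-hand side is the energy of the slope on [J k t]. Cancelling one factor [g k t] in
    [smoothstep_gap] bounds it by quantities that telescope in [k]. *)
Let c_sqr k t : 0 <= t <= 1 ->
  c k t ^+ 2 * g k t <= 12 * ((a k.+1 - a k) + (b k.+1 - b k)).
Proof.
move=> t01; have gk := g0 k t01.
have A0 : 0 <= a k.+1 - a k by rewrite subr_ge0.
have B0 : 0 <= b k.+1 - b k by rewrite subr_ge0.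
have := smoothstep_gap t01 A0 B0; rewrite -gE -(c_gap k t01) exprMn.
have [->|gn0] := eqVneq (g k t) 0; first by rewrite !mulr0 mulr_ge0// addr_ge0.
have gp : 0 < g k t by rewrite lt_neqAle eq_sym gn0.
by rewrite [in X in X <= _]expr2 mulrA ler_pM2r.
Qed.

Let mJ k t : measurable (J k t). Proof. exact: measurable_itvX. Qed.

Let mu_J k t : 0 <= t <= 1 -> mu (J k t) = (g k t)%:E.
Proof.
move=> t01; rewrite /J lebesgue_measure_itv/= lte_fin.
case: ltP => // hk; apply/esym; congr EFin; apply/eqP.
by rewrite eq_le g0// andbT /g subr_le0.
Qed.

Let J_I01 k t : 0 <= t <= 1 -> (k < M)%N -> J k t `<=` I01.
Proof.
move=> t01 kM y; rewrite /J /= !in_itv/= => /andP[hy yh].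
have /andP[hk0 _] := h01 t01 (ltnW kM); have /andP[_ hk1] := h01 t01 kM.
by rewrite (le_trans hk0 (ltW hy)) (le_trans yh hk1).
Qed.

Let measurable_h k : measurable_fun [set: X] (h k).
Proof.
have ms := measurable_smoothstep.
apply: measurable_funD; apply: measurable_funM => //.
exact: measurable_funB.
Qed.

Let measurable_dv : measurable_fun [set: X * X] (fun p : X * X => dv p.1 p.2).
Proof.
apply: measurable_sum => k.
apply: measurable_funM.
  have mc : measurable_fun [set: X] (c k).
    apply: measurable_funM.
      by apply: measurable_funM => //; exact: measurable_smoothslope.
    have mg : measurable_fun [set: X] (g k) by apply: measurable_funB; exact: measurable_h.
    have mp : measurable_fun [set: X] (fun x : X => x `^ (-1)) by exact: measurable_powR.
    exact: (measurableT_comp mp mg).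
  exact: (measurableT_comp mc measurable_fst).
pose B : set (X * X) := [set p | J k p.1 p.2].
rewrite (_ : (fun p : X * X => _) = (\1_B : X * X -> R)).
  apply: measurable_indic.
  have -> : B = ((fun p : X * X => p.2 - h k p.1) @^-1` `]0, +oo[%classic) `&`
      ((fun p : X * X => h k.+1 p.1 - p.2) @^-1` `[0, +oo[%classic).
    apply/seteqP; split => -[t y]; rewrite /B /J /= !in_itv/= !andbT.
      by move=> /andP[? ?]; rewrite subr_gt0 subr_ge0.
    by rewrite subr_gt0 subr_ge0 => -[-> ->].
  have m1 : measurable_fun [set: X * X] (fun p : X * X => p.2 - h k p.1).
    apply: measurable_funB => //.
    exact: (measurableT_comp (measurable_h k) measurable_fst).
  have m2 : measurable_fun [set: X * X] (fun p : X * X => h k.+1 p.1 - p.2).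
    apply: measurable_funB => //.
    exact: (measurableT_comp (measurable_h k.+1) measurable_fst).
  apply: measurableI; rewrite -[X in measurable X]setTI.
    by apply: m1 => //; exact: measurable_itv.
  by apply: m2 => //; exact: measurable_itv.
by apply/funext => -[t y]; rewrite !indicE; congr (_%:R); congr nat_of_bool; apply/idP/idP => /set_mem/mem_set.
Qed.

Let integrable_J k t (D : set X) : measurable D ->
  mu.-integrable D (EFin \o (\1_(J k t) : X -> R)).
Proof.
move=> mD; apply: (integrableS measurableT mD (@subsetT _ _)).
exact: (integrable_indic_itv (h k t) (h k.+1 t) false false).
Qed.

Let dv_integral t (D : set X) : measurable D ->
  mu.-integrable D (fun y => (dv t y)%:E) /\
  (\int[mu]_(y in D) (dv t y)%:E = \sum_(k < M) (c k t)%:E * mu (J k t `&` D))%E.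
Proof.
move=> mD.
have dvE y : (dv t y)%:E = (\sum_(k < M) (c k t * \1_(J k t) y)%:E)%E.
  by rewrite /dv sumEFin.
have iD k : mu.-integrable D (fun y => (c k t * \1_(J k t) y)%:E).
  exact: (integrableZl mD (c k t) (integrable_J k t mD)).
split.
  under eq_fun do rewrite dvE.
  by apply: integrable_sum => // k _; exact: iD.
transitivity (\int[mu]_(y in D) (\sum_(k < M) (c k t * \1_(J k t) y)%:E))%E.
  by apply: eq_integral => y _; exact: dvE.
rewrite integral_sum//.
apply: eq_bigr => k _.
transitivity (\int[mu]_(y in D) ((c k t)%:E * (\1_(J k t) y)%:E))%E.
  by apply: eq_integral => y _; rewrite -[RHS]EFinM.
rewrite (integralZl mD (integrable_J k t mD)).
by rewrite integral_indic// setIC.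
Qed.

(** The contributions of the gaps below the node telescope to the time derivative of [h j], which
    makes [h j] a flow line. *)
Let v_node t j : 0 <= t <= 1 -> (j <= M)%N -> v t (h j t) = smoothslope t * (b j - a j).
Proof.
move=> t01 jM; have /andP[hj0 hj1] := h01 t01 jM.
have [_ vE] := dv_integral t (measurable_itvX `[0, h j t]).
rewrite /v vE.
transitivity (fine (\sum_(k < M | (k < j)%N)
    (smoothslope t * ((b k.+1 - b k) - (a k.+1 - a k)))%:E)%E).
  congr fine; rewrite [RHS]big_mkcond/=; apply: eq_bigr => k _; case: ifPn => kj.
    rewrite -(c_gap k t01) [RHS]EFinM -(mu_J k t01); congr (_ * mu _)%E.
    apply/setIidPl => y; rewrite /J /= !in_itv/= => /andP[hy yh].
    have /andP[hk0 _] := h01 t01 (ltnW (ltn_ord k)).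
    by rewrite (le_trans hk0 (ltW hy)) (le_trans yh (hmono t01 kj)).
  rewrite (_ : _ `&` _ = set0) ?measure0 ?mule0//.
  apply/seteqP; split => // y; rewrite /J /= !in_itv/= => -[/andP[hy _] /andP[_ yh]].
  move: kj; rewrite -leqNgt => /(hmono t01) jk.
  by have := lt_le_trans hy (le_trans yh jk); rewrite ltxx.
rewrite sumEFin/= -(big_ord_widen _ (fun k : nat =>
  smoothslope t * ((b k.+1 - b k) - (a k.+1 - a k))) jM) -mulr_sumr.
congr (_ * _); rewrite sumrB.
rewrite -(big_mkord xpredT (fun k => b k.+1 - b k)) -(big_mkord xpredT (fun k => a k.+1 - a k)).
by rewrite !telescope_sumr// a0 b0 !subr0.
Qed.

(** The intervals [J k t] are disjoint, so the square has no cross terms. *)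
Let dv_sqr t y : 0 <= t <= 1 ->
  dv t y ^+ 2 = \sum_(k < M) c k t ^+ 2 * \1_(J k t) y.
Proof.
move=> t01; rewrite /dv.
elim: M => [|n IH]; first by rewrite !big_ord0 expr0n.
have recr (F : nat -> R) : \sum_(k < n.+1) F k = \sum_(k < n) F k + F n.
  by rewrite big_ord_recr.
rewrite (recr (fun k => c k t * \1_(J k t) y)) (recr (fun k => c k t ^+ 2 * \1_(J k t) y)).
have -> : \1_(J n t) y = (y \in J n t)%:R :> R by rewrite indicE.
case: (boolP (y \in J n t)) => yn; last by rewrite !mulr0 !addr0.
have z k : (k < n)%N -> (\1_(J k t) y : R) = 0.
  move=> kn; rewrite indicE memNset// /J /= in_itv/= => /andP[_ yh].
  move/set_mem: yn; rewrite /J/= in_itv/= => /andP[hy _].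
  by have := lt_le_trans hy (le_trans yh (hmono t01 kn)); rewrite ltxx.
rewrite !big1 ?add0r ?mulr1// => k _; by rewrite z// mulr0.
Qed.

Let dv_energy t : 0 <= t <= 1 ->
  (\int[mu]_(y in I01) (dv t y ^+ 2)%:E <= 24%:E)%E.
Proof.
move=> t01.
have -> : (\int[mu]_(y in I01) (dv t y ^+ 2)%:E =
    \int[mu]_(y in I01) \sum_(k < M) ((c k t ^+ 2)%:E * (\1_(J k t) y)%:E))%E.
  apply: eq_integral => y _; rewrite dv_sqr// -sumEFin; apply: eq_bigr => k _.
  by rewrite EFinM.
rewrite ge0_integral_sum//; first last.
- by move=> k y _; rewrite -EFinM lee_fin mulr_ge0 ?sqr_ge0// indicE.
- move=> k; apply: measurable_funeM; exact/measurable_EFinP/measurable_funTS/measurable_indic.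
(* The gaps of [a] have total length 1, and so do those of [b]: the bound is twice 12. *)
apply: (@le_trans _ _ (\sum_(k < M) (12 * ((a k.+1 - a k) + (b k.+1 - b k)))%:E)%E).
  apply: lee_sum => k _.
  have mJk : measurable_fun I01 (fun y : X => (\1_(J k t) y : R)%:E).
    exact/measurable_EFinP/measurable_funTS/measurable_indic.
  rewrite ge0_integralZl//;
    try first [by rewrite lee_fin sqr_ge0|by move=> y _; rewrite lee_fin indicE].
  rewrite integral_indic//.
  apply: (@le_trans _ _ ((c k t ^+ 2)%:E * (g k t)%:E)%E).
    rewrite le_eqVlt; apply/orP; left; apply/eqP; congr (_ * _)%E.
    by apply: etrans (mu_J k t01); congr (mu _); exact/setIidPl/J_I01.
  by rewrite -EFinM lee_fin c_sqr.
rewrite sumEFin lee_fin -mulr_sumr big_split/=.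
rewrite -(big_mkord xpredT (fun k => b k.+1 - b k)) -(big_mkord xpredT (fun k => a k.+1 - a k)).
by rewrite !telescope_sumr// a0 b0 aM bM; lra.
Qed.

Let dv_total_energy : (\int[mu]_(t in I01) \int[mu]_(y in I01) (dv t y ^+ 2)%:E <= 24%:E)%E.
Proof.
have mdv : measurable_fun square (fun p : X * X => dv p.1 p.2).
  exact: measurable_funTS.
have me : measurable_fun I01 (fun t : X => \int[mu]_(y in I01) (dv t y ^+ 2)%:E)%E.
  have me2 : measurable_fun [set: X * X] (fun p => (ext dv p ^+ 2)%:E).
    by apply/measurable_EFinP/measurable_funX; exact: measurable_ext.
  have := mu2_tonelli_measurable me2 (fun p => _ : (0 <= (ext dv p ^+ 2)%:E)%E).
  move=> /(_ (fun p => ltac:(rewrite lee_fin; exact: sqr_ge0))) m.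
  have := measurable_funTS (D := I01) m; apply: eq_measurable_fun => t /set_mem/=.
  rewrite in_itv/= => t01; rewrite [RHS]integral_mkcond; apply: eq_integral => y _.
  rewrite /patch; case: ifPn => [/set_mem/=|/negP yI].
    by rewrite in_itv/= => y01; rewrite ext_in.
  by rewrite ext_out ?expr0n// => -[_ /= yI']; apply: yI; exact/mem_set.
apply: (@le_trans _ _ (\int[mu]_(t in I01) 24%:E)%E); last first.
  rewrite le_eqVlt; apply/orP; left; apply/eqP; apply: etrans; first exact: (integral_cst mu (measurable_itvX _)).
  by apply: etrans (mule1 _); congr (_ * _)%E; exact: mu_I01.
apply: ge0_le_integral => //.
- by move=> t _; apply: integral_ge0 => y _; rewrite lee_fin sqr_ge0.
Qed.

Lemma step_Admissible : exists v dv, Admissible (a \o K) (b \o K) v dv /\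
  (Lenergy v dv <= 30%:E)%E.
Proof.
have mI := measurable_itvX (`[0%R, 1%R] : interval R).
have Hv : H10field v dv.
  split.
  - exact: measurable_funTS.
  - exact: le_lt_trans dv_total_energy (ltry _).
  - by move=> t _; have [] := dv_integral t mI.
  - move=> t x tI; rewrite in_itv/= => /andP[x0 x1]; rewrite /v fineK//.
    apply: integrable_fin_num; first exact: measurable_itvX.
    exact: (dv_integral t (measurable_itvX `[0, x])).1.
  - move=> t; rewrite in_itv/= => t01; have := v_node t01 (leqnn M).
    by rewrite hM aM bM subrr mulr0.
have dvE := H10_L2bound Hv dv_total_energy.
exists v, dv; split; last first.
  have [_ vE] := velocity_L2bound Hv dvE; have [_ dvE2] := dvE.
  (* 24 for the velocity by Poincare's inequality, and a quarter of 24 for the derivative. *)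
  rewrite (Lenergy_ext Hv); apply: (@le_trans _ _ (24%:E + 4^-1%:E * 24%:E)%E).
    by apply: leeD => //; apply: lee_wpmul2l => //; rewrite lee_fin invr_ge0.
  by rewrite -EFinM -EFinD lee_fin; lra.
split => //; exists (fun t x => h (K x) t); split.
- have hI t x : t \in `[0, 1] -> x \in `[0, 1] -> h (K x) t \in `[0, 1].
    by rewrite !in_itv/= => t01 _; exact: h01.
  apply: (LagFlow_mk Hv hI).
  + move=> t tI x y xI yI xy; apply: hmono; last exact: Kmono.
    by move: tI; rewrite in_itv.
  + by move=> x _; exists (h (K x)) => //; exact: measurable_h.
  + move=> x _ s t s0 st t1.
    rewrite (_ : \int[mu]_(r in _) _ =
        \int[mu]_(r in `[s, t]) (smoothslope r * (b (K x) - a (K x)))%:E)%E.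
      by rewrite smoothstep_FTC// /h; congr EFin; ring.
    apply: eq_integral => r /set_mem/=; rewrite in_itv/= => /andP[sr rt].
    by rewrite v_node ?KM// (le_trans s0 sr) (le_trans rt t1).
- by move=> x _; rewrite /h /smoothstep/=; ring.
- by move=> x _; rewrite /h /smoothstep/=; ring.
Qed.

End step_data.

Lemma clamp_le x y : x <= y -> clamp x <= clamp y :> R.
Proof.
move=> xy; case: (clampP x) => -[? ->]; case: (clampP y) => -[? ->]; do ?[lra].
all: by do ?match goal with H : is_true (_ <= _ <= _) |- _ => case/andP: H => ? ? end; lra.
Qed.

(** * Approximation of monotone maps by step maps *)

Section approximation.
Variables (phi0 phi1 : R -> R).
Hypotheses (M0 : Monp phi0) (M1 : Monp phi1).

(** The increments of the sum dominate those of both maps, so quantizing it at scale [1 / n.+1]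
    approximates both at once, with the common index that [step_Admissible] requires. *)
Let s x : R := phi0 (clamp x) + phi1 (clamp x).
Let lev (n : nat) x : nat := Num.truncn (n.+1%:R * s x).
Let levsup (phi : R -> R) n k : R :=
  sup [set phi (clamp x) | x in [set x | (lev n x <= k)%N]].
(** The shift by one makes room for the value 0 at index 0 required of the step data, whence the
    index [(lev n x).+1] later on. *)
Let node (phi : R -> R) n k : R := if k is k'.+1 then levsup phi n k' else 0.

Let phi_mono (phi : R -> R) x y : Monp phi -> x <= y -> phi (clamp x) <= phi (clamp y).
Proof. by move=> [_ _ _ m] xy; apply: m; rewrite ?in_itv/= ?clamp01// clamp_le. Qed.

Let phi01 (phi : R -> R) x : Monp phi -> 0 <= phi (clamp x) <= 1.
Proof. by move=> [_ _ + _] => /(_ (clamp x)); rewrite !in_itv/= clamp01; exact. Qed.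

Let s_mono x y : x <= y -> s x <= s y.
Proof. by move=> xy; rewrite lerD// phi_mono. Qed.

Let s_ge0 x : 0 <= s x.
Proof. by have /andP[? _] := phi01 x M0; have /andP[? _] := phi01 x M1; exact: addr_ge0. Qed.

Let lev_mono n x y : x <= y -> (lev n x <= lev n y)%N.
Proof. by move=> xy; apply: le_truncn; rewrite ler_pM2l ?ltr0n// s_mono. Qed.

Let lev0 n : lev n 0 = 0%N.
Proof.
rewrite /lev /s clamp_id ?lexx ?ler01//; case: M0 => -> _ _ _; case: M1 => -> _ _ _.
by rewrite addr0 mulr0 truncn0.
Qed.

Let lev_le n x : (lev n x <= 2 * n.+1)%N.
Proof.
rewrite truncn_le_nat (@le_lt_trans _ _ (2 * n.+1)%:R)// ?ltr_nat//.
rewrite natrM mulrC ler_pM2r ?ltr0n//.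
by have /andP[_ ?] := phi01 x M0; have /andP[_ ?] := phi01 x M1; rewrite /s; lra.
Qed.

Let levsup_has (phi : R -> R) n k : Monp phi ->
  has_sup [set phi (clamp x) | x in [set x | (lev n x <= k)%N]].
Proof.
move=> Mphi; split; first by exists (phi (clamp 0)), 0 => //=; rewrite lev0.
by exists 1 => _ [x _ <-]; have /andP[] := phi01 x Mphi.
Qed.

Let levsup_ub (phi : R -> R) n k x : Monp phi -> (lev n x <= k)%N ->
  phi (clamp x) <= levsup phi n k.
Proof.
move=> Mphi xk; apply: ub_le_sup; first by case: (levsup_has n k Mphi).
by exists x.
Qed.

Let levsup_le (phi : R -> R) n k z : Monp phi ->
  (forall x, (lev n x <= k)%N -> phi (clamp x) <= z) -> levsup phi n k <= z.
Proof.
move=> Mphi xz; apply: ge_sup; first by case: (levsup_has n k Mphi).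
by move=> _ [x /= xk <-]; exact: xz.
Qed.

Let node_mono (phi : R -> R) n k : Monp phi -> node phi n k <= node phi n k.+1.
Proof.
move=> Mphi; case: k => [|k] /=.
  apply: le_trans (levsup_ub (x := 0) Mphi _); last by rewrite lev0.
  by case/andP: (phi01 0 Mphi).
by apply: levsup_le => // x xk; apply: levsup_ub => //; exact: leqW.
Qed.

Let node_last (phi : R -> R) n : Monp phi -> node phi n (2 * n.+1).+1 = 1.
Proof.
move=> Mphi; apply/eqP; rewrite eq_le; apply/andP; split.
  by apply: levsup_le => // x _; case/andP: (phi01 x Mphi).
apply: le_trans (levsup_ub (x := 1) Mphi _); last exact: lev_le.
by rewrite clamp_id ?ler01 ?lexx//; case: Mphi => _ ->.
Qed.

(** In the supremum, points to the left of [x] give at most [phi (clamp x)]. Those to the right have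
    the level of [x], so [s], and with it [phi], has grown by less than [1 / n.+1]. *)
Let node_close (phi : R -> R) n x : Monp phi ->
  (forall x y, x <= y -> phi (clamp y) - phi (clamp x) <= s y - s x) ->
  phi (clamp x) <= node phi n (lev n x).+1 <= phi (clamp x) + n.+1%:R^-1.
Proof.
move=> Mphi lip; apply/andP; split; first exact: levsup_ub.
have n0 : 0 < n.+1%:R :> R by rewrite ltr0n.
apply: levsup_le => // y yx; have [le_yx|/ltW xy] := leP y x.
  by rewrite (le_trans (phi_mono Mphi le_yx))// lerDl invr_ge0 ltW.
rewrite -lerBlDl (le_trans (lip _ _ xy))//.
have yE : lev n y = lev n x by apply/eqP; rewrite eqn_leq yx lev_mono.
have /andP[_ y2] := truncn_itv (mulr_ge0 (ltW n0) (s_ge0 y)).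
have /andP[x1 _] := truncn_itv (mulr_ge0 (ltW n0) (s_ge0 x)).
rewrite -/(lev n y) yE in y2; rewrite -/(lev n x) in x1.
rewrite -(ler_pM2l n0) mulfV ?gt_eqF// mulrBr.
by move: y2; rewrite -natr1; lra.
Qed.

Lemma Admissible_exists : exists v dv : R -> R -> R,
  Admissible phi0 phi1 v dv /\ (Lenergy v dv <= 30%:E)%E.
Proof.
have approx n : exists vd : (R -> R -> R) * (R -> R -> R),
    Admissible (node phi0 n \o (fun x => (lev n x).+1)) (node phi1 n \o (fun x => (lev n x).+1))
      vd.1 vd.2 /\ (Lenergy vd.1 vd.2 <= 30%:E)%E.
  have [v [dv vdv]] := step_Admissible (K := fun x => (lev n x).+1)
    (erefl : node phi0 n 0 = 0) (erefl : node phi1 n 0 = 0) (node_last n M0) (node_last n M1)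
    (fun k => node_mono n k M0) (fun k => node_mono n k M1)
    (fun x => lev_le n x : ((lev n x).+1 <= (2 * n.+1).+1)%N)
    (fun x y _ _ xy => lev_mono n xy).
  by exists (v, dv).
have [vd vdP] := choice approx.
have cvg (phi : R -> R) x : Monp phi ->
    (forall x y, x <= y -> phi (clamp y) - phi (clamp x) <= s y - s x) -> x \in `[0, 1] ->
    (fun n => (node phi n \o (fun x => (lev n x).+1)) x) @ \oo --> phi x.
  move=> Mphi lip; rewrite in_itv/= => x01; apply/cvgrPdist_lt => e e0.
  near=> n.
  have /andP[] := node_close n x Mphi lip; rewrite (clamp_id x01) /= => l1 l2.
  have ne : n.+1%:R^-1 < e by near: n; exact: near_infty_natSinv_lt (PosNum e0).
  by rewrite ler0_norm ?subr_le0// opprB ltrBlDl (le_lt_trans l2)// ltrD2l.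
have lip0 x y : x <= y -> phi0 (clamp y) - phi0 (clamp x) <= s y - s x.
  by move=> /(phi_mono M1); rewrite /s; lra.
have lip1 x y : x <= y -> phi1 (clamp y) - phi1 (clamp x) <= s y - s x.
  by move=> /(phi_mono M0); rewrite /s; lra.
have [v [dv [A Lle]]] := Admissible_compact (fun n => (vdP n).1) (fun n => (vdP n).2)
  (fun x => @cvg phi0 x M0 lip0) (fun x => @cvg phi1 x M1 lip1).
exists v, dv; split => //; apply: Lle; near=> n; exact: (vdP n).2.
Unshelve. all: by end_near. Qed.

End approximation.

End interpolation.

(** * The distance *)

Section distance.
Variable R : realType.
Local Notation mu := (@lebesgue_measure R).
Local Notation X := (measurableTypeR R).
Local Notation I01 := (`[0%R, 1%R]%classic : set X).
Implicit Types (v dv : R -> R -> R).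

Let energies (phi0 phi1 : R -> R) : set (\bar R) :=
  (fun vd : (R -> R -> R) * (R -> R -> R) => Lenergy vd.1 vd.2) @`
    [set vd | Admissible phi0 phi1 vd.1 vd.2].

Lemma Lenergy_ge0 v dv : (0 <= Lenergy v dv)%E.
Proof.
apply: integral_ge0 => t _; apply: integral_ge0 => x _.
by rewrite lee_fin addr_ge0 ?sqr_ge0// divr_ge0 ?sqr_ge0.
Qed.

Lemma Admissible_eq (phi0 phi1 psi0 psi1 : R -> R) v dv :
  (forall x, x \in `[0, 1] -> phi0 x = psi0 x) ->
  (forall x, x \in `[0, 1] -> phi1 x = psi1 x) ->
  Admissible phi0 phi1 v dv -> Admissible psi0 psi1 v dv.
Proof.
move=> e0 e1 [Hv [phi [L p0 p1]]]; split => //; exists phi; split => // x xI.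
- by rewrite p0// e0.
- by rewrite p1// e1.
Qed.

Lemma Lenergy_minimizer (phi0 phi1 : R -> R) : Monp phi0 -> Monp phi1 ->
  exists v dv, Admissible phi0 phi1 v dv /\
    forall v' dv', Admissible phi0 phi1 v' dv' -> (Lenergy v dv <= Lenergy v' dv')%E.
Proof.
move=> M0 M1; have [v0 [dv0 [A0 L0]]] := Admissible_exists M0 M1.
pose m := ereal_inf (energies phi0 phi1).
have m0 : (0 <= m)%E by apply/ereal_infP => _ [[v dv] _ <-]; exact: Lenergy_ge0.
have mfin : m \is a fin_num.
  rewrite ge0_fin_numE//; apply: le_lt_trans (ltry 30); apply: le_trans L0.
  by apply: ereal_inf_lbound; exists (v0, dv0).
have seq n : exists vd : (R -> R -> R) * (R -> R -> R),
    Admissible phi0 phi1 vd.1 vd.2 /\ (Lenergy vd.1 vd.2 <= (fine m + n.+1%:R^-1)%:E)%E.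
  have n0 : 0 < n.+1%:R^-1 :> R by rewrite invr_gt0 ltr0n.
  have [_ [vd A <-] lt] := lb_ereal_inf_adherent n0 mfin.
  by exists vd; split => //; rewrite EFinD fineK// ltW.
have [vd vdP] := choice seq.
have LC n : (Lenergy (vd n).1 (vd n).2 <= (fine m + 1)%:E)%E.
  apply: le_trans (vdP n).2 _; rewrite lee_fin lerD2l invf_le1 ?ltr0n//.
  by rewrite ler1n.
have cst (f : R -> R) x : x \in `[0, 1] -> (fun _ : nat => f x) @ \oo --> f x.
  by move=> _; exact: cvg_cst.
have [v [dv [A Lle]]] := Admissible_compact (fun n => (vdP n).1) LC (cst phi0) (cst phi1).
exists v, dv; split => // v' dv' A'; apply: (@le_trans _ _ m).
  rewrite -(fineK mfin); apply/lee_addgt0Pr => e e0; rewrite -EFinD; apply: Lle.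
  near=> n; apply: le_trans (vdP n).2 _; rewrite lee_fin lerD2l ltW//.
  by near: n; exact: near_infty_natSinv_lt (PosNum e0).
by apply: ereal_inf_lbound; exists (v', dv').
Unshelve. all: by end_near. Qed.

Lemma dMon_ge0 (phi0 phi1 : R -> R) : 0 <= dMon phi0 phi1.
Proof. exact: sqrtr_ge0. Qed.

Lemma dMon_le (phi0 phi1 : R -> R) v dv (c : R) : 0 <= c -> Admissible phi0 phi1 v dv ->
  (Lenergy v dv <= (c ^+ 2)%:E)%E -> dMon phi0 phi1 <= c.
Proof.
move=> c0 A Lc; rewrite -(ler_pXn2r (n := 2)) ?nnegrE ?dMon_ge0//.
have m0 : (0 <= ereal_inf (energies phi0 phi1))%E.
  by apply/ereal_infP => _ [[? ?] _ <-]; exact: Lenergy_ge0.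
have mc : (ereal_inf (energies phi0 phi1) <= (c ^+ 2)%:E)%E.
  by apply: le_trans Lc; apply: ereal_inf_lbound; exists (v, dv).
rewrite sqr_sqrtr ?fine_ge0// -lee_fin fineK// ge0_fin_numE//.
exact: le_lt_trans mc (ltry _).
Qed.

Lemma dMon_attained (phi0 phi1 : R -> R) : Monp phi0 -> Monp phi1 ->
  exists v dv, Admissible phi0 phi1 v dv /\ (Lenergy v dv = (dMon phi0 phi1 ^+ 2)%:E)%E.
Proof.
move=> M0 M1; have [v [dv [A Amin]]] := Lenergy_minimizer M0 M1.
have [v0 [dv0 [A0 L0]]] := Admissible_exists M0 M1.
exists v, dv; split => //.
have -> : dMon phi0 phi1 ^+ 2 = fine (Lenergy v dv).
  rewrite sqr_sqrtr; last first.
    by apply: fine_ge0; apply/ereal_infP => _ [[? ?] _ <-]; exact: Lenergy_ge0.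
  congr fine; apply/eqP; rewrite eq_le; apply/andP; split.
    by apply: ereal_inf_lbound; exists (v, dv).
  by apply/ereal_infP => _ [[? ?] A' <-]; exact: Amin.
rewrite fineK// ge0_fin_numE ?Lenergy_ge0//.
exact: le_lt_trans (le_trans (Amin _ _ A0) L0) (ltry _).
Qed.

Lemma dMon_eq (phi0 phi1 psi0 psi1 : R -> R) :
  (forall x, x \in `[0, 1] -> phi0 x = psi0 x) ->
  (forall x, x \in `[0, 1] -> phi1 x = psi1 x) -> dMon phi0 phi1 = dMon psi0 psi1.
Proof.
move=> e0 e1; rewrite /dMon; congr (Num.sqrt (fine (ereal_inf _))).
apply/seteqP; split => _ [vd A <-]; exists vd => //.
  exact: Admissible_eq A.
by apply: Admissible_eq A => x xI; rewrite ?e0 ?e1.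
Qed.

(** Convergence for [dMon] is thus at least uniform: this separates points and provides the
    pointwise limit of a Cauchy sequence. *)
Lemma dMon_sup (phi0 phi1 : R -> R) x : Monp phi0 -> Monp phi1 -> x \in `[0, 1] ->
  `|phi1 x - phi0 x| <= 2 * dMon phi0 phi1.
Proof.
move=> M0 M1; rewrite in_itv/= => x01.
have [v [dv [[Hv [phi [L p0 p1]]] LE]]] := dMon_attained M0 M1.
have d0 := dMon_ge0 phi0 phi1; set d := dMon _ _ in d0 LE *.
have LC : (Lenergy v dv <= (d ^+ 2)%:E)%E by rewrite LE.
have [p [q [_ qE p0' q0 LE']]] := Lenergy_split Hv LC.
have gC : L2bound (mu2 R) (ext dv) (4 * d ^+ 2).
  split; first by apply: measurable_ext; case: Hv.
  by rewrite qE lee_fin; move: LC; rewrite LE' lee_fin; lra.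
rewrite -p0 ?in_itv// -p1 ?in_itv//; apply/ler_addgt0Pr => e e0.
(* The squared norm of the derivative is at most [4 * d ^+ 2] and the time span is 1, so the best
   [K] is [2 * d]; adding [e] keeps it positive when [d = 0]. *)
have K0 : 0 < 2 * d + e by lra.
have := LagFlow_equicontinuous Hv L gC x01 (lexx 0) ler01 (lexx 1) K0.
move=> /le_trans; apply; rewrite subr0 mulr1.
have : (2 * (2 * d + e))^-1 * (4 * d ^+ 2) <= d; last by lra.
by rewrite ler_pdivrMl ?mulr_gt0//; nra.
Qed.

Lemma Admissible_cst (phi : R -> R) : Monp phi -> Admissible phi phi (fun _ _ => 0) (fun _ _ => 0).
Proof.
move=> [_ _ m01 mono].
have H : H10field (fun _ _ : R => 0) (fun _ _ : R => 0).
  split => //.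
  - rewrite integral0_eq// => t _; rewrite integral0_eq// => x _.
    by rewrite expr0n.
  - by move=> t _; exact: integrable0.
  - by move=> t x _ _; rewrite integral0_eq.
split => //; exists (fun _ => phi); split => //.
apply: (LagFlow_mk H) => //.
- by move=> t x _; exact: m01.
- by move=> x xI; exists (fun=> phi x).
- by move=> x _ s t _ _ _; rewrite subrr integral0_eq.
Qed.

Lemma dMon_eq0 (phi0 phi1 : R -> R) : Monp phi0 -> Monp phi1 ->
  dMon phi0 phi1 = 0 <-> forall x, x \in `[0, 1] -> phi0 x = phi1 x.
Proof.
move=> M0 M1; split => [d0 x xI|e].
  have := dMon_sup M0 M1 xI; rewrite d0 mulr0 normr_le0 subr_eq0.
  by move=> /eqP.
apply/eqP; rewrite eq_le dMon_ge0 andbT.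
have A := Admissible_eq (fun x _ => erefl) e (Admissible_cst M0).
apply: (dMon_le (lexx 0) A); rewrite expr0n /Lenergy integral0_eq// => t _.
by rewrite integral0_eq// => x _; rewrite expr0n/= mul0r addr0.
Qed.

Lemma dMon_sym (phi0 phi1 : R -> R) : Monp phi0 -> Monp phi1 ->
  dMon phi0 phi1 = dMon phi1 phi0.
Proof.
have le (f g : R -> R) : Monp f -> Monp g -> dMon f g <= dMon g f.
  move=> Mf Mg; have [v [dv [A LE]]] := dMon_attained Mg Mf.
  have [v' [dv' [A' LE']]] := Admissible_rev A.
  by apply: (dMon_le (dMon_ge0 _ _) A'); rewrite LE' LE.
by move=> M0 M1; apply/eqP; rewrite eq_le !le.
Qed.

Lemma dMon_triangle (phi0 phi1 phi2 : R -> R) : Monp phi0 -> Monp phi1 -> Monp phi2 ->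
  dMon phi0 phi2 <= dMon phi0 phi1 + dMon phi1 phi2.
Proof.
move=> M0 M1 M2.
(* If one distance vanishes, two of the maps agree on [0, 1] and the claim is immediate; otherwise
   the splitting time used below lies strictly between 0 and 1. *)
have [d0|a0] := eqVneq (dMon phi0 phi1) 0.
  rewrite d0 add0r; have /(dMon_eq0 M0 M1) e := d0.
  by rewrite (dMon_eq e (fun x _ => erefl (phi2 x))).
have [d0|b0] := eqVneq (dMon phi1 phi2) 0.
  rewrite d0 addr0; have /(dMon_eq0 M1 M2) e := d0.
  by rewrite (dMon_eq (fun x _ => erefl (phi0 x)) e).
have ap : 0 < dMon phi0 phi1 by rewrite lt_neqAle eq_sym a0 dMon_ge0.
have bp : 0 < dMon phi1 phi2 by rewrite lt_neqAle eq_sym b0 dMon_ge0.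
have [v1 [dv1 [A1 LE1]]] := dMon_attained M0 M1.
have [v2 [dv2 [A2 LE2]]] := dMon_attained M1 M2.
move: (dMon phi0 phi1) (dMon phi1 phi2) ap bp LE1 LE2 {a0 b0} => a b ap bp LE1 LE2.
have abp : 0 < a + b by rewrite addr_gt0.
(* Splitting the time interval proportionally to the two distances gives a
   concatenation of constant speed. *)
have th01 : 0 < a / (a + b) < 1.
  by rewrite divr_gt0//= ltr_pdivrMr// mul1r ltrDl.
have [v [dv [A LE]]] := Admissible_cat th01 A1 A2.
apply: (dMon_le (ltW abp) A); rewrite LE LE1 LE2 -!EFinM -EFinD lee_fin.
rewrite le_eqVlt; apply/orP; left; apply/eqP.
have -> : 1 - a / (a + b) = b / (a + b) by field; rewrite gt_eqF.
by field; rewrite !gt_eqF.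
Qed.

Lemma Admissible_comp (phi0 phi1 psi : R -> R) v dv :
  (forall x, x \in `[0, 1] -> psi x \in `[0, 1]) ->
  {in `[0, 1] &, forall x y, x <= y -> psi x <= psi y} ->
  Admissible phi0 phi1 v dv -> Admissible (phi0 \o psi) (phi1 \o psi) v dv.
Proof.
move=> pI pm [Hv [phi [[L1 L2 L3] p0 p1]]]; split => //.
exists (fun t x => phi t (psi x)); split; last 2 first.
- by move=> x xI /=; rewrite p0// pI.
- by move=> x xI /=; rewrite p1// pI.
split.
- by move=> t x tI xI; apply: L1 => //; exact: pI.
- by move=> t tI x y xI yI xy; apply: L2; rewrite ?pI//; exact: pm.
- by move=> x xI; exact: L3 (pI x xI).
Qed.

(** Composing with the monotone right inverse [chi] brings admissibility back from the
    reparametrized maps to the original ones, so both pairs have the same admissible fields. *)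
Lemma SmoothIncDiffeo_inv (psi : R -> R) : SmoothIncDiffeo psi ->
  [/\ (forall x, x \in `[0, 1] -> psi x \in `[0, 1]),
      {in `[0, 1] &, forall x y, x <= y -> psi x <= psi y} &
      exists chi : R -> R,
        [/\ (forall x, x \in `[0, 1] -> chi x \in `[0, 1]),
            {in `[0, 1] &, forall x y, x <= y -> chi x <= chi y} &
            forall x, x \in `[0, 1] -> psi (chi x) = x]].
Proof.
move=> [psi0 psi1 psid psip].
have cpsi : {within `[0, 1], continuous psi}.
  by apply: derivable_within_continuous => x xI; exact: (psid 0%N).
have lt x y : 0 <= x -> x < y -> y <= 1 -> psi x < psi y.
  apply: gtr0_derive1_incr => // z zI; [apply: (psid 0%N)|apply: psip].
    exact: subset_itv_oo_cc zI.
  exact: subset_itv_oo_cc zI.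
have mono : {in `[0, 1] &, forall x y, x <= y -> psi x <= psi y}.
  move=> x y; rewrite !in_itv/= => /andP[x0 _] /andP[_ y1].
  by rewrite le_eqVlt => /predU1P[->//|xy]; rewrite ltW// lt.
have I0 : 0 \in `[0, 1 : R] by rewrite in_itv/= lexx ler01.
have I1 : 1 \in `[0, 1 : R] by rewrite in_itv/= lexx ler01.
have pI x : x \in `[0, 1] -> psi x \in `[0, 1].
  move=> xI; have := xI; rewrite !in_itv/= => /andP[x0 x1].
  by rewrite -{1}psi0 -psi1 !mono.
split => //.
have inv y : exists x, y \in `[0, 1] -> x \in `[0, 1] /\ psi x = y.
  have [yI|] := boolP (y \in `[0, 1]); last by exists 0.
  have [|x xI xy] := IVT (v := y) ler01 cpsi; last by exists x.
  by rewrite psi0 psi1 min_l// max_r//; move: yI; rewrite in_itv.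
have [chi chiP] := choice inv.
exists chi; split.
- by move=> x /chiP[].
- move=> x y xI yI xy; have [cx ex] := chiP x xI; have [cy ey] := chiP y yI.
  rewrite leNgt; apply/negP => yx; move: xy; rewrite -ex -ey leNgt => /negP; apply.
  by move: cx cy; rewrite !in_itv/= => /andP[_ ?] /andP[? _]; exact: lt.
- by move=> x /chiP[].
Qed.

Lemma dMon_right_invariant (phi0 phi1 psi : R -> R) : SmoothIncDiffeo psi ->
  dMon (phi0 \o psi) (phi1 \o psi) = dMon phi0 phi1.
Proof.
move=> /SmoothIncDiffeo_inv[pI pm [chi [cI cm pc]]].
rewrite /dMon; congr (Num.sqrt (fine (ereal_inf _))).
apply/seteqP; split => _ [vd A <-]; exists vd => //; last exact: Admissible_comp A.
have := Admissible_comp cI cm A; apply: Admissible_eq => x xI /=; by rewrite pc.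
Qed.

Lemma dMon_complete (u : nat -> R -> R) : (forall n, Monp (u n)) ->
  (forall e : R, 0 < e -> exists N : nat, forall m n : nat,
     (N <= m)%N -> (N <= n)%N -> dMon (u m) (u n) < e) ->
  exists l : R -> R, Monp l /\ (fun n => dMon (u n) l) @ \oo --> (0 : R).
Proof.
move=> Mu cu; pose l x : R := lim ((fun n => u n x) @ \oo).
have ul x : x \in `[0, 1] -> (fun n => u n x) @ \oo --> l x.
  move=> xI; apply/cauchy_cvgP; apply: cauchy_exP => e e0.
  have e4 : 0 < e / 4 by lra.
  have [N Nu] := cu _ e4; exists (u N x); exists N => // n /= Nn.
  rewrite /ball/=; apply: le_lt_trans (dMon_sup (Mu n) (Mu N) xI) _.
  by have := Nu n N Nn (leqnn N); lra.
have I0 : 0 \in `[0, 1 : R] by rewrite in_itv/= lexx ler01.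
have I1 : 1 \in `[0, 1 : R] by rewrite in_itv/= lexx ler01.
have Ml : Monp l.
  split.
  - have c0 : (fun n => u n 0) @ \oo --> (0 : R).
      rewrite (_ : (fun n => u n 0) = fun=> 0); first exact: cvg_cst.
      by apply/funext => n; case: (Mu n).
    exact: (cvg_unique _ (ul 0 I0) c0).
  - have c1 : (fun n => u n 1) @ \oo --> (1 : R).
      rewrite (_ : (fun n => u n 1) = fun=> 1); first exact: cvg_cst.
      by apply/funext => n; case: (Mu n).
    exact: (cvg_unique _ (ul 1 I1) c1).
  - move=> x xI; rewrite in_itv/=; apply/andP; split.
      apply: (cvgr_to_ge (ul x xI)); apply: nearW => n.
      by case: (Mu n) => _ _ /(_ x xI) + _; rewrite in_itv => /andP[].
    apply: (cvgr_to_le (ul x xI)); apply: nearW => n.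
    by case: (Mu n) => _ _ /(_ x xI) + _; rewrite in_itv => /andP[].
  - move=> x y xI yI xy; apply: (ler_cvg_to (ul x xI) (ul y yI)); apply: nearW => n.
    by case: (Mu n) => _ _ _; apply.
exists l; split => //; apply/cvgrPdist_le => e e0.
have [N Nu] := cu _ e0; exists N => // n /= Nn.
rewrite sub0r normrN ger0_norm ?dMon_ge0//.
(* With [n] fixed, fields from [u n] to [u (m + N)] of energy at most [e ^+ 2] have a compactness
   limit joining [u n] to [l]; the shift by [N] makes the bound valid for every [m]. *)
have min m : exists vd : (R -> R -> R) * (R -> R -> R),
    Admissible (u n) (u (m + N)%N) vd.1 vd.2 /\ (Lenergy vd.1 vd.2 <= (e ^+ 2)%:E)%E.
  have [v [dv [A LE]]] := dMon_attained (Mu n) (Mu (m + N)%N).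
  exists (v, dv); split => //; rewrite LE lee_fin lerXn2r ?nnegrE ?dMon_ge0 ?ltW//.
  by apply: Nu => //; exact: leq_addl.
have [vd vdP] := choice min.
have ulN x : x \in `[0, 1] -> (fun m => u (m + N)%N x) @ \oo --> l x.
  by move=> xI; have := ul x xI; rewrite -(cvg_shiftn N).
have cst x : x \in `[0, 1] -> (fun _ : nat => u n x) @ \oo --> u n x.
  by move=> _; exact: cvg_cst.
have [v [dv [A Lle]]] := Admissible_compact (fun m => (vdP m).1) (fun m => (vdP m).2) cst ulN.
by apply: (dMon_le (ltW e0) A); apply: Lle; apply: nearW => m; exact: (vdP m).2.
Qed.

End distance.

Theorem theorem1 (R : realType) :
  (* existence of a minimizer (hence nonemptiness of the admissible set) *)
  (forall phi0 phi1 : R -> R, Monp phi0 -> Monp phi1 ->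
     exists v dv : R -> R -> R, Admissible phi0 phi1 v dv /\
       forall v' dv', Admissible phi0 phi1 v' dv' ->
         (Lenergy v dv <= Lenergy v' dv')%E) /\
  (* d is a distance on Mon_+ *)
  (forall phi0 phi1 : R -> R, Monp phi0 -> Monp phi1 ->
     dMon phi0 phi1 = 0 <-> forall x, x \in `[0, 1] -> phi0 x = phi1 x) /\
  (forall phi0 phi1 : R -> R, Monp phi0 -> Monp phi1 ->
     dMon phi0 phi1 = dMon phi1 phi0) /\
  (forall phi0 phi1 phi2 : R -> R, Monp phi0 -> Monp phi1 -> Monp phi2 ->
     dMon phi0 phi2 <= dMon phi0 phi1 + dMon phi1 phi2) /\
  (* right invariance *)
  (forall (phi0 phi1 psi : R -> R), Monp phi0 -> Monp phi1 ->
     SmoothIncDiffeo psi ->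
     dMon (phi0 \o psi) (phi1 \o psi) = dMon phi0 phi1) /\
  (* completeness *)
  (forall u : nat -> R -> R, (forall n, Monp (u n)) ->
     (forall e : R, 0 < e -> exists N : nat, forall m n : nat,
        (N <= m)%N -> (N <= n)%N -> dMon (u m) (u n) < e) ->
     exists l : R -> R, Monp l /\ (fun n => dMon (u n) l) @ \oo --> (0 : R)).
Proof.
split; first exact: Lenergy_minimizer.
split; first exact: dMon_eq0.
split; first exact: dMon_sym.
split; first exact: dMon_triangle.
split; first by move=> phi0 phi1 psi _ _; exact: dMon_right_invariant.
exact: dMon_complete.
Qed.
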